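(* Let the coefficients $f,\kappa,\sigma$ satisfy the assumptions (A1), (A2), (A3) listed in the context, and let $x_t$ and $X_t^{\varepsilon,\delta}$ be the solutions of $$\frac{dx_t}{dt}=f(x_t)+\kappa(x_t),\quad x(0)=x_0,\qquad dX_t^{\varepsilon,\delta}=\{f(X_t^{\varepsilon,\delta})+\kappa(X_{\pi_\delta(t)}^{\varepsilon,\delta})\}\,dt+\varepsilon\sigma(X_t^{\varepsilon,\delta})\,dW_t,\quad X_0^{\varepsilon,\delta}=x_0 .$$ Let $\delta=\delta_\varepsilon$ be such that the limit $\mathsf c:=\lim_{\varepsilon\searrow0}\delta_\varepsilon/\varepsilon$ exists in $[0,\infty)$, and let $Z_t^{\varepsilon,\delta}:=\varepsilon^{-1}(X_t^{\varepsilon,\delta}-x_t)$. Let $Z=\{Z_t:t\ge0\}$ be the unique solution of $$Z_t=\int_0^t[Df(x_s)+D\kappa(x_s)]Z_s\,ds-\frac{\mathsf c}{2}\int_0^tD\kappa(x_s)[f(x_s)+\kappa(x_s)]\,ds+\int_0^t\sigma(x_s)\,dW_s .$$ Then for every integer $p\ge1$ there exists a constant $C>0$, independent of time $t$ and of $\varepsilon,\delta$, such that for all sufficiently small $\varepsilon,\delta>0$, $$\sup_{t\ge0}\mathbb E\left[|Z_t^{\varepsilon,\delta}-Z_t|^p\right]=\frac1{\varepsilon^p}\sup_{t\ge0}\mathbb E\left[|X_t^{\varepsilon,\delta}-x_t-\varepsilon Z_t|^p\right]\le C\left[\frac{\delta^{2p}}{\varepsilon^p}+\left|\frac\delta\varepsilon-\mathsf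 c\right|^p+\left(\frac{\delta^p}{\varepsilon^p}+1\right)\left(\delta^p+\varepsilon^p+\delta^{p/2}\varepsilon^p\right)^{1/2}+\delta^{p/2}+\varepsilon^p\right].$$
   Context: $f,\kappa,\sigma:\mathbb R\to\mathbb R$ are functions, $x_0\in\mathbb R$ is deterministic, $W=\{W_t:t\ge0\}$ is a standard one-dimensional Brownian motion on a probability space $(\Omega,\mathscr F,\mathbb P)$ (the same $W$ drives $X^{\varepsilon,\delta}$ and $Z$), and $\pi_\delta(t)=\delta\lfloor t/\delta\rfloor$ for $\delta>0$, $t\ge 0$. $Dh$ and $D^2h$ denote first and second derivatives. It is assumed that the coefficients are such that the SDE for $X^{\varepsilon,\delta}$ has a unique, at least weak, solution. (A1) There exist positive numbers $q,\xi,\mu$ and Lipschitz constants $L_\kappa,L_\sigma$ such that for all $x,y\in\mathbb R$: $|f(x)-f(y)|\le[\xi(|x|^q+|y|^q)+\mu]|x-y|$, $|\kappa(x)-\kappa(y)|\le L_\kappa|x-y|$, $|\sigma(x)-\sigma(y)|\le L_\sigma|x-y|$. Moreover there is $\lambda>0$ such that $(x-y)(f(x)-f(y))\le-\lambda|x-y|^2$ for all $x,y\in\mathbb R$, and $\frac{\lambda}{2}-L_\kappa>0$. (A2) There exists $\gamma<\infty$ such that $|\sigma(x)|+|\kappa(x)|\le\gamma$ for all $x\in\mathbb R$. (A3) $f,\kappa$ are twice differentiable and for $m\in\{1,2\}$ there is a time-independent constant $C'>0$ such that $\sup_{t\ge0}\int_0^te^{\int_s^tm[Df(x_u)+D\kappa(x_u)]\,du}\,ds\le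 C'$. The second derivative of $\kappa$ is uniformly bounded and the second derivative of $f$ grows at most polynomially. The constant $C$ may depend on $p$, $x_0$, $\mathsf c$ and the coefficients, but not on $t,\varepsilon,\delta$. *)

(* Defs.v *)
From HB Require Import structures.
From mathcomp Require Import all_boot all_order all_algebra.
From mathcomp Require Import all_classical all_reals all_analysis.

Set Implicit Arguments.
Unset Strict Implicit.
Unset Printing Implicit Defensive.

Import Order.TTheory GRing.Theory Num.Theory.
Import numFieldNormedType.Exports.

Local Open Scope classical_set_scope.
Local Open Scope ring_scope.

(* Processes are functions [R -> T -> R] (time, then sample point) and
   filtrations are functions [R -> set_system T]; both are constrained only at
   times [t >= 0], their values at negative times are irrelevant. *)

Section stochastic_basis.
Context {R : realType} {d : measure_display} {T : measurableType d}.
Implicit Types (F : R -> set_system T) (X W H I : R -> T -> R).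

Definition is_filtration F : Prop :=
  [/\ forall t : R, 0 <= t -> sigma_algebra setT (F t),
      forall t : R, 0 <= t -> F t `<=` measurable
    & forall s t : R, 0 <= s -> s <= t -> F s `<=` F t].

Definition measurable_wrt (G : set_system T) (g : T -> R) : Prop :=
  forall B : set R, measurable B -> G (g @^-1` B).

Definition adapted F X : Prop :=
  forall t : R, 0 <= t -> measurable_wrt (F t) (X t).

Definition continuous_paths X : Prop :=
  forall w, {within `[0, +oo[, continuous (fun t : R => X t w)}.

(* [normal_prob m s] has standard deviation [s], hence the square root. *)
Definition is_brownian_motion (P : probability T R) F W : Prop :=
  [/\ adapted F W, continuous_paths W, {ae P, forall w, W 0 w = 0},
      forall s t : R, 0 <= s -> s < t -> forall B : set R, measurable B ->
        P ((fun w => W t w - W s w) @^-1` B)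
        = normal_prob 0 (Num.sqrt (t - s)) B
    & forall s t : R, 0 <= s -> s < t ->
        forall (A : set T) (B : set R), F s A -> measurable B ->
        P (A `&` (fun w => W t w - W s w) @^-1` B)
        = (P A * P ((fun w => (W t w - W s w)%R) @^-1` B))%E].

(* The simple process
   G_s(w) = \sum_(i < n) xi_i(w) 1_{]t_i, t_(i+1)]}(s). *)
Record simple_process F := SimpleProcess {
  sp_size : nat;
  sp_time : nat -> R;
  sp_coef : nat -> T -> R;
  sp_time_ge0 : forall i, 0 <= sp_time i;
  sp_time_le : forall i, sp_time i <= sp_time i.+1;
  sp_coef_measurable : forall i, measurable_wrt (F (sp_time i)) (sp_coef i);
  sp_coef_bounded : forall i, exists K, forall w, `|sp_coef i w| <= K }.

Definition sp_eval F (G : simple_process F) (s : R) (w : T) : R :=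
  \sum_(i < sp_size G)
    sp_coef G i w * \1_(`]sp_time G i, sp_time G i.+1]) s.

Definition sp_integral F (G : simple_process F) W (t : R) (w : T) : R :=
  \sum_(i < sp_size G)
    sp_coef G i w * (W (Num.min t (sp_time G i.+1)) w
                     - W (Num.min t (sp_time G i)) w).

(* Convergence to 0 in probability of nonnegative variables. *)
Definition cvg0_in_probability (P : probability T R)
    (U : nat -> T -> \bar R) : Prop :=
  forall e : R, 0 < e ->
    (fun n => P [set w | (e%:E <= U n w)%E]) @ \oo --> 0%E.

(* [I] is (a continuous adapted version of) the Ito integral process
   t |-> \int_0^t H_s dW_s: the limit in probability of the integrals of simple
   processes G_n such that \int_0^t |G_n - H|^2 ds tends to 0 in probability
   for every t.  Only applied below to continuous adapted integrands, which are
   progressively measurable and pathwise square-integrable on [0, t]. *)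
Definition is_ito_integral (P : probability T R) F W H I : Prop :=
  [/\ adapted F I, continuous_paths I &
    exists G : nat -> simple_process F, forall t : R, 0 <= t ->
      cvg0_in_probability P (fun n w =>
        (\int[lebesgue_measure]_(s in `[0%R, t])
           ((sp_eval (G n) s w - H s w) ^+ 2)%:E)%E)
      /\ cvg0_in_probability P (fun n w =>
           (`|sp_integral (G n) W t w - I t w|)%:E)].

End stochastic_basis.

Section equations.
Context {R : realType}.
Implicit Types (f kappa sigma x : R -> R) (eps delta c : R).

Definition ode_solution f kappa (x0 : R) x : Prop :=
  [/\ x 0 = x0, {within `[0, +oo[, continuous x} &
      forall t : R, 0 < t -> is_derive t 1 x (f (x t) + kappa (x t))].

Definition pi_ delta (t : R) : R := delta * (Num.floor (t / delta))%:~R.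

(* dX_t = {f(X_t) + kappa(X_{pi_delta(t)})} dt + eps sigma(X_t) dW_t,
   X_0 = x0. *)
Definition sde_solution f kappa sigma (x0 : R) eps delta
    (d : measure_display) (T : measurableType d) (P : probability T R)
    (F : R -> set_system T) (W X : R -> T -> R) : Prop :=
  [/\ adapted F X, continuous_paths X &
    exists M : R -> T -> R,
      is_ito_integral P F W (fun s w => eps * sigma (X s w)) M /\
      {ae P, forall w, forall t : R, 0 <= t ->
        X t w = x0
          + \int[lebesgue_measure]_(s in `[0, t])
              (f (X s w) + kappa (X (pi_ delta s) w))
          + M t w}].

Definition weak_existence f kappa sigma (x0 : R) eps delta : Prop :=
  exists (d : measure_display) (T : measurableType d) (P : probability T R)
    (F : R -> set_system T) (W X : R -> T -> R),
    [/\ is_filtration F, is_brownian_motion P F W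
      & sde_solution f kappa sigma x0 eps delta P F W X].

(* Uniqueness in law, through the finite-dimensional distributions. *)
Definition weak_uniqueness f kappa sigma (x0 : R) eps delta : Prop :=
  forall (d1 : measure_display) (T1 : measurableType d1)
    (P1 : probability T1 R) (F1 : R -> set_system T1) (W1 X1 : R -> T1 -> R)
    (d2 : measure_display) (T2 : measurableType d2)
    (P2 : probability T2 R) (F2 : R -> set_system T2) (W2 X2 : R -> T2 -> R),
    is_filtration F1 -> is_brownian_motion P1 F1 W1 ->
    sde_solution f kappa sigma x0 eps delta P1 F1 W1 X1 ->
    is_filtration F2 -> is_brownian_motion P2 F2 W2 ->
    sde_solution f kappa sigma x0 eps delta P2 F2 W2 X2 ->
    forall (n : nat) (ts : 'I_n -> R) (B : 'I_n -> set R),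
      (forall i, 0 <= ts i) -> (forall i, measurable (B i)) ->
      P1 [set w | forall i, B i (X1 (ts i) w)]
      = P2 [set w | forall i, B i (X2 (ts i) w)].

(* Z_t = \int_0^t [Df(x_s) + Dkappa(x_s)] Z_s ds
         - c/2 \int_0^t Dkappa(x_s) [f(x_s) + kappa(x_s)] ds
         + \int_0^t sigma(x_s) dW_s. *)
Definition limit_solution f kappa sigma x c
    (d : measure_display) (T : measurableType d) (P : probability T R)
    (F : R -> set_system T) (W Z : R -> T -> R) : Prop :=
  [/\ adapted F Z, continuous_paths Z &
    exists M : R -> T -> R,
      is_ito_integral P F W (fun s _ => sigma (x s)) M /\
      {ae P, forall w, forall t : R, 0 <= t ->
        Z t w =
          \int[lebesgue_measure]_(s in `[0, t])
            ((derive1 f (x s) + derive1 kappa (x s)) * Z s w)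
          - c / 2 * \int[lebesgue_measure]_(s in `[0, t])
              (derive1 kappa (x s) * (f (x s) + kappa (x s)))
          + M t w}].

Definition assumption_A1 f kappa sigma : Prop :=
  exists q xi mu Lkappa Lsigma lambda : R,
    [/\ 0 < q, 0 < xi & 0 < mu] /\
    [/\ forall x y : R,
          `|f x - f y| <= (xi * (`|x| `^ q + `|y| `^ q) + mu) * `|x - y|,
        forall x y : R, `|kappa x - kappa y| <= Lkappa * `|x - y|
      & forall x y : R, `|sigma x - sigma y| <= Lsigma * `|x - y|] /\
    [/\ 0 < lambda,
        forall x y : R, (x - y) * (f x - f y) <= - lambda * `|x - y| ^+ 2
      & 0 < lambda / 2 - Lkappa].

Definition assumption_A2 kappa sigma : Prop :=
  exists gamma : R, forall x : R, `|sigma x| + `|kappa x| <= gamma.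

Definition twice_differentiable (g : R -> R) : Prop :=
  forall y : R, derivable g y 1 /\ derivable (derive1 g) y 1.

Definition assumption_A3 f kappa x : Prop :=
  [/\ twice_differentiable f, twice_differentiable kappa,
      forall m : nat, (1 <= m <= 2)%N ->
        exists C' : R, 0 < C' /\
          (ereal_sup [set \int[lebesgue_measure]_(s in `[0%R, t])
             (expR (\int[lebesgue_measure]_(u in `[s, t])
                (m%:R * (derive1 f (x u) + derive1 kappa (x u))))%R)%:E
             | t in `[0%R, +oo[] <= C'%:E)%E,
      exists K : R, forall y : R, `|derive1n 2 kappa y| <= K
    & exists (K : R) (r : nat), forall y : R, `|derive1n 2 f y| <= K * (1 + `|y| ^+ r)].

End equations.

(* Main.v *)
Require Import Defs.
From HB Require Import structures.
From mathcomp Require Import all_boot all_order all_algebra.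
From mathcomp Require Import all_classical all_reals all_analysis.
From mathcomp Require Import measurable_realfun.
From mathcomp Require Import ring lra zify.

Set Implicit Arguments.
Unset Strict Implicit.
Unset Printing Implicit Defensive.

Import Order.TTheory GRing.Theory Num.Theory.
Import numFieldNormedType.Exports.

Local Open Scope classical_set_scope.
Local Open Scope ring_scope.

Lemma lee_mulEFin (R : realType) (k a : R) (x : \bar R) :
  0 <= k -> (x <= a%:E)%E -> (k%:E * x <= (k * a)%:E)%E.
Proof. by move=> k0 xa; rewrite EFinM lee_wpmul2l. Qed.

Section gaussian.
Context {R : realType}.
Local Notation mu := (@lebesgue_measure R).
Import HBNNSimple.

Lemma ge0_integral_normal (m s : R) (f : R -> R) :
  measurable_fun setT f -> (forall x, 0 <= f x) ->
  (\int[normal_prob m s]_x (f x)%:E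
   = \int[mu]_x (f x * normal_pdf m s x)%:E)%E.
Proof.
move=> mf f0.
have mpdf : measurable_fun setT (EFin \o normal_pdf m s).
  by apply/measurable_EFinP; exact: measurable_normal_pdf.
have mF : measurable_fun setT (EFin \o f) by exact/measurable_EFinP.
have dom := normal_prob_dominates m s.
rewrite -(Radon_Nikodym_SigmaFinite.change_of_variables dom (f := EFin \o f))//.
transitivity (\int[mu]_x ((EFin \o f) x * (EFin \o normal_pdf m s) x)%E)%E.
  apply: ae_eq_integral => //.
  - apply: emeasurable_funM => //; apply: (measurable_int mu).
    exact: Radon_Nikodym_SigmaFinite.f_integrable dom.
  - exact: emeasurable_funM.
  - apply: ae_eqe_mul2l => /=.
    apply: integral_ae_eq => //=.
    + exact: Radon_Nikodym_SigmaFinite.f_integrable dom.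
    + move=> E _ mE.
      by rewrite -Radon_Nikodym_SigmaFinite.f_integral.
by [].
Qed.

Lemma expR_ge_expn (x : R) n : 0 <= x -> x ^+ n <= n`!%:R * expR x.
Proof.
move=> x0; case: n => [|n]; first by rewrite expr0 fact0 mul1r -expR0 ler_expR.
rewrite mulrC -ler_pdivrMr ?ltr0n ?fact_gt0//.
by apply: le_trans (expR_ge1Dxn n x0); rewrite lerDr.
Qed.

Lemma ge0_integral_oppr (f : R -> R) : measurable_fun setT f ->
  (forall x, 0 <= f x) ->
  (\int[mu]_x (f (- x))%:E = \int[mu]_x (f x)%:E)%E.
Proof.
move=> mf f0.
have mN : measurable_fun setT (-%R : measurableTypeR R -> measurableTypeR R) by [].
have := @ge0_integral_pushforward _ _ _ _ R _ mN mu setT (EFin \o f).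
rewrite preimage_setT => <-//.
- by apply: eq_measure_integral => //= A mA AS; exact/lebesgue_measureN.
- exact/measurable_EFinP.
- by move=> x _; rewrite lee_fin.
Qed.

Lemma ge0_integral_normal_oppr (s : R) (f : R -> R) : s != 0 ->
  measurable_fun setT f -> (forall x, 0 <= f x) ->
  (\int[normal_prob 0 s]_x (f (- x))%:E = \int[normal_prob 0 s]_x (f x)%:E)%E.
Proof.
move=> s0 mf f0; rewrite !ge0_integral_normal//; last first.
  by apply: measurableT_comp.
rewrite -[RHS]ge0_integral_oppr; first last.
- by move=> x; rewrite mulr_ge0// normal_pdf_ge0.
- by apply: measurable_funM => //; exact: measurable_normal_pdf.
- apply: eq_integral => x _; congr (_ * _)%:E.
  by rewrite !normal_pdfE//= /normal_fun !subr0 sqrrN.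
Qed.

Definition gauss_cst (m : nat) : R := 4 ^+ m * m`!%:R * Num.sqrt 2.

Lemma gauss_cst_ge0 m : 0 <= gauss_cst m.
Proof. by rewrite !mulr_ge0// exprn_ge0. Qed.

Lemma normal_even_moment (s : R) m : 0 < s ->
  (\int[normal_prob 0 s]_v (v ^+ m.*2)%:E <= (gauss_cst m * s ^+ m.*2)%:E)%E.
Proof.
move=> s0.
have e0 (v : R) : 0 <= v ^+ m.*2 by rewrite exprn_even_ge0// odd_double.
have q0 : 0 < Num.sqrt 2 * s by rewrite mulr_gt0 ?sqrtr_gt0.
rewrite ge0_integral_normal//.
pose c : R := gauss_cst m * s ^+ m.*2.
have c0 : 0 <= c by rewrite mulr_ge0 ?gauss_cst_ge0 ?exprn_ge0 ?ltW.
have peakE : normal_peak s = Num.sqrt 2 * normal_peak (Num.sqrt 2 * s).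
  rewrite /normal_peak exprMn sqr_sqrtr// -!mulrnAr -[in RHS]mulrA.
  rewrite [in RHS]sqrtrM// invfM mulrA divff ?mul1r// gt_eqF// sqrtr_gt0//.
(* Halving the rate of Gaussian decay pays for the polynomial factor. *)
have pw (v : R) :
    v ^+ m.*2 * normal_pdf 0 s v <= c * normal_pdf 0 (Num.sqrt 2 * s) v.
  rewrite !normal_pdfE ?gt_eqF//= /normal_fun subr0 exprMn sqr_sqrtr// peakE.
  pose u := v ^+ 2 / (4 * s ^+ 2).
  have u0 : 0 <= u by rewrite divr_ge0 ?sqr_ge0// mulr_ge0// sqr_ge0.
  have sn0 : s != 0 by rewrite gt_eqF.
  have -> : v ^+ m.*2 = 4 ^+ m * s ^+ m.*2 * u ^+ m.
    rewrite -!muln2 !(mulnC m) !exprM -!exprMn; congr (_ ^+ m).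
    by rewrite /u; field.
  have -> : - v ^+ 2 / (s ^+ 2 *+ 2) = - u - u by rewrite /u; field.
  have -> : - v ^+ 2 / (2 * s ^+ 2 *+ 2) = - u by rewrite /u; field.
  have H : u ^+ m * expR (- u) <= m`!%:R.
    have := ler_wpM2r (expR_ge0 (- u)) (expR_ge_expn m u0).
    by rewrite -[leRHS]mulrA expRxMexpNx_1 mulr1.
  rewrite expRD.
  rewrite /c /gauss_cst.
  set A := 4 ^+ m; set S := s ^+ m.*2; set q := Num.sqrt 2.
  set k := normal_peak _; set E := expR (- u); set F := m`!%:R.
  rewrite [leLHS](_ : _ = A * S * q * k * E * (u ^+ m * E)); last by ring.
  rewrite [leRHS](_ : _ = A * S * q * k * E * F); last by ring.
  apply: ler_wpM2l => //.
  by rewrite !mulr_ge0 /A /S /q /k /E ?exprn_ge0 ?normal_peak_ge0 ?expR_ge0// ltW.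
apply: (@le_trans _ _ (\int[mu]_v (c%:E * (normal_pdf 0 (Num.sqrt 2 * s) v)%:E))%E).
  apply: ge0_le_integral => //.
  - by move=> v _; rewrite lee_fin mulr_ge0// normal_pdf_ge0.
  - apply/measurable_EFinP/measurable_funM => //; exact: measurable_normal_pdf.
  - apply: measurable_funeM; apply/measurable_EFinP; exact: measurable_normal_pdf.
  - by move=> v _; rewrite -EFinM lee_fin; exact: pw.
rewrite ge0_integralZl//; first by rewrite integral_normal_pdf mule1.
- apply/measurable_EFinP; exact: measurable_normal_pdf.
- by move=> v _; rewrite lee_fin normal_pdf_ge0.
Qed.

End gaussian.

Lemma sum_even_pow_le (R : realType) (s z : R) m : (0 < m)%N ->
  (s + z) ^+ m.*2 + (s - z) ^+ m.*2 <=
  2 * s ^+ m.*2 + 2 * 2 ^+ m.*2 * (s ^+ (m.-1).*2 * z ^+ 2 + z ^+ m.*2).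
Proof.
move=> m0; set n := m.*2.
have n2 : (2 <= n)%N by rewrite /n; case: m m0 {n}.
have nE : (m.-1.*2 = n - 2)%N by rewrite /n; case: m m0 {n n2} => // m _; rewrite doubleS subn2.
have on : odd n = false by rewrite odd_double.
have [sE zE] : s ^+ n = `|s| ^+ n /\ z ^+ n = `|z| ^+ n.
  by split; rewrite -normrX ger0_norm// exprn_even_ge0// on.
rewrite nE [X in _ + _ * (X * _ + _)](_ : _ = `|s| ^+ (n - 2)); last first.
  by rewrite -normrX ger0_norm// exprn_even_ge0// oddB// on.
rewrite -[z ^+ 2]real_normK ?num_real// zE sE.
set a : R := `|s|; set b : R := `|z|.
have a0 : 0 <= a by exact: normr_ge0.
have b0 : 0 <= b by exact: normr_ge0.
set K := a ^+ (n - 2) * b ^+ 2 + b ^+ n.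
have K0 : 0 <= K by rewrite addr_ge0// ?mulr_ge0// exprn_ge0.
have key i : (2 <= i <= n)%N -> a ^+ (n - i) * b ^+ i <= K.
  move=> /andP[i2 iN]; rewrite /K; have [ba|ab] := leP b a.
    apply: (@le_trans _ _ (a ^+ (n - 2) * b ^+ 2)); last by rewrite lerDl exprn_ge0.
    rewrite -(subnK i2) exprD mulrA ler_wpM2r ?exprn_ge0//.
    have -> : (n - 2 = (n - (i - 2 + 2)) + (i - 2))%N by lia.
    by rewrite [in leRHS]exprD ler_wpM2l ?exprn_ge0// lerXn2r// nnegrE.
  apply: (@le_trans _ _ (b ^+ n)); last by rewrite lerDr mulr_ge0// exprn_ge0.
  by rewrite -[in leRHS](subnK iN) exprD ler_wpM2r ?exprn_ge0// lerXn2r ?nnegrE// ltW.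
rewrite (exprDn s z) (exprDn s (- z)) -big_split/= big_ord_recl/= subn0 !expr0 !mulr1 bin0 !mulr1n.
rewrite sE -/a -mulr2n mulr_natl lerD2l.
apply: (@le_trans _ _ (\sum_(i < n) ((2 * K) *+ 'C(n, bump 0 i)))); last first.
  under eq_bigr do rewrite -mulr_natr.
  rewrite -mulr_sumr -natr_sum [leRHS](_ : _ = 2 * K * 2 ^+ n); last by ring.
  apply: ler_wpM2l; first by rewrite mulr_ge0.
  have <- : \sum_(i < n.+1) ('C(n, i)%:R : R) = 2 ^+ n.
    rewrite -[2]/(1 + 1) exprDn.
    by apply: eq_bigr => i _; rewrite !expr1n mul1r.
  by rewrite big_ord_recl/= -natr_sum lerDr.
apply: ler_sum => i _; rewrite -mulrnDl ler_wMn2r// -mulrDr.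
rewrite exprNn; case: (boolP (odd (bump 0 i))) => oi.
  by rewrite -signr_odd oi expr1 mulN1r subrr mulr0 mulr_ge0.
rewrite -signr_odd (negbTE oi) expr0 mul1r -mulr2n mulrnAr -mulr_natl ler_wpM2l//.
apply: (le_trans (ler_norm _)); rewrite normrM !normrX; apply: key.
by have := ltn_ord i; move: oi; rewrite /bump leq0n add1n /=; case: (nat_of_ord i) => //=.
Qed.


Lemma expr_mul_le_add (R : realType) (a b : R) m : (0 < m)%N ->
  0 <= a -> 0 <= b -> a ^+ m.-1 * b <= a ^+ m + b ^+ m.
Proof.
move=> m0 a0 b0; have [ba|/ltW ab] := leP b a.
  apply: (@le_trans _ _ (a ^+ m)); last by rewrite lerDl exprn_ge0.
  by rewrite -[in leRHS](prednK m0) exprSr ler_wpM2l// exprn_ge0.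
apply: (@le_trans _ _ (b ^+ m)); last by rewrite lerDr exprn_ge0.
by rewrite -[in leRHS](prednK m0) exprSr ler_wpM2r// lerXn2r// nnegrE.
Qed.

Definition incr_cst (R : realType) (m : nat) : R :=
  2 ^+ m.*2 * (gauss_cst 1 + gauss_cst m).

Lemma incr_cst_ge0 (R : realType) m : 0 <= incr_cst R m.
Proof. by rewrite mulr_ge0 ?exprn_ge0 ?addr_ge0 ?gauss_cst_ge0. Qed.

Lemma normal_shift_even_moment (R : realType) (m : nat) (h T s y : R) :
  (0 < m)%N -> 0 < h -> h <= T ->
  (\int[normal_prob 0 (Num.sqrt h)]_v ((s + y * v) ^+ m.*2)%:E <=
   ((1 + incr_cst R m * h / T) * s ^+ m.*2
    + incr_cst R m * T ^+ m.-1 * h * y ^+ m.*2)%:E)%E.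
Proof.
move=> m0 h0 hT.
have T0 : 0 < T by exact: lt_le_trans hT.
have ev (x : R) k : 0 <= x ^+ k.*2 by rewrite exprn_even_ge0// odd_double.
have q0 : 0 < Num.sqrt h by rewrite sqrtr_gt0.
set N := normal_prob 0 (Num.sqrt h).
set q := Num.sqrt h in N q0 *.
have sE : (\int[N]_v ((s + y * v) ^+ m.*2)%:E = \int[N]_v ((s - y * v) ^+ m.*2)%:E)%E.
  rewrite -[LHS]ge0_integral_normal_oppr ?gt_eqF//.
    by apply: eq_integral => v _; rewrite mulrN.
  by apply: measurable_funX; apply: measurable_funD => //; exact: measurable_funM.
have mp (z : R) : measurable_fun setT (fun v : R => ((s + z * v) ^+ m.*2)%:E).
  apply/measurable_EFinP.
  by apply: measurable_funX; apply: measurable_funD => //; exact: measurable_funM.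
have mpN : measurable_fun setT (fun v : R => ((s - y * v) ^+ m.*2)%:E).
  by under eq_fun do rewrite -mulNr; exact: mp.
pose K1 : R := 2 * s ^+ m.*2.
pose K2 : R := 2 * 2 ^+ m.*2 * s ^+ (m.-1).*2 * y ^+ 2.
pose K3 : R := 2 * 2 ^+ m.*2 * y ^+ m.*2.
have K10 : 0 <= K1 by rewrite mulr_ge0.
have K20 : 0 <= K2.
  by apply: mulr_ge0; [apply: mulr_ge0; [rewrite mulr_ge0 ?exprn_ge0|exact: ev]|exact: sqr_ge0].
have K30 : 0 <= K3.
  by apply: mulr_ge0; [rewrite mulr_ge0 ?exprn_ge0|exact: ev].
have e2 : (2%:E * \int[N]_v ((s + y * v) ^+ m.*2)%:E <=
    (K1 + K2 * (gauss_cst 1 * q ^+ 2) + K3 * (gauss_cst m * q ^+ m.*2))%:E)%E.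
  rewrite mule_natl mule2n {2}sE -ge0_integralD//;
    try exact: mp; try exact: mpN; try by move=> v _; rewrite lee_fin.
  have m2 : measurable_fun setT (fun v : R => K2%:E * (v ^+ 2)%:E)%E.
    by apply: measurable_funeM; apply/measurable_EFinP; exact: measurable_funX.
  have m3 : measurable_fun setT (fun v : R => K3%:E * (v ^+ m.*2)%:E)%E.
    by apply: measurable_funeM; apply/measurable_EFinP; exact: measurable_funX.
  apply: (@le_trans _ _ (\int[N]_v (K1%:E + (K2%:E * (v ^+ 2)%:E + K3%:E * (v ^+ m.*2)%:E)))%E).
    apply: ge0_le_integral => //.
    - by move=> v _; rewrite lee_fin addr_ge0.
    - by apply: emeasurable_funD; [exact: mp|exact: mpN].
    - apply: emeasurable_funD; first exact: measurable_cst.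
      by apply: emeasurable_funD; [exact: m2|exact: m3].
    move=> v _; rewrite -!EFinM -!EFinD lee_fin.
    have := sum_even_pow_le s (y * v) m0; rewrite !exprMn /K1 /K2 /K3 => /le_trans; apply.
    by rewrite le_eqVlt; apply/orP; left; apply/eqP; ring.
  rewrite ge0_integralD//; last 2 first.
  - move=> v _; rewrite adde_ge0// mule_ge0// lee_fin ?sqr_ge0//.
  - by apply: emeasurable_funD; [exact: m2|exact: m3].
  rewrite ge0_integralD//; last 2 first.
  - by move=> v _; rewrite mule_ge0// lee_fin ?sqr_ge0.
  - by move=> v _; rewrite mule_ge0// lee_fin.
  rewrite integral_cst//.
  rewrite [X in (_ * X + _)%E](_ : _ = 1%E) ?mule1; last first.
    exact: (probability_setT (normal_prob 0 q)).
  rewrite !ge0_integralZl//; last 4 first.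
  - by apply/measurable_EFinP; exact: measurable_funX.
  - by move=> v _; rewrite lee_fin.
  - by apply/measurable_EFinP; exact: measurable_funX.
  - by move=> v _; rewrite lee_fin sqr_ge0.
  rewrite -addrA EFinD; apply: leeD => //; rewrite EFinD.
  apply: leeD; apply: lee_mulEFin => //; first exact: (normal_even_moment 1 q0).
  exact: normal_even_moment.
rewrite -(@lee_pmul2l _ 2%:E)//.
apply: (le_trans e2); rewrite -EFinM lee_fin.
have q2 : q ^+ 2 = h by rewrite sqr_sqrtr// ltW.
have qm : q ^+ m.*2 = h ^+ m by rewrite -muln2 mulnC exprM q2.
rewrite qm q2 /incr_cst.
have g0 := @gauss_cst_ge0 R.
have hm : h ^+ m <= h * T ^+ m.-1.
  rewrite -[in leLHS](prednK m0) exprS; apply: ler_wpM2l; first exact: ltW.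
  by rewrite lerXn2r ?nnegrE// ltW.
have young : s ^+ m.-1.*2 * y ^+ 2 <= s ^+ m.*2 / T + T ^+ m.-1 * y ^+ m.*2.
  have := @expr_mul_le_add _ (s ^+ 2) (T * y ^+ 2) m m0 (sqr_ge0 _)
    (mulr_ge0 (ltW T0) (sqr_ge0 _)).
  rewrite (exprMn _ T) -!exprM !mul2n => H.
  rewrite -(ler_pM2l T0) [leRHS](_ : _ = s ^+ m.*2 + T ^+ m * y ^+ m.*2).
    by rewrite mulrCA.
  rewrite -[in RHS](prednK m0) [in RHS]exprS prednK//; field; lra.
have := g0 1%N; have := g0 m.
set gm := gauss_cst m; set g1 := gauss_cst 1; move=> gm0 g10.
have p0 : 0 <= 2 ^+ m.*2 :> R by rewrite exprn_ge0.
have hh : 0 <= h by exact: ltW.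
have a1 : 2 ^+ m.*2 * g1 * h * (s ^+ m.-1.*2 * y ^+ 2)
    <= 2 ^+ m.*2 * g1 * h * (s ^+ m.*2 / T + T ^+ m.-1 * y ^+ m.*2).
  by apply: ler_wpM2l => //; rewrite !mulr_ge0.
have a2 : 2 ^+ m.*2 * gm * y ^+ m.*2 * h ^+ m
    <= 2 ^+ m.*2 * gm * y ^+ m.*2 * (h * T ^+ m.-1).
  by apply: ler_wpM2l => //; rewrite !mulr_ge0.
have a3 : 0 <= 2 ^+ m.*2 * gm * h * (s ^+ m.*2 / T).
  by rewrite !mulr_ge0// invr_ge0 ltW.
rewrite /K1 /K2 /K3; lra.
Qed.

Lemma measurable_wrtP (R : realType) d (T : measurableType d) (G : set_system T)
    (g : T -> R) : sigma_algebra setT G ->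
  measurable_wrt G g <->
  measurable_fun setT (g : g_sigma_algebraType G -> R).
Proof.
move=> sG; have GE : @measurable _ (g_sigma_algebraType G) = G.
  exact: sigma_algebra_id.
split=> [mg _ B mB|mg B mB].
  by rewrite setTI GE; exact: mg.
by rewrite -GE -[X in measurable X]setTI; exact: mg.
Qed.

Section independence.
Context {R : realType} {d d1 d2 : measure_display} {T : measurableType d}.
Context {E1 : measurableType d1} {E2 : measurableType d2}.
Variable P : probability T R.

Lemma ge0_integral_indep (G : set_system T) (U : T -> E1) (D : T -> E2)
    (nu : probability E2 R) (phi : E1 * E2 -> R) :
  measurable_fun setT U -> measurable_fun setT D ->
  (forall B, measurable B -> G (U @^-1` B)) ->
  (forall A B, G A -> measurable B ->
    P (A `&` D @^-1` B) = (P A * nu B)%E) ->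
  measurable_fun setT phi -> (forall z, 0 <= phi z) ->
  (\int[P]_w (phi (U w, D w))%:E =
   \int[P]_w \int[nu]_z (phi (U w, z))%:E)%E.
Proof.
move=> mU mD GU ind mphi phi0.
have mUD : measurable_fun setT (fun w => (U w, D w)).
  exact: measurable_fun_pair.
pose U' : {mfun T >-> E1} := HB.pack U (isMeasurableFun.Build _ _ _ _ _ mU).
pose J : {mfun T >-> (E1 * E2)%type} :=
  HB.pack (fun w => (U w, D w)) (isMeasurableFun.Build _ _ _ _ _ mUD).
pose PU : probability E1 R := distribution P U'.
pose PJ : probability (E1 * E2)%type R := distribution P J.
have E X : measurable X -> (PU \x nu)%E X = PJ X.
  apply: (product_measure_unique (m' := PJ)) => A B mA mB.
  by rewrite -[RHS]ind//; exact: GU.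
have mphiE : measurable_fun setT (EFin \o phi) by exact/measurable_EFinP.
have phiE0 z : (0 <= (EFin \o phi) z)%E by rewrite lee_fin.
transitivity (\int[PJ]_z (EFin \o phi) z)%E.
  by rewrite ge0_integral_distribution.
transitivity (\int[(PU \x nu)%E]_z (EFin \o phi) z)%E.
  by apply: eq_measure_integral => A mA _; exact/esym/E.
rewrite fubini_tonelli1//= ge0_integral_distribution//.
  exact: measurable_fun_fubini_tonelli_F.
by move=> z; apply: integral_ge0.
Qed.
End independence.

Section measurable_wrt_theory.
Context {R : realType} {d : measure_display} {T : measurableType d}.
Variables (G : set_system T) (sG : sigma_algebra setT G).
Implicit Types g h : T -> R.

Lemma mwrt_lift2 (op : R * R -> R) g h :
  measurable_fun setT op ->
  measurable_wrt G g -> measurable_wrt G h ->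
  measurable_wrt G (fun w => op (g w, h w)).
Proof.
move=> mop /(measurable_wrtP _ sG) mg /(measurable_wrtP _ sG) mh.
apply/(measurable_wrtP _ sG).
by apply: (measurableT_comp mop); exact: measurable_fun_pair.
Qed.

Lemma mwrtD g h : measurable_wrt G g -> measurable_wrt G h ->
  measurable_wrt G (fun w => g w + h w).
Proof.
move=> /(measurable_wrtP _ sG) mg /(measurable_wrtP _ sG) mh.
by apply/(measurable_wrtP _ sG); exact: measurable_funD.
Qed.

Lemma mwrtM g h : measurable_wrt G g -> measurable_wrt G h ->
  measurable_wrt G (fun w => g w * h w).
Proof.
move=> /(measurable_wrtP _ sG) mg /(measurable_wrtP _ sG) mh.
by apply/(measurable_wrtP _ sG); exact: measurable_funM.
Qed.

Lemma mwrt_comp (k : R -> R) g : measurable_fun setT k ->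
  measurable_wrt G g -> measurable_wrt G (k \o g).
Proof.
move=> mk mg B mB; have := mk measurableT _ mB; rewrite setTI => mkB.
exact: (mg _ mkB).
Qed.

Lemma mwrt_cst (r : R) : measurable_wrt G (fun=> r).
Proof. by apply/(measurable_wrtP _ sG); exact: measurable_cst. Qed.

Lemma mwrtB g h : measurable_wrt G g -> measurable_wrt G h ->
  measurable_wrt G (fun w => g w - h w).
Proof. by move=> mg mh; apply: mwrtD => //; exact: (@mwrt_comp -%R). Qed.

Lemma mwrt_sum n (g : nat -> T -> R) :
  (forall i, (i < n)%N -> measurable_wrt G (g i)) ->
  measurable_wrt G (fun w => \sum_(i < n) g i w).
Proof.
elim: n => [|n IH] mg.
  by under [X in measurable_wrt _ X]eq_fun do rewrite big_ord0; exact: mwrt_cst.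
under [X in measurable_wrt _ X]eq_fun do rewrite big_ord_recr/=.
by apply: mwrtD; [apply: IH => i ni; apply: mg; rewrite ltnS ltnW|exact: mg].
Qed.

Lemma mwrt_measurable g : G `<=` measurable -> measurable_wrt G g ->
  measurable_fun setT g.
Proof. by move=> Gm mg _ B mB; rewrite setTI; apply: Gm; exact: mg. Qed.

End measurable_wrt_theory.

Lemma mwrt_sub (R : realType) d (T : measurableType d) (G H : set_system T) (g : T -> R) :
  G `<=` H -> measurable_wrt G g -> measurable_wrt H g.
Proof. by move=> GH mg B mB; apply: GH; exact: mg. Qed.

Lemma measurable_ge_level (R : realType) d (T : measurableType d) (f : T -> \bar R)
    (a : \bar R) :
  measurable_fun setT f -> measurable [set w | (a <= f w)%E].
Proof.
move=> mf; rewrite -[X in measurable X]setTI.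
exact: measurable_lee.
Qed.

Lemma probabilityU_le (R : realType) d (T : measurableType d)
    (P : probability T R) (A B C : set T) :
  measurable A -> measurable B -> measurable C -> A `<=` B `|` C ->
  (P A <= P B + P C)%E.
Proof.
move=> mA mB mC ABC; apply: le_trans (measureU2 _ mB mC).
by apply: le_measure => //; rewrite inE//; exact: measurableU.
Qed.

Section grid_sums.
Context {R : realType} {d : measure_display} {T : measurableType d}.
Variables (P : probability T R) (F : R -> set_system T) (W : R -> T -> R).
Hypotheses (hF : is_filtration F) (hW : is_brownian_motion P F W).

Lemma filtration_sigma s : 0 <= s -> sigma_algebra setT (F s).
Proof. by move=> s0; case: hF => + _ _; exact. Qed.

Lemma filtration_measurable s : 0 <= s -> F s `<=` measurable.
Proof. by move=> s0; case: hF => _ + _; exact. Qed.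

Lemma filtration_sub s t : 0 <= s -> s <= t -> F s `<=` F t.
Proof. by move=> s0 st; case: hF => _ _; exact. Qed.

Lemma adapted_measurable (X : R -> T -> R) t :
  adapted F X -> 0 <= t -> measurable_fun setT (X t).
Proof.
by move=> aX t0; apply: mwrt_measurable (aX _ t0); exact: filtration_measurable.
Qed.

Lemma brownian_measurable t : 0 <= t -> measurable_fun setT (W t).
Proof. by apply: adapted_measurable; case: hW. Qed.

Lemma increment_moment (m : nat) (s t A : R) (S xi : T -> R) :
  (0 < m)%N -> 0 <= s -> s <= t -> 0 < A -> t - s <= A ->
  measurable_wrt (F s) S -> measurable_wrt (F s) xi ->
  (\int[P]_w ((S w + xi w * (W t w - W s w)) ^+ m.*2)%:E <=
   (expR (incr_cst R m * (t - s) / A))%:E * \int[P]_w (S w ^+ m.*2)%:E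
   + (incr_cst R m * A ^+ m.-1 * (t - s))%:E * \int[P]_w (xi w ^+ m.*2)%:E)%E.
Proof.
move=> m0 s0; rewrite le_eqVlt => /predU1P[<-|st] A0 tsA mS mxi.
  under eq_integral do rewrite subrr mulr0 addr0.
  by rewrite subrr !mulr0 mul0r mul0e adde0 expR0 mul1e.
have t0 : 0 <= t by rewrite (le_trans s0)// ltW.
have ev (x : R) k : 0 <= x ^+ k.*2 by rewrite exprn_even_ge0// odd_double.
have mS' := mwrt_measurable (filtration_measurable s0) mS.
have mxi' := mwrt_measurable (filtration_measurable s0) mxi.
pose nu : probability (measurableTypeR R) R := normal_prob 0 (Num.sqrt (t - s)).
pose D w : measurableTypeR R := W t w - W s w.
pose U w : (R * R)%type := (S w, xi w).
pose phi (z : (R * R) * measurableTypeR R) := (z.1.1 + z.1.2 * z.2) ^+ m.*2.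
have mphi : measurable_fun setT phi.
  apply: measurable_funX; apply: measurable_funD.
    exact: (measurableT_comp measurable_fst measurable_fst).
  apply: measurable_funM.
    exact: (measurableT_comp measurable_snd measurable_fst).
  exact: measurable_snd.
have -> : (\int[P]_w ((S w + xi w * (W t w - W s w)) ^+ m.*2)%:E =
    \int[P]_w \int[nu]_z (phi (U w, z))%:E)%E.
  transitivity (\int[P]_w (phi (U w, D w))%:E)%E; first exact: eq_integral.
  apply: (@ge0_integral_indep _ _ _ _ _ _ _ P (F s)) => //.
  - exact: measurable_fun_pair.
  - by apply: measurable_funB; exact: brownian_measurable.
  - move=> B mB; rewrite -(sigma_algebra_id (filtration_sigma s0)).
    have := measurable_fun_pair
      ((measurable_wrtP S (filtration_sigma s0)).1 mS)
      ((measurable_wrtP xi (filtration_sigma s0)).1 mxi).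
    by move=> /(_ measurableT _ mB); rewrite setTI.
  - case: hW => _ _ _ law ind A' B FA mB; rewrite [LHS]ind//; congr (_ * _)%E.
    exact: law.
  - by move=> z; exact: ev.
have mSm : measurable_fun setT (fun w => (S w ^+ m.*2)%:E).
  by apply/measurable_EFinP; exact: measurable_funX.
have mxim : measurable_fun setT (fun w => (xi w ^+ m.*2)%:E).
  by apply/measurable_EFinP; exact: measurable_funX.
have c0 := incr_cst_ge0 R m.
have ts0 : 0 < t - s by rewrite subr_gt0.
have k0 : 0 <= incr_cst R m * A ^+ m.-1 * (t - s).
  by apply: mulr_ge0 (ltW ts0); apply: mulr_ge0 => //; rewrite exprn_ge0// ltW.
have nS w : setT w -> (0 <= (S w ^+ m.*2)%:E)%E by rewrite lee_fin.
have nxi w : setT w -> (0 <= (xi w ^+ m.*2)%:E)%E by rewrite lee_fin.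
rewrite -!ge0_integralZl// ?lee_fin ?expR_ge0//.
rewrite -ge0_integralD//; try exact: measurable_funeM;
  try by move=> w _; rewrite mule_ge0// lee_fin ?expR_ge0.
apply: ge0_le_integral => //.
- by move=> w _; apply: integral_ge0 => z _; rewrite lee_fin; exact: ev.
- have mU : measurable_fun setT U by exact: measurable_fun_pair.
  have mphiE : measurable_fun setT (EFin \o phi) by exact/measurable_EFinP.
  have mI : measurable_fun setT (fun u => \int[nu]_z (phi (u, z))%:E)%E.
    apply: (measurable_fun_fubini_tonelli_F (m2 := nu) (EFin \o phi)) => //.
    by move=> z; rewrite lee_fin; exact: ev.
  exact: (measurableT_comp mI mU).
- by apply: emeasurable_funD; exact: measurable_funeM.
move=> w _; apply: (le_trans (normal_shift_even_moment _ _ m0 ts0 tsA)).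
rewrite -!EFinM -EFinD lee_fin lerD2r ler_wpM2r//.
exact: expR_ge1Dx.
Qed.

Definition grid_sum (rho : nat -> R) (xi : nat -> T -> R) n (w : T) : R :=
  \sum_(i < n) xi i w * (W (rho i.+1) w - W (rho i) w).

Variables (rho : nat -> R) (xi : nat -> T -> R).
Hypothesis rho0 : forall i, 0 <= rho i.
Hypothesis rhoS : forall i, rho i <= rho i.+1.
Hypothesis mxi : forall i, measurable_wrt (F (rho i)) (xi i).

Lemma grid_le i j : (i <= j)%N -> rho i <= rho j.
Proof.
move=> ij; rewrite -(subnK ij) addnC.
by elim: (j - i)%N => [|k IH]; [rewrite addn0|rewrite addnS (le_trans IH)].
Qed.

Lemma grid_coef_measurable i : measurable_fun setT (xi i).
Proof. exact: mwrt_measurable (filtration_measurable (rho0 i)) (@mxi i). Qed.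

Lemma grid_sum_mwrt n : measurable_wrt (F (rho n)) (grid_sum rho xi n).
Proof.
have sF := filtration_sigma (rho0 n).
case: hW => aW _ _ _ _.
apply: (mwrt_sum sF (g := fun i w => xi i w * (W (rho i.+1) w - W (rho i) w))).
move=> i ni; apply: (mwrtM sF).
  by apply: mwrt_sub (@mxi i); apply: filtration_sub => //; apply: grid_le; exact: ltnW.
by apply: (mwrtB sF); apply: mwrt_sub (aW _ _) => //; apply: filtration_sub => //;
  apply: grid_le => //; exact: ltnW.
Qed.

Lemma grid_sum_moment (m n : nat) (A : R) : (0 < m)%N -> 0 < A ->
  rho n - rho 0 <= A ->
  (\int[P]_w (grid_sum rho xi n w ^+ m.*2)%:E <=
   (expR (incr_cst R m) * incr_cst R m * A ^+ m.-1)%:E *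
   \sum_(i < n) (rho i.+1 - rho i)%:E * \int[P]_w (xi i w ^+ m.*2)%:E)%E.
Proof.
move=> m0 A0 hA; set c := incr_cst R m.
have c0 : 0 <= c := incr_cst_ge0 R m.
have ev (x : R) k : 0 <= x ^+ k.*2 by rewrite exprn_even_ge0// odd_double.
have k0 : 0 <= c * A ^+ m.-1 by rewrite mulr_ge0// exprn_ge0// ltW.
pose s k := (\sum_(i < k) (rho i.+1 - rho i)%:E * \int[P]_w (xi i w ^+ m.*2)%:E)%E.
have i0 i : (0 <= \int[P]_w (xi i w ^+ m.*2)%:E)%E.
  by apply: integral_ge0 => w _; rewrite lee_fin.
have s0 k : (0 <= s k)%E.
  by apply: sume_ge0 => i _; rewrite mule_ge0// lee_fin subr_ge0.
have step k : (k <= n)%N -> (\int[P]_w (grid_sum rho xi k w ^+ m.*2)%:E <=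
    (expR (c * (rho k - rho 0) / A) * (c * A ^+ m.-1))%:E * s k)%E.
  elim: k => [_|k IH kn].
    rewrite /s big_ord0 mule0; under eq_integral do
      rewrite /grid_sum big_ord0 expr0n double_eq0 eqn0Ngt m0.
    by rewrite integral0.
  have hk : rho k.+1 - rho k <= A.
    apply: le_trans hA; apply: lerB; first exact: grid_le.
    exact: grid_le.
  under eq_integral do rewrite /grid_sum big_ord_recr/=.
  apply: (le_trans (increment_moment m0 (rho0 k) (rhoS k) A0 hk
    (@grid_sum_mwrt k) (@mxi k))).
  have -> : s k.+1 = (s k + (rho k.+1 - rho k)%:E * \int[P]_w (xi k w ^+ m.*2)%:E)%E.
    by rewrite /s big_ord_recr.
  have x0 : (0 <= (rho k.+1 - rho k)%:E * \int[P]_w (xi k w ^+ m.*2)%:E)%E.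
    by rewrite mule_ge0// lee_fin subr_ge0.
  rewrite (ge0_muleDr _ (s0 k) x0).
  apply: leeD.
    apply: (@le_trans _ _ ((expR (c * (rho k.+1 - rho k) / A))%:E *
       ((expR (c * (rho k - rho 0) / A) * (c * A ^+ m.-1))%:E * s k)))%E.
      by rewrite lee_wpmul2l ?lee_fin ?expR_ge0// IH// ltnW.
    rewrite muleA -EFinM le_eqVlt; apply/orP; left; apply/eqP; congr (_%:E * _)%E.
    have eD (x y K : R) : expR x * (expR y * K) = expR (x + y) * K.
      by rewrite mulrA -expRD.
    by apply: etrans (eD _ _ _) _; congr (expR _ * _); ring.
  rewrite muleA -EFinM lee_wpmul2r// lee_fin -/c.
  rewrite -[leRHS]mulrA -[leLHS]mul1r; apply: ler_wpM2r.
    by rewrite mulr_ge0// subr_ge0.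
  rewrite -expR0 ler_expR; apply: divr_ge0; last exact: ltW.
  by rewrite mulr_ge0// subr_ge0 grid_le.
apply: (le_trans (step n (leqnn n))).
rewrite lee_wpmul2r// lee_fin -[leRHS]mulrA; apply: ler_wpM2r => //.
by rewrite ler_expR ler_pdivrMr// ler_wpM2l.
Qed.


Lemma markov_sqr (S : T -> R) (e b : R) : measurable_fun setT S -> 0 < e ->
  (\int[P]_w (S w ^+ 2)%:E <= b%:E)%E ->
  (P [set w | (e%:E <= `|S w|%:E)%E] <= (b / e ^+ 2)%:E)%E.
Proof.
move=> mS e0 Sb.
have mS2 : measurable_fun setT (fun w => (S w ^+ 2)%:E).
  by apply/measurable_EFinP; exact: measurable_funX.
have e2 : 0 < e ^+ 2 by rewrite exprn_gt0.
have := le_integral_abse P measurableT mS2 e2; rewrite setTI.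
have -> : [set x | ((e ^+ 2)%:E <= `|(S x ^+ 2)%:E|)%E] =
    [set w | (e%:E <= `|S w|%:E)%E].
  have sqE (x : R) : (e ^+ 2 <= x ^+ 2) = (e <= `|x|).
    by rewrite -[x ^+ 2]real_normK ?num_real// ler_pXn2r// nnegrE ltW.
  by apply/seteqP; split => w /=; rewrite !lee_fin (ger0_norm (sqr_ge0 (S w))) sqE.
under eq_integral do rewrite gee0_abs ?lee_fin ?sqr_ge0//.
move=> /le_trans /(_ Sb) H.
by rewrite EFinM lee_pdivlMr// muleC.
Qed.

Definition stop_cst : R := expR (incr_cst R 1) * incr_cst R 1.

Lemma stop_cst_ge0 : 0 <= stop_cst.
Proof. by rewrite mulr_ge0 ?expR_ge0 ?incr_cst_ge0. Qed.

End grid_sums.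

Section stopping.
Context {R : realType} {d : measure_display} {T : measurableType d}.
Variables (P : probability T R) (F : R -> set_system T) (W : R -> T -> R).
Hypotheses (hF : is_filtration F) (hW : is_brownian_motion P F W).
Variables (rho : nat -> R) (xi : nat -> T -> R).
Hypothesis rho0 : forall i, 0 <= rho i.
Hypothesis rhoS : forall i, rho i <= rho i.+1.
Hypothesis mxi : forall i, measurable_wrt (F (rho i)) (xi i).

Let qv n w := \sum_(i < n) (rho i.+1 - rho i) * xi i w ^+ 2.

Lemma grid_sum_in_probability n (b e : R) : 0 < b -> 0 < e ->
  (P [set w | (e%:E <= `|grid_sum W rho xi n w|%:E)%E] <=
   P [set w | (b%:E <= (\sum_(i < n) (rho i.+1 - rho i) * xi i w ^+ 2)%:E)%E]
   + (@stop_cst R * b / e ^+ 2)%:E)%E.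
Proof.
move=> b0 e0.
have h0 i : 0 <= rho i.+1 - rho i by rewrite subr_ge0.
pose eta i w := xi i w * \1_[set w | qv i.+1 w < b] w.
have sF i := filtration_sigma hF (rho0 i).
have mqv i j : (i <= j.+1)%N -> measurable_wrt (F (rho j)) (qv i).
  move=> ij; apply: (mwrt_sum (sF j) (g := fun i w => (rho i.+1 - rho i) * xi i w ^+ 2)).
  move=> k ki; apply: (mwrtM (sF j)); first exact: mwrt_cst.
  have mk : measurable_wrt (F (rho j)) (xi k).
    apply: mwrt_sub (@mxi k); apply: (filtration_sub hF) => //.
    by apply: (grid_le rhoS); have := leq_trans ki ij; rewrite ltnS.
  exact: (mwrtM (sF j) mk mk).
have meta i : measurable_wrt (F (rho i)) (eta i).
  apply: (mwrtM (sF i)) => //.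
  have mind : measurable_fun setT (\1_[set x : R | x < b] : R -> R).
    by apply: measurable_indic; rewrite -set_itvNyo.
  exact: (@mwrt_comp _ _ _ _ _ _ mind (@mqv i.+1 i _)).
have etaS k w : qv k.+1 w < b -> eta k w = xi k w.
  by move=> h; rewrite /eta indicE mem_set// mulr1.
have eta0 k w : ~~ (qv k.+1 w < b) -> eta k w = 0.
  by move=> h; rewrite /eta indicE memNset ?mulr0//; exact/negP.
pose qe n w := \sum_(i < n) (rho i.+1 - rho i) * eta i w ^+ 2.
have qvS k w : qv k.+1 w = qv k w + (rho k.+1 - rho k) * xi k w ^+ 2.
  by rewrite /qv big_ord_recr.
have qeS k w : qe k.+1 w = qe k w + (rho k.+1 - rho k) * eta k w ^+ 2.
  by rewrite /qe big_ord_recr.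
have qv_nd k w : qv k w <= qv k.+1 w.
  by rewrite qvS lerDl mulr_ge0// sqr_ge0.
have etale k w : qe k w <= b /\ (qv k w < b -> qe k w = qv k w).
  elim: k => [|k [IH1 IH2]]; first by rewrite /qe /qv !big_ord0 ltW.
  have [lt|ge] := boolP (qv k.+1 w < b).
    have E : qe k.+1 w = qv k.+1 w.
      by rewrite qeS qvS IH2 ?etaS// (le_lt_trans (qv_nd k w)).
    by rewrite E; split => //; exact: ltW.
  by rewrite qeS (eta0 _ _ ge) expr0n/= mulr0 addr0.
have meta' i := grid_coef_measurable hF rho0 meta i.
pose A : R := 1 + (rho n - rho 0).
have A0 : 0 < A by rewrite ltr_wpDr// subr_ge0 (grid_le rhoS).
have hA : rho n - rho 0 <= A by rewrite lerDr.
have M2 : (\int[P]_w (grid_sum W rho eta n w ^+ 2)%:E <= (@stop_cst R * b)%:E)%E.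
  have := grid_sum_moment hF hW rho0 rhoS meta (isT : (0 < 1)%N) A0 hA.
  rewrite expr0 mulr1 => /le_trans; apply; apply: lee_mulEFin; first exact: stop_cst_ge0.
  apply: (@le_trans _ _ (\int[P]_w (qe n w)%:E)%E).
    rewrite /qe; under [leRHS]eq_integral do rewrite -sumEFin.
    rewrite ge0_integral_sum//; last 2 first.
    - by move=> i; apply/measurable_EFinP/measurable_funM => //; exact: measurable_funX.
    - by move=> i w _; rewrite lee_fin mulr_ge0// sqr_ge0.
    apply: lee_sum => i _; rewrite -ge0_integralZl//.
    - by apply/measurable_EFinP; exact: measurable_funX.
    - by move=> w _; rewrite lee_fin sqr_ge0.
    - by rewrite lee_fin.
  apply: (@le_trans _ _ (\int[P]_w (cst b%:E w))%E).
    apply: ge0_le_integral => //.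
    - by move=> w _; rewrite lee_fin sumr_ge0// => i _; rewrite mulr_ge0// sqr_ge0.
    - apply/measurable_EFinP; apply: measurable_sum => i.
      by apply: measurable_funM => //; exact: measurable_funX.
    - by move=> w _; rewrite lee_fin; case: (etale n w).
  by rewrite /cst integral_cst// [X in (_ * X)%E](probability_setT P) mule1.
have mgs (z : nat -> T -> R) : (forall i, measurable_wrt (F (rho i)) (z i)) -> measurable_fun setT (grid_sum W rho z n).
  by move=> mz; apply: mwrt_measurable (grid_sum_mwrt hF hW rho0 rhoS mz n);
    exact: filtration_measurable.
have mP z : (forall i, measurable_wrt (F (rho i)) (z i)) ->
    measurable [set w | (e%:E <= `|grid_sum W rho z n w|%:E)%E].
  move=> mz; apply: measurable_ge_level; apply/measurable_EFinP.
  by apply: measurableT_comp => //; exact: mgs.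
have mQ : measurable [set w | (b%:E <= (qv n w)%:E)%E].
  apply: measurable_ge_level; apply/measurable_EFinP.
  apply: measurable_sum => i; apply: measurable_funM => //.
  by apply: measurable_funX; exact: (grid_coef_measurable hF rho0 mxi).
apply: (le_trans (probabilityU_le P (mP _ mxi) mQ (mP _ meta) _)); last first.
  by rewrite leeD2l//; apply: markov_sqr => //; exact: mgs.
move=> w /= ew; have [lt|ge] := ltP (qv n w) b; last by left; rewrite lee_fin.
right; rewrite (_ : grid_sum W rho eta n w = grid_sum W rho xi n w)//.
apply: eq_bigr => i _; rewrite etaS//; apply: le_lt_trans lt.
exact: (@grid_le _ (qv ^~ w) (fun k => qv_nd k w)).
Qed.

End stopping.

Section refining_grid.
Context {R : realType}.

(* a time of [l] lying below the right end of a grid interval lies below its left end *)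
Lemma refining_grid (l : seq R) (s t : R) : 0 <= s -> s < t ->
  exists N (rho : nat -> R),
    [/\ rho 0%N = s, rho N = t, forall i, s <= rho i <= t,
        forall i, rho i <= rho i.+1 &
        forall a i, a \in l -> a < rho i.+1 -> a <= rho i].
Proof.
move=> s0 st.
pose clip (a : R) := Num.min t (Num.max s a).
pose L := sort <=%R (s :: t :: map clip l).
have sL : sorted <=%R L by exact: sort_le_sorted.
have memL a : (a \in L) = (a \in s :: t :: map clip l) by rewrite mem_sort.
have Lst a : a \in L -> s <= a <= t.
  have st' := ltW st.
  rewrite memL !inE => /or3P[/eqP->|/eqP->|/mapP[b _ ->]]; rewrite ?lexx ?st'//.
  by rewrite /clip le_min st' le_max lexx/= ge_min lexx.
pose rho i := nth t L i.
have rhost i : s <= rho i <= t.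
  have [iL|Li] := ltnP i (size L); first by apply/Lst/mem_nth.
  by rewrite /rho nth_default// lexx ltW.
have rhoS i : rho i <= rho i.+1.
  have [iL|Li] := ltnP i.+1 (size L).
    by rewrite /rho; apply: (sorted_leq_nth le_trans le_refl) => //; rewrite inE ltnW.
  by rewrite [leRHS]/rho nth_default//; case/andP: (rhost i).
have rhoL a : a \in L -> exists k, rho k = a.
  by move=> aL; exists (index a L); rewrite /rho nth_index.
exists (size L), rho; split => //.
- have [k ks] : exists k, rho k = s by apply: rhoL; rewrite memL inE eqxx.
  apply/eqP; rewrite eq_le -{1}ks (grid_le rhoS)//=.
  by case/andP: (rhost 0%N).
- by rewrite /rho nth_default.
- move=> a i al av.
  have [k kE] : exists k, rho k = clip a.
    by apply: rhoL; rewrite memL !inE map_f ?orbT.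
  have at_ : a <= t by apply: le_trans (ltW av) _; case/andP: (rhost i.+1).
  have aclip : a <= clip a by rewrite /clip le_min at_/= le_max lexx orbT.
  have [ki|ik] := leqP k i.
    by rewrite (le_trans aclip)// -kE (grid_le rhoS).
  have : rho i.+1 <= clip a by rewrite -kE (grid_le rhoS).
  rewrite /clip le_min => /andP[_]; rewrite le_max => /orP[h|h].
    by rewrite (le_trans (ltW av))// (le_trans h)//; case/andP: (rhost i).
  by move: (lt_le_trans av h); rewrite ltxx.
Qed.

End refining_grid.

Section simple_on_grid.
Context {R : realType} {d : measure_display} {T : measurableType d}.
Variables (P : probability T R) (F : R -> set_system T) (W : R -> T -> R).
Hypotheses (hF : is_filtration F) (hW : is_brownian_motion P F W).
Variables (G : simple_process F) (rho : nat -> R).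
Hypothesis rho0 : forall i, 0 <= rho i.
Hypothesis rhoS : forall i, rho i <= rho i.+1.
Hypothesis refine : forall i j, (j <= sp_size G)%N ->
  sp_time G j < rho i.+1 -> sp_time G j <= rho i.

Lemma sp_eval_on_grid i x w : rho i < x -> x <= rho i.+1 ->
  sp_eval G x w = sp_eval G (rho i.+1) w.
Proof.
move=> ix xi; apply: eq_bigr => j _; congr (_ * _).
rewrite !indicE; congr (_ %:R); congr nat_of_bool.
have nj := ltn_ord j.
apply/idP/idP; rewrite !inE/= !in_itv/= => /andP[ax xb].
  rewrite (lt_le_trans ax)//= leNgt; apply/negP => bv.
  by have := refine nj bv; rewrite leNgt (lt_le_trans ix).
rewrite (le_trans xi)// andbT.
by apply: le_lt_trans ix; apply: refine => //; exact: ltnW.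
Qed.

Lemma sp_eval_mwrt i : measurable_wrt (F (rho i)) (sp_eval G (rho i.+1)).
Proof.
have sF := filtration_sigma hF (rho0 i).
apply: (mwrt_sum sF (g := fun j w =>
  sp_coef G j w * \1_(`]sp_time G j, sp_time G j.+1]) (rho i.+1))) => j nj.
case: (boolP (rho i.+1 \in `]sp_time G j, sp_time G j.+1]%classic)) => h.
  apply: (mwrtM sF); last exact: mwrt_cst.
  apply: mwrt_sub (@sp_coef_measurable _ _ _ _ G j).
  apply: (filtration_sub hF); first exact: sp_time_ge0.
  move: h; rewrite inE/= in_itv/= => /andP[h _].
  by apply: refine => //; exact: ltnW.
rewrite [X in measurable_wrt _ X](_ : _ = cst 0); first exact: mwrt_cst.
by apply/funext => w; rewrite indicE (negbTE h) mulr0.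
Qed.

Lemma sp_integral_on_grid N w :
  sp_integral G W (rho N) w - sp_integral G W (rho 0%N) w =
  grid_sum W rho (fun i => sp_eval G (rho i.+1)) N w.
Proof.
rewrite /grid_sum /sp_eval; under eq_bigr do rewrite mulr_suml.
rewrite exchange_big/= /sp_integral -sumrB; apply: eq_bigr => j _.
rewrite -mulrBr; under eq_bigr do rewrite -mulrA.
rewrite -mulr_sumr; congr (_ * _).
set a := sp_time G j; set b := sp_time G j.+1.
have ab : a <= b by exact: sp_time_le.
have nj := ltn_ord j.
pose phi u := W (Num.min u b) w - W (Num.min u a) w.
rewrite -/(phi (rho N)) -/(phi (rho 0%N)) -(@telescope_sumr _ _ _ (phi \o rho))//=.
rewrite big_mkord; apply: eq_bigr => i _.
have uv := rhoS i; rewrite /phi indicE.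
case: (boolP (rho i.+1 \in `]a, b]%classic)) => h.
  move: h; rewrite inE/= in_itv/= => /andP[av vb]. 
  have au : a <= rho i by apply: refine => //; exact: ltnW.
  have ub := le_trans uv vb.
  by rewrite mul1r (min_l vb) (min_l ub) (min_r (ltW av)) (min_r au); ring.
move/negP: h; rewrite inE/= in_itv/= => /negP.
rewrite mul0r negb_and -leNgt -ltNge => /orP[va|bv].
  have ua := le_trans uv va; have vb := le_trans va ab.
  by rewrite (min_l va) (min_l ua) (min_l vb) (min_l (le_trans uv vb)); ring.
have bu : b <= rho i by exact: refine.
rewrite (min_r bu) (min_r (ltW bv)) (min_r (le_trans ab bu)).
by rewrite (min_r (ltW (le_lt_trans ab bv))); ring.
Qed.

End simple_on_grid.

Section step_functions.
Context {R : realType}.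
Local Notation mu := (@lebesgue_measure R).

Lemma grid_cover (rho : nat -> R) n x : rho 0%N < x -> x <= rho n ->
  exists2 i, (i < n)%N & rho i < x <= rho i.+1.
Proof.
move=> x0; elim: n => [|n IH] xn; first by move: (lt_le_trans x0 xn); rewrite ltxx.
have [h|h] := leP x (rho n); last by exists n => //; rewrite h xn.
by have [i ni hi] := IH h; exists i => //; rewrite ltnS ltnW.
Qed.

Lemma step_integral (rho : nat -> R) (g : R -> R) n :
  (forall i, rho i <= rho i.+1) -> measurable_fun setT g ->
  (forall i x, rho i < x -> x <= rho i.+1 -> g x = g (rho i.+1)) ->
  (forall x, 0 <= g x) ->
  ((\sum_(i < n) (rho i.+1 - rho i) * g (rho i.+1))%:E =
   \int[mu]_(x in `[rho 0%N, rho n]) (g x)%:E)%E.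
Proof.
move=> rhoS mg gE g0.
have mgE (D : set R) : measurable_fun D (EFin \o g).
  by apply/measurable_EFinP; exact: measurable_funTS.
rewrite -integral_itv_obnd_cbnd//.
elim: n => [|n IH]; first by rewrite big_ord0 set_itvoc0 integral_set0.
rewrite big_ord_recr/= EFinD IH.
have -> : `]rho 0%N, rho n.+1]%classic =
    `]rho 0%N, rho n]%classic `|` `]rho n, rho n.+1]%classic.
  by rewrite -itv_bndbnd_setU// bnd_simp// grid_le.
rewrite ge0_integral_setU//; last 3 first.
- exact: mgE.
- by move=> x _; rewrite lee_fin.
- apply/disj_setPS => x [] /=; rewrite !in_itv/= => /andP[_ xn] /andP[nx _].
  by move: (le_lt_trans xn nx); rewrite ltxx.
congr (_ + _)%E.
transitivity (\int[mu]_(x in `]rho n, rho n.+1]) (g (rho n.+1))%:E)%E; last first.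
  by apply: eq_integral => x; rewrite inE/= in_itv/= => /andP[h1 h2]; rewrite (gE _ _ h1 h2).
rewrite integral_cst//= lebesgue_measure_itv/= lte_fin.
case: ltP => [_|h]; first by rewrite -EFinB -EFinM mulrC.
have -> : rho n.+1 = rho n by apply/eqP; rewrite eq_le h rhoS.
by rewrite subrr mul0r mule0.
Qed.

End step_functions.

Section continuity_half_line.
Context {R : realType}.

Lemma continuous_max0 : continuous (fun t : R => Num.max 0 t).
Proof.
by move=> t; apply: (@continuous_max _ _ (cst 0) id); [exact: cvg_cst|exact: cvg_id].
Qed.

Lemma within_continuous_max0 (f : R -> R) :
  {within `[0, +oo[, continuous f} -> continuous (fun t : R => f (Num.max 0 t)).
Proof.
move=> cf0 t; have cf := (@subspace_continuousP _ `[(0:R), +oo[%classic _ f).1 cf0.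
have t0 : `[0, +oo[%classic (Num.max 0 t) by rewrite /= in_itv/= andbT le_max lexx.
have := cf _ t0; apply: (@cvg_comp _ _ _ (fun x : R => Num.max 0 x) f) => B /=.
rewrite /within/= => wB.
have wB' : \forall x \near t, Num.max 0 x \in `[0, +oo[ -> B (Num.max 0 x).
  exact: (@continuous_max0 t _ wB).
change (\forall x \near t, B (Num.max 0 x)).
apply: filterS wB' => x; apply.
by rewrite in_itv/= andbT le_max lexx.
Qed.

End continuity_half_line.

Section joint_measurability.
Context {R : realType} {d : measure_display} {T : measurableType d}.

Lemma measurable_fun_countable_choice d' (E : measurableType d')
    (k : E -> nat) (g : nat -> E -> R) :
  (forall n, measurable [set x | k x = n]) ->
  (forall n, measurable_fun setT (g n)) ->
  measurable_fun setT (fun x => g (k x) x).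
Proof.
move=> mk mg _ B mB; rewrite setTI.
have -> : (fun x => g (k x) x) @^-1` B =
    \bigcup_n ([set x | k x = n] `&` (g n @^-1` B)).
  apply/seteqP; split => [x Bx|x [n _ [/= <-]]//].
  by exists (k x).
apply: bigcup_measurable => n _; apply: measurableI; first exact: mk.
by have := mg n measurableT _ mB; rewrite setTI.
Qed.

Lemma continuous_paths_jointly_measurable (X : R -> T -> R) :
  (forall t, 0 <= t -> measurable_fun setT (X t)) -> continuous_paths X ->
  measurable_fun setT (fun z : measurableTypeR R * T => X (Num.max 0 z.1) z.2).
Proof.
move=> mX cX.
pose k n (z : measurableTypeR R * T) := Num.truncn (Num.max 0 z.1 * n.+1%:R).
pose Xn n z := X ((k n z)%:R / n.+1%:R) z.2.
have mXn n : measurable_fun setT (Xn n).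
  apply: (@measurable_fun_countable_choice _ _ (k n)
    (fun j z => X (j%:R / n.+1%:R) z.2)).
    move=> j; rewrite [X in measurable X](_ : _ = setT `&`
      (fun z : measurableTypeR R * T => Num.max 0 z.1 * n.+1%:R) @^-1` `[j%:R, j.+1%:R[).
      have mz : measurable_fun setT (fun z : measurableTypeR R * T => Num.max 0 z.1 * n.+1%:R : measurableTypeR R).
        apply: measurable_funM => //; apply: measurable_maxr => //.
      exact: mz.
    rewrite setTI; apply/seteqP; split => z /=.
      by move=> /eqP; rewrite truncn_eq ?mulr_ge0 ?le_max ?lexx// in_itv.
    by rewrite in_itv/= => h; apply/eqP; rewrite truncn_eq// mulr_ge0// le_max lexx.
  move=> j; apply: (measurableT_comp _ measurable_snd).
  by apply: mX; rewrite divr_ge0.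
apply: (@measurable_fun_cvg _ _ _ _ Xn) => //.
move=> z _.
have m0 : 0 <= Num.max 0 z.1 by rewrite le_max lexx.
have cXz := within_continuous_max0 (cX z.2).
suff : (k n z)%:R / n.+1%:R @[n --> \oo] --> Num.max 0 z.1.
  move=> h; have := continuous_cvg _ (cXz (Num.max 0 z.1)) h.
  rewrite (max_r m0) => /(_ _)/=; rewrite (_ : _ \o _ = Xn ^~ z); first by apply.
  by apply/funext => n /=; rewrite max_r// divr_ge0.
set u := Num.max 0 z.1 in m0 *.
apply: (@squeeze_cvgr _ _ _ _ (fun n => u - n.+1%:R^-1) (cst u)).
- apply: nearW => n /=; rewrite /k -/u.
  have n0 : 0 < n.+1%:R :> R by rewrite ltr0n.
  have /andP[h1 h2] := truncn_itv (mulr_ge0 m0 (ltW n0)).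
  rewrite ler_pdivrMr// h1 andbT ler_pdivlMr// mulrBl mulVf ?gt_eqF// lerBlDr.
  by rewrite natr1 ltW.
- rewrite -[X in _ --> X]subr0; apply: cvgB; first exact: cvg_cst.
  exact: cvg_harmonic.
- exact: cvg_cst.
Qed.

End joint_measurability.

Section convergence_to_zero.
Context {R : realType}.

Lemma cvg0_eventually_le (u : nat -> \bar R) (c : R) : u @ \oo --> 0%E -> 0 < c ->
  \forall n \near \oo, (u n <= c%:E)%E.
Proof.
move=> u0 c0; have : nbhs (0%E : \bar R) [set x | (x < c%:E)%E].
  by apply: open_nbhs_nbhs; split; [exact: open_ereal_lt_ereal|rewrite /= lte_fin].
move=> /u0 near0; have near1 : \forall n \near \oo, (u n < c%:E)%E by exact: near0.
by apply: filterS near1 => n /= /ltW.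
Qed.

Lemma eventually_le_cvg0 (u : nat -> \bar R) : (forall n, 0 <= u n)%E ->
  (forall c : R, 0 < c -> \forall n \near \oo, (u n <= c%:E)%E) ->
  u @ \oo --> 0%E.
Proof.
move=> u0 H; apply/fine_cvgP; split.
  near=> n; have ue : (u n <= 1%:E)%E by near: n; exact: H.
  by rewrite ge0_fin_numE// (le_lt_trans ue)// ltry.
apply/cvgrPdist_le => e e0; near=> n; rewrite sub0r normrN /=.
have ue : (u n <= e%:E)%E by near: n; exact: H.
have fu : u n \is a fin_num by rewrite ge0_fin_numE// (le_lt_trans ue)// ltry.
by rewrite ger0_norm ?fine_ge0// -lee_fin fineK.
Unshelve. all: by end_near. Qed.

End convergence_to_zero.

Section path_integrals.
Context {R : realType} {d : measure_display} {T : measurableType d}.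
Local Notation mu := (@lebesgue_measure R).
Variables (P : probability T R) (phi : measurableTypeR R * T -> R) (D : set R).
Hypotheses (mphi : measurable_fun setT phi) (phi0 : forall z, 0 <= phi z).
Hypothesis mD : measurable (D : set (measurableTypeR R)).

Let f (z : measurableTypeR R * T) : \bar R := (phi z * \1_D z.1)%:E.

Let mf : measurable_fun setT f.
Proof.
apply/measurable_EFinP; apply: measurable_funM => //.
have mi : measurable_fun setT (\1_D : measurableTypeR R -> R) by exact: measurable_indic.
exact: (measurableT_comp mi measurable_fst).
Qed.

Let f0 z : (0 <= f z)%E.
Proof. by rewrite lee_fin mulr_ge0. Qed.

Let intE w : (\int[mu]_(u in D) (phi (u, w))%:E = \int[mu]_u f (u, w))%E.
Proof.
rewrite integral_mkcond; apply: eq_integral => u _; rewrite patchE /f /= indicE.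
by case: (u \in D); rewrite ?mulr1 ?mulr0.
Qed.

Lemma measurable_path_integral :
  measurable_fun setT (fun w => \int[mu]_(u in D) (phi (u, w))%:E)%E.
Proof.
under eq_fun do rewrite intE.
exact: (measurable_fun_fubini_tonelli_G (m1 := mu) f).
Qed.

Lemma path_integral_tonelli :
  (\int[P]_w \int[mu]_(u in D) (phi (u, w))%:E =
   \int[mu]_(u in D) \int[P]_w (phi (u, w))%:E)%E.
Proof.
under eq_integral do rewrite intE.
rewrite -[LHS](fubini_tonelli (m1 := mu) (m2 := P) f)// [RHS]integral_mkcond.
apply: eq_integral => u _; rewrite patchE /f /= indicE.
case: (u \in D); first by apply: eq_integral => w _; rewrite mulr1.
by under eq_integral do rewrite mulr0; rewrite integral0.
Qed.

End path_integrals.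

Section riemann.
Context {R : realType} {d : measure_display} {T : measurableType d}.
Local Notation mu := (@lebesgue_measure R).
Variables (P : probability T R) (F : R -> set_system T) (W : R -> T -> R).
Hypotheses (hF : is_filtration F) (hW : is_brownian_motion P F W).
Variables (H : R -> T -> R) (K : R).
Hypotheses (aH : adapted F H) (cH : continuous_paths H).
Hypothesis bH : forall u w, `|H u w| <= K.
Variables (s t : R).
Hypotheses (s0 : 0 <= s) (st : s < t).

Definition unif_grid (s t : R) n i : R := s + i%:R * ((t - s) / n.+1%:R).

Lemma unif_grid_ge0 n i : 0 <= unif_grid s t n i.
Proof. by rewrite addr_ge0// mulr_ge0// divr_ge0// subr_ge0 ltW. Qed.

Lemma unif_gridS n i : unif_grid s t n i <= unif_grid s t n i.+1.
Proof.
rewrite lerD2l ler_wpM2r ?ler_nat//.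
by rewrite divr_ge0// subr_ge0 ltW.
Qed.

Lemma unif_grid0 n : unif_grid s t n 0 = s.
Proof. by rewrite /unif_grid mul0r addr0. Qed.

Lemma unif_gridn n : unif_grid s t n n.+1 = t.
Proof. by rewrite /unif_grid mulrC divfK ?pnatr_eq0// addrC subrK. Qed.

Lemma unif_grid_mesh n i : unif_grid s t n i.+1 - unif_grid s t n i = (t - s) / n.+1%:R.
Proof. by rewrite /unif_grid -natr1; ring. Qed.

Definition riemann_process n : simple_process F :=
  @SimpleProcess _ _ _ F n.+1 (unif_grid s t n) (fun i => H (unif_grid s t n i))
    (unif_grid_ge0 n) (unif_gridS n)
    (fun i => aH (unif_grid_ge0 n i))
    (fun i => ex_intro _ K (bH (unif_grid s t n i))).

Lemma riemann_eval n i x w : (i < n.+1)%N ->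
  unif_grid s t n i < x -> x <= unif_grid s t n i.+1 ->
  sp_eval (riemann_process n) x w = H (unif_grid s t n i) w.
Proof.
move=> ni ix xi; rewrite /sp_eval/= (bigD1 (Ordinal ni))//= big1 ?addr0.
  by rewrite indicE mem_set ?mulr1//= in_itv/= ix xi.
move=> j /eqP ji; rewrite indicE memNset ?mulr0//= in_itv/= => /andP[jx xj].
apply: ji; apply/val_inj => /=; apply/eqP; rewrite eqn_leq; apply/andP; split.
  rewrite leqNgt; apply/negP => ij.
  have := le_lt_trans (le_trans xi (grid_le (unif_gridS n) ij)) jx.
  by rewrite ltxx.
rewrite leqNgt; apply/negP => ij.
have := le_lt_trans (le_trans xj (grid_le (unif_gridS n) ij)) ix.
by rewrite ltxx.
Qed.

Lemma riemann_integral n w :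
  sp_integral (riemann_process n) W t w - sp_integral (riemann_process n) W s w =
  grid_sum W (unif_grid s t n) (fun i => H (unif_grid s t n i)) n.+1 w.
Proof.
have refine i j : (j <= sp_size (riemann_process n))%N ->
    sp_time (riemann_process n) j < unif_grid s t n i.+1 ->
    sp_time (riemann_process n) j <= unif_grid s t n i.
  move=> _ /= ji; apply: (grid_le (unif_gridS n)).
  by rewrite leqNgt; apply/negP => /(grid_le (unif_gridS n)); rewrite leNgt ji.
rewrite -[in sp_integral _ _ t](unif_gridn n) -[in sp_integral _ _ s](unif_grid0 n).
rewrite (sp_integral_on_grid W (unif_gridS n) refine).
apply: eq_bigr => i _; have [e|ne] := eqVneq (unif_grid s t n i.+1) (unif_grid s t n i).
  by rewrite e !subrr !mulr0.
congr (_ * _); apply: riemann_eval => //.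
by rewrite lt_neqAle eq_sym ne unif_gridS.
Qed.

Let hg n u w := sp_eval (riemann_process n) u w - H (Num.max 0 u) w.

Lemma riemann_cvg u w : s < u -> u <= t -> hg n u w @[n --> \oo] --> 0.
Proof.
move=> su ut; have cHw := within_continuous_max0 (@cH w).
have u0 : 0 <= u by rewrite (le_trans s0)// ltW.
apply/cvgrPdist_le => e e0.
have /cvgrPdist_le /(_ e e0) [r/= r0 hr] := cHw u.
near=> n.
have [i ni /andP[iu ui]] : exists2 i, (i < n.+1)%N &
    unif_grid s t n i < u <= unif_grid s t n i.+1.
  by apply: grid_cover; rewrite ?unif_grid0 ?unif_gridn.
rewrite sub0r normrN /hg (riemann_eval w ni iu ui) distrC (max_r u0).
have := hr (unif_grid s t n i); rewrite /= (max_r u0) (max_r (unif_grid_ge0 n i)); apply.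
rewrite ger0_norm ?subr_ge0 ?ltW//.
apply: (@le_lt_trans _ _ ((t - s) / n.+1%:R)).
  by rewrite -(unif_grid_mesh n i) lerB.
rewrite ltr_pdivrMr// mulrC -ltr_pdivrMr//.
near: n; exists (Num.truncn ((t - s) / r)).+1 => // n /= hn.
apply: (lt_trans (truncnS_gt _)).
by rewrite ltr_nat ltnS.
Unshelve. all: by end_near. Qed.

Lemma sp_eval_jointly_measurable (G : simple_process F) :
  measurable_fun setT (fun z : measurableTypeR R * T => sp_eval G z.1 z.2).
Proof.
rewrite /sp_eval; apply: measurable_sum => j.
apply: measurable_funM.
  apply: (measurableT_comp _ measurable_snd).
  apply: mwrt_measurable (@sp_coef_measurable _ _ _ _ G j).
  apply: (filtration_measurable hF); exact: sp_time_ge0.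
have : measurable_fun setT (\1_(`]sp_time G j, sp_time G j.+1]) : measurableTypeR R -> R).
  by apply: measurable_indic.
by move=> mi; exact: (measurableT_comp mi measurable_fst).
Qed.

Lemma riemann_error_jointly_measurable n :
  measurable_fun setT (fun z : measurableTypeR R * T => hg n z.1 z.2).
Proof.
apply: measurable_funB; first exact: sp_eval_jointly_measurable.
apply: continuous_paths_jointly_measurable => // u u0.
exact: (adapted_measurable hF).
Qed.

Let err n w := (\int[mu]_(u in `[s, t]) (hg n u w ^+ 2)%:E)%E.

Lemma measurable_riemann_error n : measurable_fun setT (err n).
Proof.
apply: (@measurable_path_integral _ _ _ (fun z => hg n z.1 z.2 ^+ 2)) => //.
  by apply: measurable_funX; exact: riemann_error_jointly_measurable.
by move=> z; exact: sqr_ge0.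
Qed.

Let mhgw n w : measurable_fun setT (fun u : measurableTypeR R => hg n u w ^+ 2).
Proof.
apply: measurable_funX.
have mw : measurable_fun setT (fun u : measurableTypeR R => (u, w)) by exact: measurable_pair2.
exact: (measurableT_comp (riemann_error_jointly_measurable n) mw).
Qed.

Let mu_st : mu (`]s, t]%classic : set (measurableTypeR R)) = (t - s)%:E.
Proof. by rewrite lebesgue_measure_itv/= lte_fin st -EFinB. Qed.

Let hg_bound n u w : s < u -> u <= t -> hg n u w ^+ 2 <= (2 * K) ^+ 2.
Proof.
move=> su ut.
have [i ni /andP[iu ui]] : exists2 i, (i < n.+1)%N &
    unif_grid s t n i < u <= unif_grid s t n i.+1.
  by apply: grid_cover; rewrite ?unif_grid0 ?unif_gridn.
have K0 : 0 <= K by apply: le_trans (bH 0 w).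
rewrite -[hg n u w ^+ 2]real_normK ?num_real// lerXn2r ?nnegrE ?mulr_ge0//.
rewrite /hg (riemann_eval w ni iu ui) (le_trans (ler_normB _ _))//.
by rewrite mulr_natl mulr2n lerD.
Qed.

Let err_oc n w : err n w = (\int[mu]_(u in `]s, t]) (hg n u w ^+ 2)%:E)%E.
Proof.
rewrite /err -integral_itv_obnd_cbnd//.
by apply/measurable_EFinP; apply: measurable_funTS; exact: mhgw.
Qed.

Let err_bound n w : (err n w <= ((2 * K) ^+ 2 * (t - s))%:E)%E.
Proof.
rewrite err_oc EFinM -mu_st -integral_cst//.
apply: ge0_le_integral => //.
- by move=> u _; rewrite lee_fin sqr_ge0.
- by apply/measurable_EFinP; apply: measurable_funTS; exact: mhgw.
- by move=> u /=; rewrite in_itv/= => /andP[su ut]; rewrite lee_fin hg_bound.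
Qed.

Let err_cvg w : err n w @[n --> \oo] --> 0%E.
Proof.
pose D : set (measurableTypeR R) := `]s, t]%classic.
have mD : measurable D by exact: measurable_itv.
have mf_ n : measurable_fun D (fun u => (hg n u w ^+ 2)%:E).
  by apply/measurable_EFinP; apply: measurable_funTS; exact: mhgw.
have ff : {ae mu, forall u, D u -> (fun n => (hg n u w ^+ 2)%:E) @ \oo --> (cst 0%E : R -> \bar R) u}.
  apply/aeW => u; rewrite /D/= in_itv/= => /andP[su ut].
  apply: cvg_EFin; first by apply: nearW => n.
  have := riemann_cvg w su ut => h.
  by have := cvgM h h; rewrite mulr0 => /(_ _); apply.
have ig : mu.-integrable D (cst ((2 * K) ^+ 2)%:E).
  apply/integrableP; split; first exact: measurable_cst.
  by rewrite integral_cst//= mu_st -EFinM ltry.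
have fg : {ae mu, forall u n, D u -> (`|(hg n u w ^+ 2)%:E| <= cst ((2 * K) ^+ 2)%:E u)%E}.
  apply/aeW => u n; rewrite /D/= in_itv/= => /andP[su ut].
  by rewrite /= lee_fin ger0_norm ?sqr_ge0//; exact: hg_bound.
have [_ _] := dominated_convergence mD mf_ (measurable_cst _) ff ig fg.
rewrite [X in _ --> X](_ : _ = 0%E); last by rewrite integral0.
move=> h; rewrite (_ : (fun n => err n w) = [sequence \int[mu]_(u in D) (hg n u w ^+ 2)%:E]_n)%E//.
by apply/funext => n; rewrite err_oc.
Qed.

Lemma riemann_error_in_probability :
  cvg0_in_probability P (fun n w => err n w).
Proof.
have e0 n w : (0 <= err n w)%E by apply: integral_ge0 => u _; rewrite lee_fin sqr_ge0.
have ff : {ae P, forall w, setT w -> (fun n => err n w) @ \oo --> (cst 0%E : T -> \bar R) w}.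
  by apply/aeW => w _; exact: err_cvg.
have ig : P.-integrable setT (cst ((2 * K) ^+ 2 * (t - s))%:E).
  exact: finite_measure_integrable_cst.
have fg : {ae P, forall w n, setT w ->
    (`|err n w| <= cst ((2 * K) ^+ 2 * (t - s))%:E w)%E}.
  by apply/aeW => w n _; rewrite gee0_abs.
have [_ _] := dominated_convergence measurableT measurable_riemann_error
  (measurable_cst _) ff ig fg.
rewrite integral0 => I0 e e_gt0.
apply: eventually_le_cvg0 => // c c0.
have := cvg0_eventually_le I0 (mulr_gt0 e_gt0 c0).
apply: filterS => n In.
have := le_integral_abse P measurableT (measurable_riemann_error n) e_gt0.
rewrite setTI; under eq_integral do rewrite gee0_abs//.
under eq_set do rewrite gee0_abs//.
move=> /le_trans /(_ In); rewrite EFinM lee_pmul2l//.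
Qed.

End riemann.

Section simple_difference.
Context {R : realType} {d : measure_display} {T : measurableType d}.
Local Notation mu := (@lebesgue_measure R).
Variables (P : probability T R) (F : R -> set_system T) (W : R -> T -> R).
Hypotheses (hF : is_filtration F) (hW : is_brownian_motion P F W).

Lemma sp_integral_measurable (G : simple_process F) t : 0 <= t ->
  measurable_fun setT (sp_integral G W t).
Proof.
move=> t0; apply: measurable_sum => j.
apply: measurable_funM.
  apply: mwrt_measurable (@sp_coef_measurable _ _ _ _ G j).
  by apply: (filtration_measurable hF); exact: sp_time_ge0.
by apply: measurable_funB; apply: (brownian_measurable hF hW); rewrite le_min t0 sp_time_ge0.
Qed.

Lemma simple_difference_in_probability (G G' : simple_process F) (s t b e : R) :
  0 <= s -> s < t -> 0 < b -> 0 < e ->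
  (P [set w | (e%:E <= `|(sp_integral G W t w - sp_integral G W s w)
                       - (sp_integral G' W t w - sp_integral G' W s w)|%:E)%E] <=
   P [set w | (b%:E <= \int[mu]_(u in `[s, t])
                          ((sp_eval G u w - sp_eval G' u w) ^+ 2)%:E)%E]
   + (@stop_cst R * b / e ^+ 2)%:E)%E.
Proof.
move=> s0 st b0 e0.
pose l := map (sp_time G) (iota 0 (sp_size G).+1)
       ++ map (sp_time G') (iota 0 (sp_size G').+1).
have [N [rho [rhos rhot rhost rhoS ref]]] := refining_grid l s0 st.
have rho0 i : 0 <= rho i by apply: (le_trans s0); case/andP: (rhost i).
have refG i j : (j <= sp_size G)%N -> sp_time G j < rho i.+1 -> sp_time G j <= rho i.
  move=> jG; apply: ref; rewrite mem_cat; apply/orP; left.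
  by apply: map_f; rewrite mem_iota add0n ltnS.
have refG' i j : (j <= sp_size G')%N -> sp_time G' j < rho i.+1 -> sp_time G' j <= rho i.
  move=> jG; apply: ref; rewrite mem_cat; apply/orP; right.
  by apply: map_f; rewrite mem_iota add0n ltnS.
pose xi i w := sp_eval G (rho i.+1) w - sp_eval G' (rho i.+1) w.
have mxi i : measurable_wrt (F (rho i)) (xi i).
  by apply: (mwrtB (filtration_sigma hF (rho0 i))); exact: (sp_eval_mwrt hF rho0).
have := grid_sum_in_probability hF hW rho0 rhoS mxi N b0 e0.
have gE w : grid_sum W rho xi N w =
    (sp_integral G W t w - sp_integral G W s w)
    - (sp_integral G' W t w - sp_integral G' W s w).
  rewrite -rhos -rhot !(sp_integral_on_grid W rhoS)// /grid_sum -sumrB.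
  by apply: eq_bigr => i _; rewrite -mulrBl.
have qE w : (\sum_(i < N) (rho i.+1 - rho i) * xi i w ^+ 2)%:E =
    (\int[mu]_(u in `[s, t]) ((sp_eval G u w - sp_eval G' u w) ^+ 2)%:E)%E.
  rewrite -rhos -rhot -(@step_integral _ rho
    (fun u => (sp_eval G u w - sp_eval G' u w) ^+ 2) N rhoS)//.
  - have mE (K : simple_process F) : measurable_fun setT (fun u : measurableTypeR R => sp_eval K u w).
      have mw : measurable_fun setT (fun u : measurableTypeR R => (u, w)) by exact: measurable_pair2.
      exact: (measurableT_comp (sp_eval_jointly_measurable hF K) mw).
    by apply: measurable_funX; apply: measurable_funB; exact: mE.
  - by move=> i x ix xi'; rewrite (sp_eval_on_grid refG w ix xi') (sp_eval_on_grid refG' w ix xi').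
  - by move=> x; exact: sqr_ge0.
under eq_set do rewrite gE.
by under [in X in (_ <= X + _)%E -> _]eq_set do rewrite qE.
Qed.

End simple_difference.

Section riemann_to_ito.
Context {R : realType} {d : measure_display} {T : measurableType d}.
Local Notation mu := (@lebesgue_measure R).
Variables (P : probability T R) (F : R -> set_system T) (W : R -> T -> R).
Hypotheses (hF : is_filtration F) (hW : is_brownian_motion P F W).

Lemma ito_increment_riemann (H I : R -> T -> R) (K s t : R) :
  adapted F H -> continuous_paths H -> (forall u w, `|H u w| <= K) ->
  is_ito_integral P F W H I -> 0 <= s -> s < t ->
  cvg0_in_probability P (fun n w =>
    `|grid_sum W (unif_grid s t n) (fun i => H (unif_grid s t n i)) n.+1 w
      - (I t w - I s w)|%:E).
Proof.
move=> aH cH bH [aI cI [G hG]] s0 st e e_gt0.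
have t0 : 0 <= t by rewrite (le_trans s0)// ltW.
apply: eventually_le_cvg0 => // th th0.
pose S n w := grid_sum W (unif_grid s t n) (fun i => H (unif_grid s t n i)) n.+1 w.
pose e' := e / 3; have e'0 : 0 < e' by rewrite divr_gt0.
pose th' := th / 5; have th'0 : 0 < th' by rewrite divr_gt0.
pose b := th' * e' ^+ 2 / (@stop_cst R + 1).
have k0 : 0 < @stop_cst R + 1 by rewrite ltr_wpDl// stop_cst_ge0.
have b0 : 0 < b by rewrite divr_gt0// mulr_gt0// exprn_gt0.
have sb : @stop_cst R * b / e' ^+ 2 <= th'.
  rewrite /b ler_pdivrMr ?exprn_gt0// mulrA ler_pdivrMr//.
  rewrite mulrC; apply: ler_wpM2l; last by rewrite lerDl.
  by rewrite mulr_ge0 ?sqr_ge0// ltW.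
have [G1t G2t] := hG t t0; have [_ G2s] := hG s s0.
pose Rn n := riemann_process aH bH s0 st n.
have b40 : 0 < b / 4 by rewrite divr_gt0.
near \oo => m.
have p1 : (P [set w | ((b / 4)%:E <= \int[mu]_(u in `[0%R, t]) ((sp_eval (G m) u w - H u w) ^+ 2)%:E)%E] <= th'%:E)%E.
  by near: m; exact: (cvg0_eventually_le (G1t _ b40) th'0).
have p2 : (P [set w | (e'%:E <= `|sp_integral (G m) W t w - I t w|%:E)%E] <= th'%:E)%E.
  by near: m; exact: (cvg0_eventually_le (G2t _ e'0) th'0).
have p3 : (P [set w | (e'%:E <= `|sp_integral (G m) W s w - I s w|%:E)%E] <= th'%:E)%E.
  by near: m; exact: (cvg0_eventually_le (G2s _ e'0) th'0).
have := cvg0_eventually_le (riemann_error_in_probability P hF aH cH bH s0 st b40) th'0.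
apply: filterS => n p4.
have mI u : 0 <= u -> measurable_fun setT (I u) by exact: (adapted_measurable hF).
have mG u : 0 <= u -> measurable_fun setT (sp_integral (G m) W u).
  exact: (sp_integral_measurable hF hW).
have mRn u : 0 <= u -> measurable_fun setT (sp_integral (Rn n) W u).
  exact: (sp_integral_measurable hF hW).
have mS : measurable_fun setT (S n).
  rewrite (_ : S n = fun w => sp_integral (Rn n) W t w - sp_integral (Rn n) W s w).
    by apply: measurable_funB; exact: mRn.
  by apply/funext => w; rewrite riemann_integral.
pose H' u := H (Num.max 0 u).
have mH' : measurable_fun setT (fun z : measurableTypeR R * T => H' z.1 z.2).
  apply: continuous_paths_jointly_measurable => // u u0.
  exact: (adapted_measurable hF).
pose q1 w := (\int[mu]_(u in `[0%R, t]) ((sp_eval (G m) u w - H' u w) ^+ 2)%:E)%E.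
pose q2 w := (\int[mu]_(u in `[s, t]) ((sp_eval (Rn n) u w - H' u w) ^+ 2)%:E)%E.
pose q3 w := (\int[mu]_(u in `[s, t]) ((sp_eval (G m) u w - sp_eval (Rn n) u w) ^+ 2)%:E)%E.
have q1E w : q1 w = (\int[mu]_(u in `[0%R, t]) ((sp_eval (G m) u w - H u w) ^+ 2)%:E)%E.
  by apply: eq_integral => u; rewrite inE/= in_itv/= => /andP[u0 _]; rewrite /H' max_r.
have mev (A : simple_process F) := sp_eval_jointly_measurable hF A.
have mq (f g : measurableTypeR R * T -> R) (D : set (measurableTypeR R)) :
    measurable D -> measurable_fun setT f -> measurable_fun setT g ->
    measurable_fun setT (fun w => \int[mu]_(u in D) ((f (u, w) - g (u, w)) ^+ 2)%:E)%E.
  move=> mD mf mg.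
  apply: (measurable_path_integral (phi := fun z => (f z - g z) ^+ 2)) => //.
    by apply: measurable_funX; exact: measurable_funB.
  by move=> z; exact: sqr_ge0.
have mq1 : measurable_fun setT q1.
  exact: (mq (fun z => sp_eval (G m) z.1 z.2) (fun z => H' z.1 z.2)).
have mq2 : measurable_fun setT q2.
  exact: (mq (fun z => sp_eval (Rn n) z.1 z.2) (fun z => H' z.1 z.2)).
have mq3 : measurable_fun setT q3.
  exact: (mq (fun z => sp_eval (G m) z.1 z.2) (fun z => sp_eval (Rn n) z.1 z.2)).
have q3le w : (q3 w <= 2%:E * q1 w + 2%:E * q2 w)%E.
  have mw : measurable_fun setT (fun u : measurableTypeR R => (u, w)) by exact: measurable_pair2.
  have m1 D : measurable_fun D (fun u : measurableTypeR R => ((sp_eval (G m) u w - H' u w) ^+ 2)%:E).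
    apply/measurable_EFinP; apply: measurable_funTS; apply: measurable_funX.
    apply: measurable_funB; first exact: (measurableT_comp (mev (G m)) mw).
    exact: (measurableT_comp mH' mw).
  have m2 D : measurable_fun D (fun u : measurableTypeR R => ((sp_eval (Rn n) u w - H' u w) ^+ 2)%:E).
    apply/measurable_EFinP; apply: measurable_funTS; apply: measurable_funX.
    apply: measurable_funB; first exact: (measurableT_comp (mev (Rn n)) mw).
    exact: (measurableT_comp mH' mw).
  have m3 D : measurable_fun D (fun u : measurableTypeR R => ((sp_eval (G m) u w - sp_eval (Rn n) u w) ^+ 2)%:E).
    apply/measurable_EFinP; apply: measurable_funTS; apply: measurable_funX.
    apply: measurable_funB; first exact: (measurableT_comp (mev (G m)) mw).
    exact: (measurableT_comp (mev (Rn n)) mw).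
  have sq0 (x : R) : (0 <= (x ^+ 2)%:E)%E by rewrite lee_fin sqr_ge0.
  apply: (@le_trans _ _ (2%:E * (\int[mu]_(u in `[s, t]) ((sp_eval (G m) u w - H' u w) ^+ 2)%:E) + 2%:E * q2 w)%E); last first.
    rewrite leeD2r// lee_wpmul2l// ?lee_fin//.
    apply: ge0_subset_integral => //.
    by move=> u /=; rewrite !in_itv/= => /andP[su ->]; rewrite (le_trans s0 su).
  rewrite /q2 -!ge0_integralZl// -ge0_integralD//; last 4 first.
  - by move=> u _; rewrite mule_ge0.
  - exact: measurable_funeM.
  - by move=> u _; rewrite mule_ge0.
  - exact: measurable_funeM.
  apply: ge0_le_integral => //.
  - by apply: emeasurable_funD; exact: measurable_funeM.
  move=> u _; rewrite -!EFinM -EFinD lee_fin.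
  set x := sp_eval _ u w; set y := sp_eval _ u w; set z := H' u w.
  by have := sqr_ge0 ((x - z) + (y - z)); lra.
have mlev (f : T -> R) (a : R) : measurable_fun setT f ->
    measurable [set w | (a%:E <= `|f w|%:E)%E].
  move=> mf; apply: measurable_ge_level; apply/measurable_EFinP.
  exact: measurableT_comp.
have D1 : measurable_fun setT (fun w => sp_integral (G m) W t w - I t w).
  by apply: measurable_funB; [exact: mG|exact: mI].
have D2 : measurable_fun setT (fun w => sp_integral (G m) W s w - I s w).
  by apply: measurable_funB; [exact: mG|exact: mI].
have D3 : measurable_fun setT (fun w => sp_integral (G m) W t w - sp_integral (G m) W s w
    - (sp_integral (Rn n) W t w - sp_integral (Rn n) W s w)).
  by apply: measurable_funB; apply: measurable_funB; (exact: mG || exact: mRn).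
have D4 : measurable_fun setT (fun w => S n w - (I t w - I s w)).
  by apply: measurable_funB => //; apply: measurable_funB; exact: mI.
have c1 : (P [set w | (b%:E <= q3 w)%E] <= th'%:E + th'%:E)%E.
  apply: (@le_trans _ _ (P [set w | ((b / 4)%:E <= q1 w)%E] + P [set w | ((b / 4)%:E <= q2 w)%E])%E); last first.
    by apply: leeD => //; under eq_set do rewrite q1E.
  apply: probabilityU_le; try exact: measurable_ge_level.
  move=> w /= bq; have [h1|h1] := leP (b / 4)%:E (q1 w); first by left.
  have [h2|h2] := leP (b / 4)%:E (q2 w); first by right.
  have : (b%:E < b%:E)%E; last by rewrite ltxx.
  apply: (le_lt_trans bq); apply: (le_lt_trans (q3le w)).
  rewrite [ltRHS](_ : _ = 2%:E * (b / 4)%:E + 2%:E * (b / 4)%:E)%E; last first.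
    by rewrite -!EFinM -EFinD; congr (_%:E); field.
  by apply: lteD; rewrite lte_pmul2l.
have c2 := simple_difference_in_probability hF hW (G m) (Rn n) s0 st b0 e'0.
have c3 : (P [set w | (e'%:E <= `|(sp_integral (G m) W t w - sp_integral (G m) W s w)
    - (sp_integral (Rn n) W t w - sp_integral (Rn n) W s w)|%:E)%E] <= (th'%:E + th'%:E) + th'%:E)%E.
  apply: (le_trans c2); apply: leeD => //; exact: sb.
apply: (@le_trans _ _ (((th'%:E + th'%:E) + th'%:E) + (th'%:E + th'%:E))%E); last first.
  by rewrite -!EFinD lee_fin /th'; lra.
apply: (@le_trans _ _ (P [set w | (e'%:E <= `|sp_integral (G m) W t w - sp_integral (G m) W s w
    - (sp_integral (Rn n) W t w - sp_integral (Rn n) W s w)|%:E)%E] +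
   P ([set w | (e'%:E <= `|sp_integral (G m) W t w - I t w|%:E)%E] `|`
      [set w | (e'%:E <= `|sp_integral (G m) W s w - I s w|%:E)%E]))%E).
  apply: probabilityU_le.
  - exact: (mlev (fun w => S n w - (I t w - I s w))).
  - exact: (mlev (fun w => sp_integral (G m) W t w - sp_integral (G m) W s w
    - (sp_integral (Rn n) W t w - sp_integral (Rn n) W s w))).
  - by apply: measurableU; [exact: (mlev (fun w => sp_integral (G m) W t w - I t w))
      |exact: (mlev (fun w => sp_integral (G m) W s w - I s w))].
  move=> w /=; rewrite -(riemann_integral W aH bH s0 st) -/(Rn n) !lee_fin.
  set a1 := sp_integral _ _ t w; set a2 := sp_integral _ _ s w.
  set a3 := sp_integral _ _ t w; set a4 := sp_integral _ _ s w => h.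
  have [k1|k1] := leP e' `|a3 - a4 - (a1 - a2)|; first by left.
  have [k2|k2] := leP e' `|a3 - I t w|; first by right; left.
  have [k3|k3] := leP e' `|a4 - I s w|; first by right; right.
  have : e < e; last by rewrite ltxx.
  apply: (le_lt_trans h).
  rewrite [X in `|X|](_ : _ = - (a3 - a4 - (a1 - a2)) + (a3 - I t w) - (a4 - I s w)); last by ring.
  apply: (le_lt_trans (ler_normB _ _)).
  have := ler_normD (- (a3 - a4 - (a1 - a2))) (a3 - I t w); rewrite normrN => k.
  by move: k k1 k2 k3; rewrite /e'; lra.
apply: leeD => //; apply: (@le_trans _ _ _ _ _ (measureU2 _ _ _)) => //.
- exact: (mlev (fun w => sp_integral (G m) W t w - I t w)).
- exact: (mlev (fun w => sp_integral (G m) W s w - I s w)).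
exact: leeD.
Unshelve. all: by end_near. Qed.

End riemann_to_ito.

Lemma exprD_le2 (R : realType) (x y : R) n : 0 <= x -> 0 <= y ->
  (x + y) ^+ n <= 2 ^+ n * (x ^+ n + y ^+ n).
Proof.
move=> x0 y0; have [xy|/ltW yx] := leP x y.
  apply: (@le_trans _ _ ((2 * y) ^+ n)).
    by rewrite lerXn2r ?nnegrE ?addr_ge0 ?mulr_ge0// mulr_natl mulr2n lerD2r.
  by rewrite exprMn ler_wpM2l ?exprn_ge0// lerDr exprn_ge0.
apply: (@le_trans _ _ ((2 * x) ^+ n)).
  by rewrite lerXn2r ?nnegrE ?addr_ge0 ?mulr_ge0// mulr_natl mulr2n lerD2l.
by rewrite exprMn ler_wpM2l ?exprn_ge0// lerDl exprn_ge0.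
Qed.

Lemma lerXn_le (R : realType) (x y : R) n : 0 <= x -> x <= y -> x ^+ n <= y ^+ n.
Proof. by move=> x0 xy; rewrite lerXn2r ?nnegrE// (le_trans x0). Qed.

Lemma probability_integral_cst (R : realType) d (T : measurableType d)
    (P : probability T R) (r : R) : (\int[P]_w r%:E = r%:E)%E.
Proof. by rewrite integral_cst// [X in (_ * X)%E](probability_setT P) mule1. Qed.

Section moment_limit.
Context {R : realType} {d : measure_display} {T : measurableType d}.
Variable P : probability T R.

Lemma moment_limit (S : nat -> T -> R) (U : T -> R) (p : nat) (B : R) :
  (forall n, measurable_fun setT (S n)) -> measurable_fun setT U ->
  cvg0_in_probability P (fun n w => `|S n w - U w|%:E) ->
  (forall n, (\int[P]_w (`|S n w| ^+ p)%:E <= B%:E)%E) -> (0 < p)%N ->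
  (\int[P]_w (`|U w| ^+ p)%:E <= (2 ^+ p * B)%:E)%E.
Proof.
move=> mS mU SU SB p0.
have mabs (f : T -> R) : measurable_fun setT f ->
    measurable_fun setT (fun w => (`|f w| ^+ p)%:E).
  move=> mf; apply/measurable_EFinP; apply: measurable_funX.
  exact: measurableT_comp.
pose g k w := (Num.min `|U w| k%:R) ^+ p.
have g0 k w : 0 <= g k w by rewrite exprn_ge0// le_min normr_ge0 ler0n.
have mg k : measurable_fun setT (fun w => (g k w)%:E).
  apply/measurable_EFinP; apply: measurable_funX.
  by apply: measurable_minr => //; exact: measurableT_comp.
have gcvg w : (g k w)%:E @[k --> \oo] --> (`|U w| ^+ p)%:E.
  apply: cvg_near_cst; exists (Num.truncn `|U w|).+1 => // k /= hk.
  rewrite /g min_l// ltW//; apply: (lt_le_trans (truncnS_gt _)).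
  by rewrite ler_nat.
have gbound k : (\int[P]_w (g k w)%:E <= (2 ^+ p * B)%:E)%E.
  apply/lee_addgt0Pr => eta eta0.
  pose e := Num.min 1 (eta / (2 * 2 ^+ p)).
  have e0 : 0 < e by rewrite lt_min ltr01 divr_gt0// mulr_gt0// exprn_gt0.
  have ep : 2 ^+ p * e ^+ p <= eta / 2.
    have ee : e ^+ p <= e.
      by rewrite -[leRHS]expr1; apply: ler_wiXn2l => //; [exact: ltW|rewrite ge_min lexx].
    apply: (@le_trans _ _ (2 ^+ p * (eta / (2 * 2 ^+ p)))).
      rewrite ler_wpM2l ?exprn_ge0//; apply: (le_trans ee).
      by rewrite ge_min lexx orbT.
    rewrite le_eqVlt; apply/orP; left; apply/eqP; field.
    by rewrite expf_neq0.
  pose th := eta / (2 * (k%:R ^+ p + 1)).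
  have kp0 : 0 < (k%:R : R) ^+ p + 1 by rewrite ltr_wpDl// exprn_ge0.
  have th0 : 0 < th by rewrite divr_gt0// mulr_gt0.
  have [n _ /(_ n (leqnn n)) Pn] := cvg0_eventually_le (SU _ e0) th0.
  pose A := [set w | (e%:E <= `|S n w - U w|%:E)%E].
  have mA : measurable A.
    apply: measurable_ge_level; apply/measurable_EFinP; apply: measurableT_comp => //.
    exact: measurable_funB.
  have pt w : g k w <= 2 ^+ p * (`|S n w| ^+ p + e ^+ p) + k%:R ^+ p * \1_A w.
    have [wA|wA] := boolP (w \in A).
      rewrite indicE wA mulr1; apply: ler_wpDl.
        by rewrite mulr_ge0 ?exprn_ge0// addr_ge0 ?exprn_ge0// ltW.
      by rewrite lerXn2r ?nnegrE ?le_min ?normr_ge0 ?ler0n// ge_min lexx orbT.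
    rewrite indicE (negbTE wA) mulr0 addr0.
    apply: le_trans (exprD_le2 _ (normr_ge0 _) (ltW e0)).
    apply: lerXn_le; first by rewrite le_min normr_ge0 ler0n.
    rewrite ge_min; apply/orP; left.
    move: wA; rewrite notin_setE /A/= lee_fin => /negP; rewrite -ltNge => h.
    rewrite -[U w](subKr (S n w)) (le_trans (ler_normB _ _))// lerD2l ltW//.
  have mSE := mabs _ (mS n).
  have mind : measurable_fun setT (fun w : T => (k%:R ^+ p * \1_A w : R)%:E).
    by apply/measurable_EFinP; apply: measurable_funM => //; exact: measurable_indic.
  apply: (@le_trans _ _ (\int[P]_w (((2 ^+ p)%:E * (`|S n w| ^+ p)%:E + (2 ^+ p * e ^+ p)%:E)
      + (k%:R ^+ p * \1_A w)%:E)%E)%E).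
    apply: ge0_le_integral => //.
    - by move=> w _; rewrite lee_fin.
    - apply: emeasurable_funD => //; apply: emeasurable_funD => //.
      exact: measurable_funeM.
    - move=> w _; rewrite -EFinM -!EFinD lee_fin -mulrDr; exact: pt.
  have pp0 : 0 <= 2 ^+ p :> R by rewrite exprn_ge0.
  have ee0 : (0 <= (2 ^+ p * e ^+ p)%:E)%E.
    by rewrite lee_fin mulr_ge0// exprn_ge0// ltW.
  have n1 w : (0 <= (2 ^+ p)%:E * (`|S n w| ^+ p)%:E)%E.
    by rewrite mule_ge0 ?lee_fin// exprn_ge0.
  have m1 := measurable_funeM (2 ^+ p)%:E mSE.
  have n2 w : (0 <= (k%:R ^+ p * \1_A w : R)%:E)%E by rewrite lee_fin mulr_ge0 ?exprn_ge0.
  have n3 w : (0 <= (2 ^+ p)%:E * (`|S n w| ^+ p)%:E + (2 ^+ p * e ^+ p)%:E)%E.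
    by rewrite adde_ge0.
  have m3 := emeasurable_funD m1 (@measurable_cst _ _ T _ setT (2 ^+ p * e ^+ p)%:E).
  rewrite (ge0_integralD P measurableT (fun w _ => n3 w) m3 (fun w _ => n2 w) mind).
  rewrite (ge0_integralD P measurableT (fun w _ => n1 w) m1 (fun w _ => ee0) (measurable_cst _)).
  rewrite ge0_integralZl//.
  rewrite probability_integral_cst.
  rewrite [X in (_ + X)%E](_ : _ = ((k%:R ^+ p)%:E * P A)%E); last first.
    under eq_integral do rewrite EFinM.
    rewrite ge0_integralZl//; try by apply/measurable_EFinP; exact: measurable_indic.
    by rewrite integral_indic// setIT.
  apply: (@le_trans _ _ ((2 ^+ p * B)%:E + (eta / 2)%:E + (k%:R ^+ p * th)%:E)%E).
    apply: leeD; last by apply: lee_mulEFin => //; rewrite exprn_ge0.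
    by apply: leeD; [exact: lee_mulEFin|rewrite lee_fin].
  rewrite -!EFinD lee_fin -addrA lerD2l.
  have : k%:R ^+ p * th <= eta / 2.
    rewrite /th mulrA ler_pdivrMr ?mulr_gt0// [leRHS](_ : _ = eta * (k%:R ^+ p + 1)); last by field.
    by rewrite mulrC ler_wpM2l ?lerDl// ltW.
  lra.
have nd w : setT w -> {homo (fun k => (g k w)%:E) : i j / (i <= j)%N >-> (i <= j)%E}.
  move=> _ i j ij; rewrite lee_fin; apply: lerXn_le.
    by rewrite le_min normr_ge0 ler0n.
  by rewrite le_min ge_min lexx/= ge_min ler_nat ij orbT.
have := cvg_monotone_convergence (mu := P) measurableT mg (fun k w _ => g0 k w) nd.
under eq_integral do rewrite (cvg_lim (@ereal_hausdorff R) (gcvg _)).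
move=> h; rewrite -(cvg_lim (@ereal_hausdorff R) h).
apply: lime_le; first by apply/cvg_ex; eexists; exact: h.
by apply: nearW => k; exact: gbound.
Qed.

End moment_limit.

Section ito_moment.
Context {R : realType} {d : measure_display} {T : measurableType d}.
Variables (P : probability T R) (F : R -> set_system T) (W : R -> T -> R).
Hypotheses (hF : is_filtration F) (hW : is_brownian_motion P F W).

Definition ito_cst (m : nat) : R :=
  2 ^+ m.*2 * (expR (incr_cst R m) * incr_cst R m).

Lemma ito_increment_moment (H1 H2 I1 I2 : R -> T -> R) (K1 K2 a b s t B : R) m :
  adapted F H1 -> continuous_paths H1 -> (forall u w, `|H1 u w| <= K1) ->
  adapted F H2 -> continuous_paths H2 -> (forall u w, `|H2 u w| <= K2) ->
  is_ito_integral P F W H1 I1 -> is_ito_integral P F W H2 I2 ->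
  0 <= s -> s < t -> (0 < m)%N ->
  (forall u, s <= u -> u <= t ->
    (\int[P]_w (`|a * H1 u w + b * H2 u w| ^+ m.*2)%:E <= B%:E)%E) ->
  (\int[P]_w (`|a * (I1 t w - I1 s w) + b * (I2 t w - I2 s w)| ^+ m.*2)%:E <=
   (ito_cst m * (t - s) ^+ m * B)%:E)%E.
Proof.
move=> aH1 cH1 bH1 aH2 cH2 bH2 I1H I2H s0 st m0 HB.
have t0 : 0 <= t by rewrite (le_trans s0)// ltW.
pose H u w := a * H1 u w + b * H2 u w.
have aH : adapted F H.
  move=> u u0; have sF := filtration_sigma hF u0.
  apply: (mwrtD sF (g := fun w => a * H1 u w) (h := fun w => b * H2 u w)).
    by apply: (mwrtM sF (g := fun=> a)); [exact: mwrt_cst|exact: aH1].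
  by apply: (mwrtM sF (g := fun=> b)); [exact: mwrt_cst|exact: aH2].
pose rho n := unif_grid s t n.
have rho0 n i : 0 <= rho n i := unif_grid_ge0 s0 st n i.
have rhoS n i : rho n i <= rho n i.+1 := unif_gridS st n i.
pose S n w := grid_sum W (rho n) (fun i => H (rho n i)) n.+1 w.
pose S1 n w := grid_sum W (rho n) (fun i => H1 (rho n i)) n.+1 w.
pose S2 n w := grid_sum W (rho n) (fun i => H2 (rho n i)) n.+1 w.
have mxi n i : measurable_wrt (F (rho n i)) (H (rho n i)) by exact: aH.
have mS n : measurable_fun setT (S n).
  exact: mwrt_measurable (filtration_measurable hF (rho0 n n.+1))
    (grid_sum_mwrt hF hW (rho0 n) (rhoS n) (mxi n) n.+1).
have mS1 n : measurable_fun setT (S1 n).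
  exact: mwrt_measurable (filtration_measurable hF (rho0 n n.+1))
    (grid_sum_mwrt hF hW (rho0 n) (rhoS n) (fun i => aH1 _ (rho0 n i)) n.+1).
have mS2 n : measurable_fun setT (S2 n).
  exact: mwrt_measurable (filtration_measurable hF (rho0 n n.+1))
    (grid_sum_mwrt hF hW (rho0 n) (rhoS n) (fun i => aH2 _ (rho0 n i)) n.+1).
have SE n w : S n w = a * S1 n w + b * S2 n w.
  rewrite /S /S1 /S2 /grid_sum !mulr_sumr -big_split/=; apply: eq_bigr => i _.
  by rewrite /H; ring.
have mI1 : measurable_fun setT (fun w => I1 t w - I1 s w).
  by case: I1H => aI1 _ _; apply: measurable_funB; exact: (adapted_measurable hF).
have mI2 : measurable_fun setT (fun w => I2 t w - I2 s w).
  by case: I2H => aI2 _ _; apply: measurable_funB; exact: (adapted_measurable hF).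
pose U w := a * (I1 t w - I1 s w) + b * (I2 t w - I2 s w).
have mU : measurable_fun setT U.
  by apply: measurable_funD; exact: measurable_funM.
have SU : cvg0_in_probability P (fun n w => `|S n w - U w|%:E).
  move=> e e0; apply: eventually_le_cvg0 => // th th0.
  pose e1 := e / (2 * (`|a| + `|b| + 1)).
  have ab0 : 0 < `|a| + `|b| + 1 by rewrite ltr_wpDl// addr_ge0.
  have e10 : 0 < e1 by rewrite divr_gt0// mulr_gt0.
  have th20 : 0 < th / 2 by rewrite divr_gt0.
  have := cvg0_eventually_le (ito_increment_riemann hF hW aH1 cH1 bH1 I1H s0 st e10) th20.
  have := cvg0_eventually_le (ito_increment_riemann hF hW aH2 cH2 bH2 I2H s0 st e10) th20.
  apply: filterS2 => n q2 q1.
  rewrite [th]splitr EFinD; apply: le_trans (leeD q1 q2).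
  have mev (f g : T -> R) (x : R) : measurable_fun setT f -> measurable_fun setT g ->
      measurable [set w | (x%:E <= `|f w - g w|%:E)%E].
    move=> mf mg; apply: measurable_ge_level; apply/measurable_EFinP.
    by apply: measurableT_comp => //; exact: measurable_funB.
  apply: probabilityU_le; try exact: mev.
  - exact: (mev (S1 n)).
  - exact: (mev (S2 n)).
  move=> w /=; rewrite !lee_fin => h.
  have [k1|k1] := leP e1 `|S1 n w - (I1 t w - I1 s w)|; first by left.
  have [k2|k2] := leP e1 `|S2 n w - (I2 t w - I2 s w)|; first by right.
  exfalso; move: h; apply/negP; rewrite -ltNge SE /U.
  set x := I1 t w - _ in k1 *; set y := I2 t w - _ in k2 *.
  rewrite [X in `|X|](_ : _ = a * (S1 n w - x) + b * (S2 n w - y)); last by ring.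
  apply: (le_lt_trans (ler_normD _ _)); rewrite !normrM.
  apply: (@le_lt_trans _ _ (`|a| * e1 + `|b| * e1)).
    by rewrite lerD// ler_wpM2l// ltW.
  apply: (@lt_le_trans _ _ ((`|a| + `|b| + 1) * e1 * 2)).
    have : 0 <= (`|a| + `|b|) * e1 by rewrite mulr_ge0 ?addr_ge0// ltW.
    lra.
  by rewrite le_eqVlt; apply/orP; left; apply/eqP; rewrite /e1; field; rewrite gt_eqF.
have c0 : 0 <= expR (incr_cst R m) * incr_cst R m.
  by rewrite mulr_ge0 ?expR_ge0 ?incr_cst_ge0.
have ts0 : 0 < t - s by rewrite subr_gt0.
rewrite /ito_cst; set c := expR _ * _ in c0 *.
have -> : 2 ^+ m.*2 * c * (t - s) ^+ m * B =
    2 ^+ m.*2 * ((c * (t - s) ^+ m.-1) * ((t - s) * B)).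
  have -> : (t - s) ^+ m = (t - s) * (t - s) ^+ m.-1.
    by rewrite -[in LHS](prednK m0) exprS.
  by ring.
apply: (moment_limit mS mU SU); last by rewrite double_gt0.
move=> n.
have normE (x : R) : `|x| ^+ m.*2 = x ^+ m.*2.
  by rewrite -normrX ger0_norm// exprn_even_ge0// odd_double.
under eq_integral do rewrite normE.
have hA : rho n n.+1 - rho n 0%N <= t - s by rewrite /rho unif_grid0 unif_gridn.
apply: (le_trans (grid_sum_moment hF hW (rho0 n) (rhoS n) (mxi n) m0 ts0 hA)).
rewrite -/c; apply: lee_mulEFin; first by rewrite mulr_ge0// exprn_ge0// ltW.
apply: (@le_trans _ _ (\sum_(i < n.+1) ((rho n i.+1 - rho n i) * B)%:E)%E).
  apply: lee_sum => i _; apply: lee_mulEFin; first by rewrite subr_ge0.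
  have := HB (rho n i); under eq_integral do rewrite normE.
  apply.
    by rewrite -[leLHS](unif_grid0 s t n); exact: (grid_le (rhoS n)).
  by rewrite -[leRHS](unif_gridn s t n); apply: (grid_le (rhoS n)); exact: ltnW.
rewrite sumEFin lee_fin -mulr_suml.
under eq_bigr do rewrite /rho unif_grid_mesh.
by rewrite sumr_const card_ord -[X in X * B <= _]mulr_natr divfK ?pnatr_eq0.
Qed.
End ito_moment.

Lemma expr_tangent_le (R : realType) (m x : R) n : 0 <= m -> 0 <= x ->
  n.+1%:R * m ^+ n * x <= x ^+ n.+1 + n%:R * m ^+ n.+1.
Proof.
move=> m0 x0; elim: n => [|n IH]; first by rewrite !expr0 !expr1 mul0r addr0 !mul1r.
have k0 : 0 <= n.+1%:R * m ^+ n * (x - m) ^+ 2.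
  by apply: mulr_ge0 (sqr_ge0 _); rewrite mulr_ge0// exprn_ge0.
have := ler_wpM2r x0 IH.
rewrite mulrDl -exprSr => IHx.
rewrite -subr_ge0.
have -> : x ^+ n.+2 + n.+1%:R * m ^+ n.+2 - n.+2%:R * m ^+ n.+1 * x =
   (x ^+ n.+2 + n%:R * m ^+ n.+1 * x - n.+1%:R * m ^+ n * x * x)
   + n.+1%:R * m ^+ n * (x - m) ^+ 2.
  by rewrite !exprS -!natr1; ring.
by rewrite addr_ge0// subr_ge0.
Qed.

Section path_moment.
Context {R : realType} {d : measure_display} {T : measurableType d}.
Local Notation mu := (@lebesgue_measure R).
Variables (P : probability T R) (Phi : measurableTypeR R * T -> R).
Variables (D : set (measurableTypeR R)) (k : measurableTypeR R -> R) (c : R).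
Hypotheses (mPhi : measurable_fun setT Phi) (mD : measurable D).
Hypotheses (mk : measurable_fun setT k) (k0 : forall u, 0 <= k u) (c0 : 0 < c).
Hypothesis kc : (\int[mu]_(u in D) (k u)%:E <= c%:E)%E.

Let g u w := k u * Phi (u, w).
Let J w := (\int[mu]_(u in D) `|g u w|%:E)%E.
Let I w := \int[mu]_(u in D) (g u w).

Let mg : measurable_fun setT (fun z : measurableTypeR R * T => g z.1 z.2).
Proof.
apply: measurable_funM; first exact: (measurableT_comp mk measurable_fst).
by apply: (eq_measurable_fun Phi) => // -[u w] _.
Qed.

Let mgw w : measurable_fun setT (fun u : measurableTypeR R => g u w).
Proof.
have mw : measurable_fun setT (fun u : measurableTypeR R => (u, w)) by exact: measurable_pair2.
exact: (measurableT_comp mg mw).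
Qed.

Lemma measurable_path_Rintegral : measurable_fun setT I.
Proof.
have mpart (s : R) : measurable_fun setT
    (fun w => \int[mu]_(u in D) (Num.max (s * g u w) 0)%:E)%E.
  apply: (measurable_path_integral (phi := fun z => Num.max (s * g z.1 z.2) 0)) => //.
    by apply: measurable_maxr => //; exact: measurable_funM.
  by move=> z; rewrite le_max lexx orbT.
have -> : I = fine \o (fun w => \int[mu]_(u in D) (Num.max (1 * g u w) 0)%:E
    - \int[mu]_(u in D) (Num.max (-1 * g u w) 0)%:E)%E.
  apply/funext => w; rewrite /I /Rintegral /= integralE; congr (fine (_ - _)).
    by apply: eq_integral => u _; rewrite funeposE mul1r EFin_max.
  by apply: eq_integral => u _; rewrite funenegE mulN1r EFin_max.
by apply: measurableT_comp => //; apply: emeasurable_funB.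
Qed.

(* a path that is not integrable has integral 0 by convention *)
Let normI w : I w = 0 \/ (`|I w|%:E <= J w)%E.
Proof.
have [i|ni] := pselect (mu.-integrable D (EFin \o g^~ w)); [right|left].
  rewrite /I EFin_normr_Rintegral//.
  apply: le_trans (le_abse_integral _ _ _) _ => //.
  by apply/measurable_EFinP; exact: measurable_funTS.
rewrite /I /Rintegral.
suff : (\int[mu]_(u in D) (g u w)%:E)%E \isn't a fin_num.
  by rewrite fin_numEn => /orP[] /eqP ->.
rewrite -integral_fin_num_abs//; last exact: measurable_funTS.
apply/negP => h; apply: ni; apply/integrableP; split => //.
by apply/measurable_EFinP; exact: measurable_funTS.
Qed.

Lemma path_integral_moment n (B : R) : (0 < n)%N -> 0 <= B ->
  (forall u, D u -> (\int[P]_w (`|Phi (u, w)| ^+ n)%:E <= B%:E)%E) ->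
  (\int[P]_w (`|I w| ^+ n)%:E <= (c ^+ n * B)%:E)%E.
Proof.
case: n => // n _ B0 HB.
pose Q w := (\int[mu]_(u in D) (k u * `|Phi (u, w)| ^+ n.+1)%:E)%E.
have mphi : measurable_fun setT (fun z : measurableTypeR R * T => k z.1 * `|Phi z| ^+ n.+1).
  apply: measurable_funM; first exact: (measurableT_comp mk measurable_fst).
  by apply: measurable_funX; exact: measurableT_comp.
have phi0 (z : measurableTypeR R * T) : 0 <= k z.1 * `|Phi z| ^+ n.+1.
  by rewrite mulr_ge0// exprn_ge0.
have Q0 w : (0 <= Q w)%E by apply: integral_ge0 => u _; rewrite lee_fin mulr_ge0// exprn_ge0.
have mQ : measurable_fun setT Q.
  exact: (measurable_path_integral mphi phi0 mD).
have mw (w : T) : measurable_fun setT (fun u : measurableTypeR R => (u, w)) by exact: measurable_pair2.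
have pathwise w : ((`|I w| ^+ n.+1)%:E <= (c ^+ n)%:E * Q w)%E.
  have [->|IJ] := normI w.
    by rewrite normr0 expr0n/= mule_ge0// lee_fin exprn_ge0// ltW.
  pose m := `|I w| / c; have m0 : 0 <= m by rewrite divr_ge0// ltW.
  have mc : m * c = `|I w| by rewrite /m divfK// gt_eqF.
  have -> : (`|I w| ^+ n.+1)%:E = ((c ^+ n)%:E * (m ^+ n.+1 * c)%:E)%E.
    by rewrite -EFinM -mc exprMn !exprS; congr (_%:E); ring.
  apply: lee_wpmul2l; first by rewrite lee_fin exprn_ge0// ltW.
  rewrite -(@leeD2rE _ (n%:R * m ^+ n.+1 * c)%:E)// -EFinD.
  have -> : m ^+ n.+1 * c + n%:R * m ^+ n.+1 * c = n.+1%:R * m ^+ n * `|I w|.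
    by rewrite -mc exprS -natr1; ring.
  have nm0 : 0 <= n.+1%:R * m ^+ n by rewrite mulr_ge0// exprn_ge0.
  apply: (@le_trans _ _ ((n.+1%:R * m ^+ n)%:E * J w)%E).
    by rewrite EFinM lee_wpmul2l// lee_fin.
  have mabsg : measurable_fun D (fun u => `|g u w|%:E).
    apply/measurable_EFinP; apply: measurable_funTS.
    by apply: measurableT_comp => //; exact: mgw.
  have mQw : measurable_fun D (fun u => (k u * `|Phi (u, w)| ^+ n.+1)%:E).
    apply/measurable_EFinP; apply: measurable_funTS.
    exact: (measurableT_comp mphi (mw w)).
  have mkD : measurable_fun D (fun u => (k u)%:E).
    by apply/measurable_EFinP; exact: measurable_funTS.
  have cm0 : 0 <= n%:R * m ^+ n.+1 by rewrite mulr_ge0// exprn_ge0.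
  rewrite /J -ge0_integralZl//.
  apply: (@le_trans _ _ (\int[mu]_(u in D) ((k u * `|Phi (u, w)| ^+ n.+1)%:E +
      (n%:R * m ^+ n.+1)%:E * (k u)%:E))%E).
    apply: ge0_le_integral => //.
    - by move=> u _; rewrite mule_ge0// lee_fin.
    - exact: measurable_funeM.
    - by apply: emeasurable_funD => //; exact: measurable_funeM.
    move=> u _; rewrite -!EFinM -EFinD lee_fin /g normrM (ger0_norm (k0 u)).
    have := ler_wpM2l (k0 u) (expr_tangent_le n m0 (normr_ge0 (Phi (u, w)))).
    lra.
  rewrite (ge0_integralD mu mD _ mQw _ (measurable_funeM _ mkD)); last 2 first.
  - by move=> u _; rewrite lee_fin; exact: (phi0 (u, w)).
  - by move=> u _; rewrite mule_ge0 ?lee_fin.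
  apply: leeD => //; rewrite ge0_integralZl ?lee_fin//; first exact: lee_mulEFin.
  by move=> u _; rewrite lee_fin.
have mPn : measurable_fun setT (fun w => (`|I w| ^+ n.+1)%:E).
  apply/measurable_EFinP; apply: measurable_funX; apply: measurableT_comp => //.
  exact: measurable_path_Rintegral.
have cpow0 : 0 <= c ^+ n by rewrite exprn_ge0// ltW.
apply: (@le_trans _ _ (\int[P]_w ((c ^+ n)%:E * Q w))%E).
  apply: ge0_le_integral => //.
  by apply: measurable_funeM.
rewrite ge0_integralZl ?lee_fin// exprSr -mulrA; apply: lee_mulEFin => //.
rewrite (path_integral_tonelli P mphi phi0 mD).
apply: (@le_trans _ _ (\int[mu]_(u in D) (B%:E * (k u)%:E))%E).
  have mkD : measurable_fun D (fun u => (k u)%:E).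
    by apply/measurable_EFinP; exact: measurable_funTS.
  apply: ge0_le_integral => //.
  - by move=> u _; apply: integral_ge0 => w _; rewrite lee_fin; exact: (phi0 (u, w)).
  - apply: measurable_funTS.
    apply: (measurable_fun_fubini_tonelli_F (m2 := P)
      (fun z : measurableTypeR R * T => (k z.1 * `|Phi z| ^+ n.+1)%:E)) => //.
    exact/measurable_EFinP.
  - exact: measurable_funeM.
  move=> u Du; under eq_integral do rewrite EFinM /=.
  rewrite ge0_integralZl ?lee_fin//.
    by rewrite muleC; apply: lee_wpmul2r; rewrite ?lee_fin//; exact: HB.
  apply/measurable_EFinP; apply: measurable_funX; apply: measurableT_comp => //.
  by apply: (measurableT_comp mPhi); exact: measurable_pair1.
rewrite ge0_integralZl ?lee_fin//.
  by rewrite mulrC; exact: lee_mulEFin.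
  by apply/measurable_EFinP; exact: measurable_funTS.
by move=> u _; rewrite lee_fin.
Qed.

End path_moment.

Section moment_families.
Context {R : realType} {I : Type} {d : I -> measure_display}.
Context {T : forall i, measurableType (d i)}.
Variable P : forall i, probability (T i) R.

Definition momO (K : Type) (D : I -> K -> Prop) (eta : I -> K -> R)
    (U : forall i, K -> T i -> R) : Prop :=
  (forall i k, D i k -> measurable_fun setT (U i k)) /\
  forall n, (0 < n)%N -> exists C, 0 <= C /\ forall i k, D i k ->
    (\int[P i]_w (`|U i k w| ^+ n)%:E <= (C * eta i k ^+ n)%:E)%E.

Section fixed_index.
Variables (K : Type) (D : I -> K -> Prop).
Implicit Types (eta : I -> K -> R) (U V : forall i, K -> T i -> R).

Let mabs i (f : T i -> R) n : measurable_fun setT f ->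
  measurable_fun setT (fun w => (`|f w| ^+ n)%:E).
Proof.
move=> mf; apply/measurable_EFinP; apply: measurable_funX.
exact: measurableT_comp.
Qed.

Lemma momO_ae_le eta U V : momO D eta V ->
  (forall i k, D i k -> measurable_fun setT (U i k)) ->
  (forall i k, D i k -> {ae P i, forall w, `|U i k w| <= `|V i k w|}) ->
  momO D eta U.
Proof.
move=> [mV HV] mU UV; split=> // n n0.
have [C [C0 HC]] := HV n n0; exists C; split => // i k Dik.
apply: le_trans (HC i k Dik).
apply: ae_ge0_le_integral => //; first exact: mabs (mU _ _ Dik).
- exact: mabs (mV _ _ Dik).
apply: filterS (UV i k Dik) => w h _; rewrite lee_fin.
exact: lerXn_le.
Qed.

Lemma momO_le eta U V : momO D eta V ->
  (forall i k, D i k -> measurable_fun setT (U i k)) ->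
  (forall i k w, D i k -> `|U i k w| <= `|V i k w|) ->
  momO D eta U.
Proof.
move=> HV mU UV; apply: momO_ae_le HV mU _ => i k Dik.
by apply/aeW => w; exact: UV.
Qed.

Lemma momO_det eta (r : I -> K -> R) (c : R) : 0 <= c ->
  (forall i k, D i k -> `|r i k| <= c * eta i k) ->
  momO D eta (fun i k _ => r i k).
Proof.
move=> c0 rc; split=> // n n0; exists (c ^+ n); split; first exact: exprn_ge0.
move=> i k Dik; rewrite probability_integral_cst lee_fin -exprMn.
by apply: lerXn_le => //; exact: rc.
Qed.

Lemma momO_weaken eta eta' U (c : R) : momO D eta U ->
  (forall i k, D i k -> 0 <= eta i k <= c * eta' i k) -> 0 <= c ->
  momO D eta' U.
Proof.
move=> [mU HU] ee c0; split=> // n n0.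
have [C [C0 HC]] := HU n n0; exists (C * c ^+ n).
split; first by rewrite mulr_ge0// exprn_ge0.
move=> i k Dik; apply: (le_trans (HC i k Dik)); rewrite lee_fin -mulrA ler_wpM2l//.
have /andP[e0 ec] := ee i k Dik.
by rewrite -exprMn; exact: lerXn_le.
Qed.

Lemma momO_scale eta U (a : R) : momO D eta U ->
  momO D eta (fun i k w => a * U i k w).
Proof.
move=> [mU HU]; split=> [i k Dik|n n0].
  by apply: measurable_funM => //; exact: mU.
have [C [C0 HC]] := HU n n0; exists (`|a| ^+ n * C).
split; first by rewrite mulr_ge0// exprn_ge0.
move=> i k Dik; under eq_integral do rewrite normrM exprMn EFinM.
rewrite ge0_integralZl//; try exact: mabs (mU _ _ Dik).
by rewrite -mulrA; apply: lee_mulEFin; [exact: exprn_ge0|exact: HC].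
Qed.

Lemma momO_abs eta U : momO D eta U -> momO D eta (fun i k w => `|U i k w|).
Proof.
move=> HU; apply: momO_le (HU) _ _ => [i k Dik|i k w _]; last by rewrite normr_id.
by apply: measurableT_comp => //; case: HU => mU _; exact: mU.
Qed.

Lemma momO_add eta U V : momO D eta U -> momO D eta V ->
  momO D eta (fun i k w => U i k w + V i k w).
Proof.
move=> [mU HU] [mV HV]; split=> [i k Dik|n n0].
  by apply: measurable_funD; [exact: mU|exact: mV].
have [C [C0 HC]] := HU n n0; have [B [B0 HB]] := HV n n0.
exists (2 ^+ n * (C + B)).
split; first by rewrite mulr_ge0 ?exprn_ge0// addr_ge0.
move=> i k Dik.
have mUn := mabs n (mU _ _ Dik); have mVn := mabs n (mV _ _ Dik).
have n1 w : (0 <= (`|U i k w| ^+ n)%:E)%E by rewrite lee_fin exprn_ge0.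
have n2 w : (0 <= (`|V i k w| ^+ n)%:E)%E by rewrite lee_fin exprn_ge0.
have p0 : 0 <= 2 ^+ n :> R by rewrite exprn_ge0.
apply: (@le_trans _ _ (\int[P i]_w ((2 ^+ n)%:E * ((`|U i k w| ^+ n)%:E + (`|V i k w| ^+ n)%:E)))%E).
  apply: ge0_le_integral => //.
  - apply: (mabs n (f := fun w => U i k w + V i k w)).
    by apply: measurable_funD; [exact: mU|exact: mV].
  - by apply: measurable_funeM; exact: emeasurable_funD.
  move=> w _; rewrite -EFinD -EFinM lee_fin.
  apply: le_trans (exprD_le2 _ (normr_ge0 _) (normr_ge0 _)).
  by apply: lerXn_le => //; exact: ler_normD.
rewrite ge0_integralZl//; try exact: emeasurable_funD;
  try by move=> w _; rewrite adde_ge0.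
rewrite -mulrA; apply: lee_mulEFin => //.
rewrite ge0_integralD// mulrDl EFinD.
by apply: leeD; [exact: HC|exact: HB].
Qed.

Lemma momO_mul eta eta' U V : momO D eta U -> momO D eta' V ->
  (forall i k, D i k -> 0 < eta i k) -> (forall i k, D i k -> 0 < eta' i k) ->
  momO D (fun i k => eta i k * eta' i k) (fun i k w => U i k w * V i k w).
Proof.
move=> [mU HU] [mV HV] e0 e0'; split=> [i k Dik|n n0].
  by apply: measurable_funM; [exact: mU|exact: mV].
have n20 : (0 < n.*2)%N by rewrite double_gt0.
have [C [C0 HC]] := HU _ n20; have [B [B0 HB]] := HV _ n20.
exists (C + B); split; first by rewrite addr_ge0.
move=> i k Dik; have e1 := e0 _ _ Dik; have e2 := e0' _ _ Dik.
have mUn := mabs n.*2 (mU _ _ Dik); have mVn := mabs n.*2 (mV _ _ Dik).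
have n1 w : (0 <= (`|U i k w| ^+ n.*2)%:E)%E by rewrite lee_fin exprn_ge0.
have n2 w : (0 <= (`|V i k w| ^+ n.*2)%:E)%E by rewrite lee_fin exprn_ge0.
set a := eta i k in e1 *; set b := eta' i k in e2 *.
pose q := (b / a) ^+ n; have q0 : 0 < q by rewrite exprn_gt0// divr_gt0.
apply: (@le_trans _ _ (\int[P i]_w (q%:E * (`|U i k w| ^+ n.*2)%:E + (q^-1)%:E * (`|V i k w| ^+ n.*2)%:E))%E).
  apply: ge0_le_integral => //.
  - apply: (mabs n (f := fun w => U i k w * V i k w)).
    by apply: measurable_funM; [exact: mU|exact: mV].
  - by apply: emeasurable_funD; exact: measurable_funeM.
  move=> w _; rewrite -!EFinM -EFinD lee_fin normrM exprMn.
  set x := `|U i k w| ^+ n; set y := `|V i k w| ^+ n.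
  have -> : `|U i k w| ^+ n.*2 = x ^+ 2 by rewrite -exprM muln2.
  have -> : `|V i k w| ^+ n.*2 = y ^+ 2 by rewrite -exprM muln2.
  have qn0 : q != 0 by rewrite gt_eqF.
  have xy0 : 0 <= x * y by rewrite mulr_ge0 ?exprn_ge0.
  have := mulr_ge0 (ltW q0) (sqr_ge0 (x - q^-1 * y)).
  have sqE (p z t : R) : p != 0 ->
      p * (z - p^-1 * t) ^+ 2 = p * z ^+ 2 + p^-1 * t ^+ 2 - 2 * (z * t).
    by move=> p0; field.
  rewrite sqE//.
  lra.
rewrite ge0_integralD//; try exact: measurable_funeM;
  try by move=> w _; rewrite mule_ge0// lee_fin ?invr_ge0 ltW.
have q0' := ltW q0; have qV0 : 0 <= q^-1 by rewrite invr_ge0.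
rewrite !ge0_integralZl// ?lee_fin//.
rewrite [(_ * (a * b) ^+ n)%R](_ : _ = q * (C * a ^+ n.*2) + q^-1 * (B * b ^+ n.*2)); last first.
  have aux (x y : R) : x != 0 -> y != 0 ->
      (C + B) * (x * y) = y / x * (C * x ^+ 2) + (y / x)^-1 * (B * y ^+ 2).
    by move=> x0 y0; field; rewrite x0 y0.
  by rewrite -muln2 !exprM exprMn /q expr_div_n; apply: aux; rewrite expf_neq0// gt_eqF.
by rewrite EFinD; apply: leeD; apply: lee_mulEFin => //; [exact: HC|exact: HB].
Qed.

Lemma momO_pow eta U m : (0 < m)%N -> momO D eta U ->
  momO D (fun i k => eta i k ^+ m) (fun i k w => U i k w ^+ m).
Proof.
move=> m0 [mU HU]; split=> [i k Dik|n n0].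
  by apply: measurable_funX; exact: mU.
have mn0 : (0 < m * n)%N by rewrite muln_gt0 m0.
have [C [C0 HC]] := HU _ mn0; exists C; split => // i k Dik.
by under eq_integral do rewrite normrX -exprM; rewrite -exprM; exact: HC.
Qed.

Lemma momO_even eta U :
  (forall i k, D i k -> 0 < eta i k) ->
  (forall i k, D i k -> measurable_fun setT (U i k)) ->
  (forall m, (0 < m)%N -> exists C, 0 <= C /\ forall i k, D i k ->
    (\int[P i]_w (`|U i k w| ^+ m.*2)%:E <= (C * eta i k ^+ m.*2)%:E)%E) ->
  momO D eta U.
Proof.
move=> e0 mU HU; split=> // n n0.
have [C [C0 HC]] := HU n n0; exists (C + 1); split; first by rewrite addr_ge0.
move=> i k Dik; have e1 := e0 _ _ Dik.
set a := eta i k in e1 *.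
pose q := (a ^+ n)^-1; have q0 : 0 < q by rewrite invr_gt0 exprn_gt0.
have mUn := mabs n.*2 (mU _ _ Dik).
have n1 w : (0 <= (`|U i k w| ^+ n.*2)%:E)%E by rewrite lee_fin exprn_ge0.
apply: (@le_trans _ _ (\int[P i]_w (q%:E * (`|U i k w| ^+ n.*2)%:E + (a ^+ n)%:E))%E).
  apply: ge0_le_integral => //.
  - exact: mabs (mU _ _ Dik).
  - by apply: emeasurable_funD => //; exact: measurable_funeM.
  move=> w _; rewrite -!EFinM -EFinD lee_fin.
  set x := `|U i k w| ^+ n.
  have -> : `|U i k w| ^+ n.*2 = x ^+ 2 by rewrite -exprM muln2.
  have qE : a ^+ n = q^-1 by rewrite /q invrK.
  have qn0 : q != 0 by rewrite gt_eqF.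
  have x0 : 0 <= x by rewrite exprn_ge0.
  have := mulr_ge0 (ltW q0) (sqr_ge0 (x - q^-1)).
  have sqE (p z : R) : p != 0 -> p * (z - p^-1) ^+ 2 = p * z ^+ 2 + p^-1 - 2 * z.
    by move=> p0; field.
  rewrite sqE//.
  rewrite qE; lra.
rewrite ge0_integralD//; try exact: measurable_funeM;
  try by move=> w _; rewrite ?mule_ge0// lee_fin ?exprn_ge0// ltW.
have q0' := ltW q0.
rewrite probability_integral_cst ge0_integralZl// ?lee_fin//.
rewrite mulrDl mul1r EFinD; apply: leeD => //.
rewrite [(C * a ^+ n)%R](_ : _ = q * (C * a ^+ n.*2)); last first.
  have aux (x : R) : x != 0 -> C * x = x^-1 * (C * x ^+ 2) by move=> x0; field.
  by rewrite /q -muln2 exprM; apply: aux; rewrite expf_neq0// gt_eqF.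
by apply: lee_mulEFin; [exact: ltW|exact: HC].
Qed.

End fixed_index.

Lemma momO_reindex (K K' : Type) (D : I -> K -> Prop) (D' : I -> K' -> Prop)
    (h : I -> K' -> K) eta U :
  momO D eta U -> (forall i k, D' i k -> D i (h i k)) ->
  momO D' (fun i k => eta i (h i k)) (fun i k => U i (h i k)).
Proof.
move=> [mU HU] DD; split=> [i k Dik|n n0]; first exact/mU/DD.
have [C [C0 HC]] := HU n n0; exists C; split => // i k Dik.
exact/HC/DD.
Qed.

Local Notation mu := (@lebesgue_measure R).

Lemma momO_path_integral (K : Type) (D : I -> K -> Prop) (A : I -> K -> set (measurableTypeR R))
    (kap : I -> K -> measurableTypeR R -> R) (c eta : I -> K -> R)
    (Phi : forall i, K -> measurableTypeR R * T i -> R) :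
  (forall i k, D i k -> measurable (A i k)) ->
  (forall i k, D i k -> measurable_fun setT (kap i k)) ->
  (forall i k, D i k -> forall u, 0 <= kap i k u) ->
  (forall i k, D i k -> 0 < c i k) ->
  (forall i k, D i k -> 0 <= eta i k) ->
  (forall i k, D i k -> (\int[mu]_(u in A i k) (kap i k u)%:E <= (c i k)%:E)%E) ->
  (forall i k, D i k -> measurable_fun setT (Phi i k)) ->
  momO (fun i (ku : K * R) => D i ku.1 /\ A i ku.1 ku.2)
    (fun i ku => eta i ku.1) (fun i ku w => Phi i ku.1 (ku.2, w)) ->
  momO D (fun i k => c i k * eta i k)
    (fun i k w => \int[mu]_(u in A i k) (kap i k u * Phi i k (u, w))).
Proof.
move=> mA mkap kap0 c0 eta0 kc mPhi [mP HP]; split=> [i k Dik|n n0].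
  by apply: measurable_path_Rintegral; [exact: mPhi|exact: mA|exact: mkap].
have [C [C0 HC]] := HP n n0; exists C; split => // i k Dik.
rewrite exprMn mulrCA.
apply: path_integral_moment.
all: try by [exact: mPhi|exact: mA|exact: mkap|exact: kap0|exact: c0|exact: kc].
- by [].
- by rewrite mulr_ge0// exprn_ge0// eta0.
by move=> u Au; exact: (HC i (k, u)).
Qed.

End moment_families.

Section half_line.
Context {R : realType}.
Local Notation mu := (@lebesgue_measure R).
Implicit Types (h g : R -> R) (a s t : R).

Definition hcont h := {within `[0, +oo[, continuous h}.

Lemma hcontP h : hcont h <-> continuous (fun t : R => h (Num.max 0 t)).
Proof.
split; first exact: within_continuous_max0.
move=> ch; apply: (@subspace_eq_continuous _ _ _ (fun t : R => h (Num.max 0 t))).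
  by move=> t; rewrite inE/= in_itv/= andbT => t0; rewrite max_r.
exact: continuous_subspaceT.
Qed.

Lemma hcont_at h t : hcont h -> 0 < t -> {for t, continuous h}.
Proof.
move=> /hcontP ch t0.
have := ch t; rewrite /continuous_at max_r ?ltW// => cht.
apply: cvg_trans cht; apply: near_eq_cvg; near=> x.
rewrite max_r// ltW//; near: x.
exact: (@cvgr_gt _ _ _ _ id t (@cvg_id _ _) 0 t0).
Unshelve. all: by end_near. Qed.

Lemma hcont_within h s t : hcont h -> 0 <= s -> {within `[s, t], continuous h}.
Proof.
move=> ch s0; apply: continuous_subspaceW ch => x /=; rewrite !in_itv/= andbT.
by move=> /andP[sx _]; exact: le_trans sx.
Qed.

Lemma hcont_integrable h s t : hcont h -> 0 <= s ->
  mu.-integrable (`[s, t]%classic : set (measurableTypeR R)) (EFin \o h).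
Proof.
move=> ch s0; apply: continuous_compact_integrable; first exact: segment_compact.
exact: hcont_within.
Qed.

Lemma hcont_cst (c : R) : hcont (fun=> c).
Proof. by apply/hcontP => t; exact: cst_continuous. Qed.

Lemma hcont_id : hcont id.
Proof. by apply/hcontP => t; exact: continuous_max0. Qed.

Lemma hcontD h g : hcont h -> hcont g -> hcont (fun t => h t + g t).
Proof. by move=> /hcontP ch /hcontP cg; apply/hcontP => t; apply: cvgD; [exact: ch|exact: cg]. Qed.

Lemma hcontM h g : hcont h -> hcont g -> hcont (fun t => h t * g t).
Proof. by move=> /hcontP ch /hcontP cg; apply/hcontP => t; apply: cvgM; [exact: ch|exact: cg]. Qed.

Lemma hcont_comp (k : R -> R) h : continuous k -> hcont h -> hcont (fun t => k (h t)).
Proof.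
move=> ck /hcontP ch; apply/hcontP => t.
exact: (@continuous_comp _ _ _ (fun t : R => h (Num.max 0 t)) k t (ch t) (ck _)).
Qed.

Lemma hcontN h : hcont h -> hcont (fun t => - h t).
Proof. by move=> /hcontP ch; apply/hcontP => t; apply: cvgN; exact: ch. Qed.

Lemma hcontB h g : hcont h -> hcont g -> hcont (fun t => h t - g t).
Proof. by move=> ch cg; apply: hcontD => //; exact: hcontN. Qed.

Lemma hcont_norm h : hcont h -> hcont (fun t => `|h t|).
Proof. by apply: hcont_comp; exact: norm_continuous. Qed.

Lemma hcontX h n : hcont h -> hcont (fun t => h t ^+ n).
Proof. by apply: (@hcont_comp (fun x => x ^+ n)); exact: exprn_continuous. Qed.

Lemma hcont_primitive h : hcont h ->
  hcont (fun t => \int[mu]_(s in `[0, t]) (h s)).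
Proof.
move=> ch; apply/subspace_continuousP => x /=; rewrite in_itv/= andbT => x0.
have b0 : 0 <= x + 1 by rewrite addr_ge0.
have cF := parameterized_integral_continuous b0 (hcont_integrable (x + 1) ch (lexx 0)).
have xb : `[0, x + 1]%classic x by rewrite /= in_itv/= x0 lerDl ler01.
have := (@subspace_continuousP _ `[(0 : R), x + 1]%classic _ _).1 cF x xb.
apply: cvg_trans => P; rewrite /= /within/= => hP.
have lt1 : \forall y \near x, y < x + 1.
  by apply: (@cvgr_lt _ _ _ _ id x (@cvg_id _ _)); rewrite ltrDl.
change (\forall y \near x, y \in `[0, +oo[ ->
  P (\int[mu]_(s in `[0, y]) (h s))).
have hP' : \forall y \near x, y \in `[0, x + 1] ->
  P (\int[mu]_(s in `[0, y]) (h s)) by exact: hP.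
apply: filterS2 lt1 hP' => y y1 hy; rewrite in_itv/= andbT => y0.
by apply: hy; rewrite in_itv/= y0 ltW.
Qed.

Lemma primitive_is_derive h t : hcont h -> 0 < t ->
  is_derive t 1 (fun t => \int[mu]_(s in `[0, t]) (h s)) (h t).
Proof.
move=> ch t0.
have tt1 : t < t + 1 by rewrite ltrDl.
have [dF F'] := continuous_FTC1_closed tt1 (hcont_integrable (t + 1) ch (lexx 0)) t0
  (hcont_at ch t0).
by apply: DeriveDef; [exact: dF|rewrite -derive1E; exact: F'].
Qed.

Lemma nonincreasing_of_derive h (dh : R -> R) t : hcont h ->
  (forall s, 0 < s -> is_derive s 1 h (dh s)) -> (forall s, 0 < s -> dh s <= 0) ->
  0 <= t -> h t <= h 0.
Proof.
move=> ch dhE dh0; rewrite le_eqVlt => /predU1P[<-//|t0].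
have dE s : s \in `]0, t[ -> is_derive s 1 h (dh s).
  by rewrite in_itv/= => /andP[s0 _]; exact: dhE.
have [s /[!in_itv]/= /andP[s0 st] E] := MVT t0 dE (@hcont_within _ 0 t ch (lexx 0)).
rewrite -subr_le0 E subr0; apply: mulr_le0_ge0; [exact: dh0|exact: ltW].
Qed.

End half_line.

Section comparison.
Context {R : realType}.
Local Notation mu := (@lebesgue_measure R).
Implicit Types (h g U Q V beta : R -> R) (a s t : R).

Lemma hcont_expR a : hcont (fun s => expR (a * s)).
Proof.
apply: (hcont_comp (k := expR)); first exact: continuous_expR.
by apply: hcontM; [exact: hcont_cst|exact: hcont_id].
Qed.

Lemma is_derive_expRM a t : is_derive t 1 (fun s => expR (a * s)) (a * expR (a * t)).
Proof.
have d1 : is_derive t 1 (fun s : R => a * s) (a * 1 + t * 0).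
  exact: (is_deriveM (f := cst a) (g := id)).
rewrite mulrC -[a in _ * a](_ : a * 1 + t * 0 = a); last by rewrite mulr0 addr0 mulr1.
exact: (is_derive1_comp (f := expR) (g := fun s => a * s)).
Qed.

Lemma exp_weight_integral h a t : hcont h ->
  \int[mu]_(s in `[0, t]) (expR (- (a * (t - s))) * h s) =
  expR (- (a * t)) * \int[mu]_(s in `[0, t]) (expR (a * s) * h s).
Proof.
move=> ch; rewrite -RintegralZl//; last first.
  by apply: hcont_integrable => //; apply: hcontM => //; exact: hcont_expR.
apply: eq_Rintegral => s _; rewrite mulrA -expRD; congr (expR _ * _); ring.
Qed.

(* [sqrt (V ^ 2 + th ^ 2)] is a smooth substitute for [|V|] *)
Lemma dissipative_comparison V (dV : R -> R) beta a t :
  0 < a -> hcont V -> hcont beta -> (forall s, 0 <= s -> 0 <= beta s) ->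
  (forall s, 0 < s -> is_derive s 1 V (dV s)) ->
  (forall s, 0 < s -> V s * dV s <= - a * V s ^+ 2 + `|V s| * beta s) ->
  0 <= t ->
  `|V t| <= `|V 0| + \int[mu]_(s in `[0, t]) (expR (- (a * (t - s))) * beta s).
Proof.
move=> a0 cV cb b0 dVE dVb t0; rewrite exp_weight_integral//.
set I := \int[mu]_(s in `[0, t]) _.
apply/ler_addgt0Pr => th th0.
pose phi s := Num.sqrt (V s ^+ 2 + th ^+ 2).
pose G s := \int[mu]_(u in `[0, s]) (expR (a * u) * beta u).
pose H s := expR (a * s) * (phi s - th) - G s.
have cw : hcont (fun u => expR (a * u) * beta u).
  by apply: hcontM => //; exact: hcont_expR.
have pos s : 0 < V s ^+ 2 + th ^+ 2 by rewrite ltr_wpDl ?sqr_ge0// exprn_gt0.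
have phi0 s : 0 < phi s by rewrite sqrtr_gt0.
have phi2 s : phi s ^+ 2 = V s ^+ 2 + th ^+ 2 by rewrite sqr_sqrtr// ltW.
have Vphi s : `|V s| <= phi s.
  rewrite -(ler_pXn2r (n := 2))// ?nnegrE//; last exact: ltW.
  by rewrite phi2 real_normK ?num_real// lerDl sqr_ge0.
have thphi s : th <= phi s.
  rewrite -(ler_pXn2r (n := 2))// ?nnegrE//; try exact: ltW.
  by rewrite phi2 lerDr sqr_ge0.
have cphi : hcont phi.
  apply: (hcont_comp (k := Num.sqrt)); first exact: sqrt_continuous.
  by apply: hcontD; [exact: hcontX|exact: hcont_cst].
have cH : hcont H.
  apply: hcontB; last exact: hcont_primitive.
  by apply: hcontM; [exact: hcont_expR|apply: hcontB => //; exact: hcont_cst].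
pose dphi s := V s * dV s / phi s.
have dphiE s : 0 < s -> is_derive s 1 phi (dphi s).
  move=> s0; have dVs := dVE s s0.
  have d2 : is_derive s 1 (fun x => V x ^+ 2 + th ^+ 2) (2 * V s * dV s).
    have := is_deriveD (is_deriveX 2 dVs) (is_derive_cst (th ^+ 2) s 1).
    by rewrite addr0 expr1.
  have := @is_derive1_comp _ Num.sqrt (fun x => V x ^+ 2 + th ^+ 2) s _ _ (is_derive1_sqrt (pos s)) d2.
  rewrite (_ : _ * _ = dphi s)//.
  by rewrite /dphi -/(phi s); field; rewrite gt_eqF.
pose dH s := (a * expR (a * s)) * (phi s - th) + expR (a * s) * dphi s - expR (a * s) * beta s.
have dHE s : 0 < s -> is_derive s 1 H (dH s).
  move=> s0.
  have d1 := is_deriveB (dphiE s s0) (is_derive_cst th s 1).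
  have d2 : is_derive s 1 (fun x => expR (a * x) * (phi x - th))
      (expR (a * s) * (dphi s - 0) + (phi s - th) * (a * expR (a * s))).
    exact: (is_deriveM (is_derive_expRM a s) d1).
  have d3 := is_deriveB d2 (primitive_is_derive cw s0).
  apply: is_derive_eq d3 _.
  by rewrite /dH subr0; ring.
have dH0 s : 0 < s -> dH s <= 0.
  move=> s0; rewrite /dH.
  have -> : a * expR (a * s) * (phi s - th) + expR (a * s) * dphi s - expR (a * s) * beta s
     = expR (a * s) * (a * (phi s - th) + dphi s - beta s) by ring.
  apply: mulr_ge0_le0; first exact: expR_ge0.
  have h1 : dphi s <= (- a * V s ^+ 2 + `|V s| * beta s) / phi s.
    by rewrite /dphi ler_wpM2r// ?invr_ge0 ?(ltW (phi0 s))// dVb.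
  have h2 : (- a * V s ^+ 2 + `|V s| * beta s) / phi s <= - a * phi s + a * th + beta s.
    rewrite ler_pdivrMr//.
    have h3 : `|V s| * beta s <= beta s * phi s.
      by rewrite mulrC ler_wpM2l// b0// ltW.
    have h4 : a * th * th <= a * th * phi s by rewrite ler_wpM2l// mulr_ge0// ltW.
    have := phi2 s; rewrite !expr2 => h5.
    have -> : V s * V s = phi s * phi s - th * th by rewrite h5; ring.
    lra.
  lra.
have := nonincreasing_of_derive cH dHE dH0 t0.
have -> : H 0 = phi 0 - th.
  by rewrite /H /G set_itv1 Rintegral_set1 subr0 mulr0 expR0 mul1r.
have h0 : phi 0 - th <= `|V 0|.
  rewrite lerBlDr -(ler_pXn2r (n := 2))// ?nnegrE//.
  - rewrite phi2 sqrrD real_normK ?num_real//.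
    by rewrite -addrA lerD2l lerDr mulrn_wge0// mulr_ge0// ltW.
  - exact: ltW.
  - by rewrite addr_ge0// ltW.
rewrite /H /G -/I => hH.
have e0 := expR_gt0 (a * t).
have h6 : expR (a * t) * (phi t - th) <= `|V 0| + I by lra.
have h7 : phi t - th <= expR (- (a * t)) * (`|V 0| + I).
  by rewrite expRN -(ler_pM2l e0) mulrA divff ?gt_eqF// mul1r.
have h8 : expR (- (a * t)) * `|V 0| <= `|V 0|.
  rewrite -[leRHS]mul1r ler_wpM2r// expR_le1 oppr_le0.
  by rewrite mulr_ge0// ltW.
have := Vphi t; lra.
Qed.

End comparison.

Section ou_transform.
Context {R : realType}.
Local Notation mu := (@lebesgue_measure R).
Implicit Types (h g U Q beta : R -> R) (a s t : R).

Definition ou a Q t := Q t - a * \int[mu]_(s in `[0, t]) (expR (- (a * (t - s))) * Q s).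

Lemma hcont_exp_weight_integral h a : hcont h ->
  hcont (fun t => \int[mu]_(s in `[0, t]) (expR (- (a * (t - s))) * h s)).
Proof.
move=> ch.
have -> : (fun t => \int[mu]_(s in `[0, t]) (expR (- (a * (t - s))) * h s)) =
    (fun t => expR (- a * t) * \int[mu]_(s in `[0, t]) (expR (a * s) * h s)).
  by apply/funext => t; rewrite exp_weight_integral// mulNr.
apply: hcontM; first exact: hcont_expR.
by apply: hcont_primitive; apply: hcontM => //; exact: hcont_expR.
Qed.

Lemma hcont_ou Q a : hcont Q -> hcont (ou a Q).
Proof.
move=> cQ; apply: hcontB => //; apply: hcontM; first exact: hcont_cst.
exact: hcont_exp_weight_integral.
Qed.

Lemma exp_integral a t : 0 < a -> 0 <= t ->
  \int[mu]_(s in `[0, t]) expR (- (a * (t - s))) = a^-1 * (1 - expR (- (a * t))).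
Proof.
move=> a0 t0.
have ce : hcont (fun s => a * expR (a * s)).
  by apply: hcontM; [exact: hcont_cst|exact: hcont_expR].
pose G s := \int[mu]_(u in `[0, s]) (a * expR (a * u)).
have cG : hcont G by exact: hcont_primitive.
have dG s : 0 < s -> is_derive s 1 G (a * expR (a * s)).
  by move=> s0; exact: (primitive_is_derive ce s0).
have G0 : G 0 = 0 by rewrite /G set_itv1 Rintegral_set1.
have GE : G t = expR (a * t) - 1.
  apply/eqP; rewrite eq_le; apply/andP; split.
    have := @nonincreasing_of_derive _ (fun s => G s - expR (a * s)) (cst 0) t.
    rewrite G0 mulr0 expR0 => /(_ _ _ _ t0) H.
    rewrite -subr_ge0 [X in 0 <= X](_ : _ = 0 - 1 - (G t - expR (a * t))); last by ring.
    rewrite subr_ge0; apply: H.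
    - by apply: hcontB => //; exact: hcont_expR.
    - move=> s s0; have := is_deriveB (dG s s0) (is_derive_expRM a s).
      by rewrite subrr.
    - by move=> s _ /=.
  have := @nonincreasing_of_derive _ (fun s => expR (a * s) - G s) (cst 0) t.
  rewrite G0 mulr0 expR0 subr0 => /(_ _ _ _ t0) H.
  rewrite lerBlDr -lerBlDl; apply: H.
  - by apply: hcontB => //; exact: hcont_expR.
  - move=> s s0; have := is_deriveB (is_derive_expRM a s) (dG s s0).
    by rewrite subrr.
  - by move=> s _ /=.
have -> : \int[mu]_(s in `[0, t]) expR (- (a * (t - s))) =
    \int[mu]_(s in `[0, t]) (expR (- (a * (t - s))) * 1).
  by apply: eq_Rintegral => s _; rewrite mulr1.
rewrite exp_weight_integral; last exact: hcont_cst.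
have -> : \int[mu]_(s in `[0, t]) (expR (a * s) * 1) = a^-1 * G t.
  rewrite /G -RintegralZl//; last by exact: hcont_integrable.
  by apply: eq_Rintegral => s _; rewrite mulr1 mulrA mulVf ?mul1r// gt_eqF.
by rewrite GE mulrCA [in RHS]mulrBr mulrBr mulr1 -expRD addNr expR0 -mulrBr.
Qed.

Lemma ou_split Q a t : 0 < a -> hcont Q -> 0 <= t ->
  ou a Q t = expR (- (a * t)) * Q t +
    \int[mu]_(s in `[0, t]) (expR (- (a / 2 * (t - s))) *
       (a * expR (- (a / 2 * (t - s))) * (Q t - Q s))).
Proof.
move=> a0 cQ t0.
have ci (h : R -> R) : hcont h -> mu.-integrable `[0, t] (EFin \o h).
  by move=> ch; exact: hcont_integrable.
have cE : hcont (fun s => expR (- (a * (t - s)))).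
  apply: (hcont_comp (k := expR)); first exact: continuous_expR.
  apply: hcontN; apply: hcontM; first exact: hcont_cst.
  by apply: hcontB; [exact: hcont_cst|exact: hcont_id].
have -> : \int[mu]_(s in `[0, t]) (expR (- (a / 2 * (t - s))) *
       (a * expR (- (a / 2 * (t - s))) * (Q t - Q s))) =
   \int[mu]_(s in `[0, t]) (a * Q t * expR (- (a * (t - s))) - a * (expR (- (a * (t - s))) * Q s)).
  apply: eq_Rintegral => s _.
  have -> : expR (- (a * (t - s))) = expR (- (a / 2 * (t - s))) * expR (- (a / 2 * (t - s))).
    by rewrite -expRD; congr expR; field.
  by ring.
rewrite RintegralB//; last 2 first.
- by apply: ci; apply: hcontM => //; exact: hcont_cst.
- by apply: ci; apply: hcontM; [exact: hcont_cst|exact: hcontM].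
rewrite !RintegralZl//; try (apply: ci; try exact: hcontM; exact: cE).
rewrite exp_integral// /ou; set I := \int[mu]_(s in _) _.
by field; rewrite gt_eqF.
Qed.

Lemma dissipative_remainder U g beta a t :
  0 < a -> hcont U -> hcont g -> hcont beta -> (forall s, 0 <= s -> 0 <= beta s) ->
  let Y := ou a (fun t => U t - \int[mu]_(s in `[0, t]) (g s)) in
  (forall s, 0 < s ->
    (U s - Y s) * (g s + a * Y s) <= - a * (U s - Y s) ^+ 2 + `|U s - Y s| * beta s) ->
  0 <= t ->
  `|U t - Y t| <= \int[mu]_(s in `[0, t]) (expR (- (a * (t - s))) * beta s).
Proof.
move=> a0 cU cg cb b0 Y ineq t0.
pose Q t := U t - \int[mu]_(s in `[0, t]) (g s).
have cQ : hcont Q by apply: hcontB => //; exact: hcont_primitive.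
have cY : hcont Y by exact: hcont_ou.
pose V t := U t - Y t.
have cV : hcont V by exact: hcontB.
have VE : V = (fun t => \int[mu]_(s in `[0, t]) (g s)
    + a * (expR (- a * t) * \int[mu]_(s in `[0, t]) (expR (a * s) * Q s))).
  apply/funext => s; rewrite /V /Y /ou exp_weight_integral// mulNr -/(Q s).
  by rewrite /Q; ring.
have V0 : V 0 = 0 by rewrite VE set_itv1 !Rintegral_set1 !mulr0 addr0.
have cw : hcont (fun s => expR (a * s) * Q s).
  by apply: hcontM => //; exact: hcont_expR.
have dV s : 0 < s -> is_derive s 1 V (g s + a * Y s).
  move=> s0; rewrite VE.
  have d1 := primitive_is_derive cg s0.
  pose G u := \int[mu]_(s in `[0, u]) (expR (a * s) * Q s).
  have d2 : is_derive s 1 G (expR (a * s) * Q s) := primitive_is_derive cw s0.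
  have d3 : is_derive s 1 (fun t => expR (- a * t) * G t)
      (expR (- a * s) * (expR (a * s) * Q s) + G s * (- a * expR (- a * s))).
    exact: (is_deriveM (is_derive_expRM (- a) s) d2).
  have d4 : is_derive s 1 (fun t => a * (expR (- a * t) * G t))
      (a * (expR (- a * s) * (expR (a * s) * Q s) + G s * (- a * expR (- a * s)))).
    exact: (is_deriveZ a d3).
  apply: is_derive_eq (is_deriveD d1 d4) _; congr (_ + a * _).
  have e1 : expR (- a * s) * expR (a * s) = 1 by rewrite -expRD mulNr addNr expR0.
  rewrite mulrA e1 mul1r /Y /ou exp_weight_integral// -/(Q s) -/(G s) !mulNr.
  by ring.
have := dissipative_comparison a0 cV cb b0 dV ineq t0.
by rewrite V0 normr0 add0r.
Qed.

End ou_transform.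

Section dissipative_families.
Context {R : realType} {I : Type} {d : I -> measure_display}.
Context {T : forall i, measurableType (d i)}.
Variable P : forall i, probability (T i) R.
Local Notation mu := (@lebesgue_measure R).

Definition pos_times (i : I) (t : R) : Prop := 0 <= t.
Definition time_pairs (i : I) (st : R * R) : Prop := 0 <= st.1 <= st.2.

Definition regular_process (X : forall i, R -> T i -> R) : Prop :=
  (forall i w, hcont (fun t => X i t w)) /\
  (forall i t, 0 <= t -> measurable_fun setT (X i t)).

Lemma regular_jointly_measurable X : regular_process X -> forall i,
  measurable_fun setT (fun z : measurableTypeR R * T i => X i (Num.max 0 z.1) z.2).
Proof.
move=> [cX mX] i; apply: continuous_paths_jointly_measurable; first exact: mX.
exact: cX.
Qed.

Lemma regular_comp (k : R -> R) X : continuous k -> regular_process X ->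
  regular_process (fun i t w => k (X i t w)).
Proof.
move=> ck [cX mX]; split=> [i w|i t t0]; first by apply: hcont_comp.
by apply: (measurableT_comp (continuous_measurable_fun ck)); exact: mX.
Qed.

Lemma regularD X Y : regular_process X -> regular_process Y ->
  regular_process (fun i t w => X i t w + Y i t w).
Proof.
move=> [cX mX] [cY mY]; split=> [i w|i t t0]; first exact: hcontD.
by apply: measurable_funD; [exact: mX|exact: mY].
Qed.

Lemma regularM X Y : regular_process X -> regular_process Y ->
  regular_process (fun i t w => X i t w * Y i t w).
Proof.
move=> [cX mX] [cY mY]; split=> [i w|i t t0]; first exact: hcontM.
by apply: measurable_funM; [exact: mX|exact: mY].
Qed.

Lemma regularB X Y : regular_process X -> regular_process Y ->
  regular_process (fun i t w => X i t w - Y i t w).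
Proof.
move=> [cX mX] [cY mY]; split=> [i w|i t t0]; first exact: hcontB.
by apply: measurable_funB; [exact: mX|exact: mY].
Qed.

Lemma regular_det (h : I -> R -> R) : (forall i, hcont (h i)) ->
  regular_process (fun i t _ => h i t).
Proof. by move=> ch; split=> [i w|i t t0]; [exact: ch|exact: measurable_cst]. Qed.

Lemma hcont_measurable (k : R -> R) : hcont k ->
  measurable_fun setT (fun s : measurableTypeR R => k (Num.max 0 s)).
Proof. by move=> /hcontP ck; exact: continuous_measurable_fun. Qed.

Lemma regular_weighted_integral (k : R -> R -> R) X :
  (forall t, measurable_fun setT (k t : measurableTypeR R -> R)) ->
  regular_process X -> forall i t, 0 <= t ->
  measurable_fun setT (fun w => \int[mu]_(s in `[0, t]) (k t s * X i s w)).
Proof.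
move=> mk rX i t t0.
under [X in measurable_fun _ X]eq_fun => w.
  rewrite (@eq_Rintegral _ _ _ mu `[0, t]%classic
    (fun s => k t s * X i (Num.max 0 s) w)); last first.
    by move=> s; rewrite inE/= in_itv/= => /andP[s0 _]; rewrite max_r.
  over.
apply: (measurable_path_Rintegral (k := k t)
  (Phi := fun z => X i (Num.max 0 z.1) z.2)) => //.
exact: regular_jointly_measurable.
Qed.

Lemma regular_integral X : regular_process X ->
  regular_process (fun i t w => \int[mu]_(s in `[0, t]) X i s w).
Proof.
move=> rX; split=> [i w|i t t0]; first by apply: hcont_primitive; case: rX.
have m1 (s : R) : measurable_fun setT ((fun=> 1) : measurableTypeR R -> R).
  exact: measurable_cst.
have := @regular_weighted_integral (fun _ _ => 1) X m1 rX i t t0.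
by under eq_fun do under eq_Rintegral do rewrite mul1r.
Qed.

Let measurable_exp a t :
  measurable_fun setT (fun s : measurableTypeR R => expR (- (a * (t - s)))).
Proof.
apply: (measurableT_comp (continuous_measurable_fun (@continuous_expR R))).
by apply: measurableT_comp => //; apply: measurable_funM => //; exact: measurable_funB.
Qed.

Lemma regular_ou (a : R) X : regular_process X ->
  regular_process (fun i t w => ou a (fun s => X i s w) t).
Proof.
move=> rX; split=> [i w|i t t0]; first by apply: hcont_ou; case: rX.
apply: measurable_funB; first by case: rX => _; apply.
apply: measurable_funM => //.
exact: (regular_weighted_integral (k := fun t s => expR (- (a * (t - s))))).
Qed.

Lemma expR_dominates_affine (a x : R) : 0 < a -> 0 <= x ->
  (1 + x) * expR (- (a * x)) <= 1 + a^-1.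
Proof.
move=> a0 x0; rewrite expRN ler_pdivrMr ?expR_gt0//.
have h := expR_ge1Dx (a * x).
have v0 : 0 < a^-1 by rewrite invr_gt0.
apply: (@le_trans _ _ ((1 + a^-1) * (1 + a * x))); last first.
  by apply: ler_wpM2l => //; rewrite addr_ge0// ltW.
have -> : (1 + a^-1) * (1 + a * x) = 1 + x + (a * x + a^-1) by field; rewrite gt_eqF.
by rewrite lerDl addr_ge0 ?mulr_ge0// ltW.
Qed.

Let exp_weight_le (a t : R) : 0 < a -> 0 <= t ->
  (\int[mu]_(s in `[0%R, t]) (expR (- (a * (t - s))))%:E <= (a^-1)%:E)%E.
Proof.
move=> a0 t0.
have cE : hcont (fun s => expR (- (a * (t - s)))).
  apply: (hcont_comp (k := expR)); first exact: continuous_expR.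
  apply: hcontN; apply: hcontM; first exact: hcont_cst.
  by apply: hcontB; [exact: hcont_cst|exact: hcont_id].
have mD : measurable (`[0, t]%classic : set (measurableTypeR R)) by exact: measurable_itv.
have fi := integrable_fin_num mD (hcont_integrable t cE (lexx 0)).
rewrite -[leLHS]fineK// lee_fin.
have := exp_integral a0 t0; rewrite /Rintegral => ->.
by rewrite ger_pMr ?invr_gt0// gerBl expR_ge0.
Qed.

Lemma momO_ou (a : R) (eta : I -> R) (Q : forall i, R -> T i -> R) : 0 < a ->
  (forall i, 0 < eta i) -> regular_process Q ->
  (forall i, {ae P i, forall w, Q i 0 w = 0}) ->
  momO P time_pairs (fun i st => eta i * (1 + (st.2 - st.1)))
    (fun i st w => Q i st.2 w - Q i st.1 w) ->
  momO P pos_times (fun i _ => eta i) (fun i t w => ou a (fun s => Q i s w) t).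
Proof.
move=> a0 e0 rQ Q0 HQ; have [cQ mQ] := rQ.
have b0 : 0 < a / 2 by rewrite divr_gt0.
have first_ : momO P pos_times (fun i _ => eta i) (fun i t w => expR (- (a * t)) * Q i t w).
  have H0 : momO P pos_times (fun i t => eta i * (1 + (t - 0))) (fun i t w => Q i t w - Q i 0 w).
    apply: (@momO_reindex _ _ _ _ P _ _ time_pairs pos_times (fun i t => (0, t)) _ _ HQ).
    by move=> i t t0; rewrite /time_pairs/= lexx.
  have H1 : momO P pos_times (fun i t => eta i * (1 + t)) (fun i t w => Q i t w).
    apply: momO_ae_le (momO_weaken H0 (c := 1) (eta' := fun i t => eta i * (1 + t)) _ _) _ _ => //.
      move=> i t t0; rewrite subr0 mul1r lexx andbT mulr_ge0 ?addr_ge0//; exact: ltW.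
    by move=> i t t0; apply: filterS (Q0 i) => w ->; rewrite subr0.
  have H2 : momO P pos_times (fun i t => expR (- (a * t))) (fun i t _ => expR (- (a * t))).
    apply: (momO_det (c := 1) _ _) => // i t t0.
    by rewrite mul1r ger0_norm// expR_ge0.
  have H3 := momO_mul H2 H1 (fun i t _ => expR_gt0 _) (fun i t t0 =>
    mulr_gt0 (e0 i) (ltr_wpDr t0 ltr01)).
  apply: (momO_weaken (c := 1 + a^-1) H3 _ _).
    move=> i t t0; rewrite mulr_ge0 ?expR_ge0//=; last first.
      by rewrite mulr_ge0 ?addr_ge0// ltW.
    rewrite mulrCA [leRHS]mulrC ler_pM2l// mulrC.
    exact: expR_dominates_affine.
  by rewrite addr_ge0// invr_ge0 ltW.
pose kap (i : I) (t u : R) := expR (- (a / 2 * (t - u))).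
pose Phi i t (z : measurableTypeR R * T i) : R :=
  a * kap i t z.1 * (Q i t z.2 - Q i (Num.max 0 z.1) z.2).
have second_ : momO P pos_times (fun i _ => (a / 2)^-1 * eta i)
    (fun i t w => \int[mu]_(u in `[0, t]) (kap i t u * Phi i t (u, w))).
  apply: (momO_path_integral (A := fun i t => `[0, t]%classic)) => //.
  - by move=> i t _; exact: measurable_exp.
  - by move=> i t _ u; exact: expR_ge0.
  - by move=> i t _; rewrite invr_gt0.
  - by move=> i t _; exact: ltW.
  - by move=> i t t0; exact: exp_weight_le.
  - move=> i t t0; apply: measurable_funM.
      apply: measurable_funM => //.
      exact: (measurableT_comp (measurable_exp (a / 2) t) measurable_fst).
    apply: measurable_funB; last exact: regular_jointly_measurable.
    by apply: (measurableT_comp (mQ i t t0) measurable_snd).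
  pose D (i : I) (tu : R * R) := pos_times i tu.1 /\ `[0, tu.1]%classic tu.2.
  have D2 i tu : D i tu -> time_pairs i (tu.2, tu.1).
    by move=> [_] /=; rewrite in_itv.
  have K1 : momO P D (fun i tu => kap i tu.1 tu.2) (fun i tu _ => kap i tu.1 tu.2).
    apply: (momO_det (c := 1) _ _) => // i tu _.
    by rewrite mul1r ger0_norm// expR_ge0.
  have K2 := momO_reindex HQ D2.
  have K3 := momO_scale a (momO_mul K1 K2 (fun i _ _ => expR_gt0 _) _).
  have K4 : momO P D (fun i tu => eta i) (fun i tu w => a * (kap i tu.1 tu.2 *
      (Q i tu.1 w - Q i tu.2 w))).
    apply: (momO_weaken (c := 1 + (a / 2)^-1) (K3 _) _ _).
    - move=> i tu /D2 /andP[/= u0 ut].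
      by rewrite mulr_gt0// ltr_wpDr// subr_ge0.
    - move=> i tu /D2 /andP[/= u0 ut].
      have tu0 : 0 <= tu.1 - tu.2 by rewrite subr_ge0.
      apply/andP; split.
        apply: mulr_ge0; first exact: expR_ge0.
        by apply: mulr_ge0; [exact: ltW|rewrite addr_ge0].
      rewrite mulrCA [leRHS]mulrC ler_pM2l// mulrC.
      exact: expR_dominates_affine.
    by rewrite addr_ge0// invr_ge0 ltW.
  apply: momO_le K4 _ _.
    move=> i [t u] [/= t0 tu]; have u0 : 0 <= u by move: tu; rewrite in_itv/= => /andP[].
    rewrite /Phi/= max_r//; apply: measurable_funM; first exact: measurable_cst.
    by apply: measurable_funB; exact: mQ.
  move=> i [t u] w [/= _]; rewrite in_itv/= => /andP[u0 _].
  by rewrite /Phi/= max_r// mulrA.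
have second' : momO P pos_times (fun i _ => eta i)
    (fun i t w => \int[mu]_(u in `[0, t]) (kap i t u * Phi i t (u, w))).
  apply: (momO_weaken (c := (a / 2)^-1) second_ _ _).
    by move=> i t _; rewrite lexx andbT mulr_ge0 ?invr_ge0// ltW.
  by rewrite invr_ge0 ltW.
apply: momO_le (momO_add first_ second') _ _.
  by move=> i t t0; have [_] := regular_ou a rQ; apply.
move=> i t w t0; rewrite ou_split//.
rewrite le_eqVlt; apply/orP; left; apply/eqP; congr (`| _ + _|).
apply: eq_Rintegral => u; rewrite inE/= in_itv/= => /andP[u0 _].
by rewrite /Phi/= max_r.
Qed.

Lemma momO_contraction (a : R) (eta : I -> R) (U g beta : forall i, R -> T i -> R) :
  0 < a -> (forall i, 0 < eta i) ->
  regular_process U -> regular_process g -> regular_process beta ->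
  (forall i t w, 0 <= t -> 0 <= beta i t w) ->
  let Y i t w := ou a (fun t => U i t w - \int[mu]_(s in `[0, t]) (g i s w)) t in
  (forall i t w, 0 < t ->
    (U i t w - Y i t w) * (g i t w + a * Y i t w) <=
    - a * (U i t w - Y i t w) ^+ 2 + `|U i t w - Y i t w| * beta i t w) ->
  momO P pos_times (fun i _ => eta i) Y ->
  momO P pos_times (fun i _ => eta i) beta ->
  momO P pos_times (fun i _ => eta i) U.
Proof.
move=> a0 e0 rU rg rb b0 Y ineq HY Hb.
have [cU mU] := rU; have [cg mg] := rg; have [cb mb] := rb.
have av0 : 0 < a^-1 by rewrite invr_gt0.
pose kap (i : I) (t u : R) := expR (- (a * (t - u))).
pose Phi i (t : R) (z : measurableTypeR R * T i) : R := beta i (Num.max 0 z.1) z.2.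
have H1 : momO P pos_times (fun i _ => a^-1 * eta i)
    (fun i t w => \int[mu]_(u in `[0, t]) (kap i t u * Phi i t (u, w))).
  apply: (momO_path_integral (A := fun i t => `[0, t]%classic)) => //.
  - by move=> i t _; exact: measurable_exp.
  - by move=> i t _ u; exact: expR_ge0.
  - by move=> i t _; exact: ltW.
  - by move=> i t t0; exact: exp_weight_le.
  - by move=> i t t0; exact: regular_jointly_measurable.
  pose D (i : I) (tu : R * R) := pos_times i tu.1 /\ `[0, tu.1]%classic tu.2.
  apply: (@momO_reindex _ _ _ _ P _ _ pos_times D
    (fun i tu => Num.max 0 tu.2) (fun i _ => eta i) beta Hb).
  by move=> i tu _; rewrite /pos_times le_max lexx.
have H2 : momO P pos_times (fun i _ => eta i)
    (fun i t w => \int[mu]_(u in `[0, t]) (kap i t u * Phi i t (u, w))).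
  apply: (momO_weaken (c := a^-1) H1 _ _); last exact: ltW.
  by move=> i t _; rewrite lexx andbT mulr_ge0// ltW.
have [_ mI] := H2.
apply: momO_le (momO_add (momO_abs HY) (momO_abs H2)) _ _.
  by move=> i t t0; exact: mU.
move=> i t w t0; rewrite [leRHS]ger0_norm ?addr_ge0//.
have := dissipative_remainder a0 (cU i w) (cg i w) (cb i w)
  (fun s => b0 i s w) (fun s s0 => ineq i s w s0) t0.
rewrite -/(Y i t w) => h.
have -> : \int[mu]_(u in `[0, t]) (kap i t u * Phi i t (u, w)) =
    \int[mu]_(s in `[0, t]) (expR (- (a * (t - s))) * beta i s w).
  apply: eq_Rintegral => u; rewrite inE/= in_itv/= => /andP[u0 _].
  by rewrite /Phi/= max_r.
rewrite -[U i t w](subrK (Y i t w)) addrC; apply: (le_trans (ler_normD _ _)).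
by rewrite lerD2l (le_trans h)// ler_norm.
Qed.

End dissipative_families.

Section locally_bounded.
Context {R : realType}.
Local Notation mu := (@lebesgue_measure R).
Implicit Types (h g H : R -> R) (s t u : R).

Definition lbm h : Prop :=
  measurable_fun setT (fun u : measurableTypeR R => h (Num.max 0 u)) /\
  forall t, exists K, forall u, 0 <= u <= t -> `|h u| <= K.

Lemma hcont_lbm h : hcont h -> lbm h.
Proof.
move=> ch; split; first exact: hcont_measurable.
move=> t; have [t0|t0] := leP 0 t; last first.
  by exists 0 => u /andP[u0 ut]; move: (le_lt_trans (le_trans u0 ut) t0); rewrite ltxx.
have [c _ hc] := EVT_max t0 (hcont_within (hcont_norm ch) (lexx 0)).
by exists `|h c| => u ut; apply: hc; rewrite in_itv.
Qed.

Lemma lbmD h g : lbm h -> lbm g -> lbm (fun u => h u + g u).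
Proof.
move=> [mh bh] [mg bg]; split; first exact: measurable_funD.
move=> t; have [K hK] := bh t; have [L gL] := bg t.
by exists (K + L) => u ut; apply: le_trans (ler_normD _ _) (lerD (hK u ut) (gL u ut)).
Qed.

Lemma lbmM h g : lbm h -> lbm g -> lbm (fun u => h u * g u).
Proof.
move=> [mh bh] [mg bg]; split; first exact: measurable_funM.
move=> t; have [K hK] := bh t; have [L gL] := bg t.
by exists (K * L) => u ut; rewrite normrM ler_pM//; [exact: hK|exact: gL].
Qed.

Lemma lbm_cst (k : R) : lbm (fun=> k).
Proof. by apply: hcont_lbm; exact: hcont_cst. Qed.

Lemma lbmB h g : lbm h -> lbm g -> lbm (fun u => h u - g u).
Proof.
move=> lh lg; have := lbmD lh (lbmM (lbm_cst (-1)) lg).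
by under eq_fun do rewrite mulN1r.
Qed.

Lemma lbm_integrable h s t : lbm h -> 0 <= s ->
  mu.-integrable (`[s, t]%classic : set (measurableTypeR R)) (EFin \o h).
Proof.
move=> [mh bh] s0.
have mI : measurable (`[s, t]%classic : set (measurableTypeR R)) by exact: measurable_itv.
have [K hK] := bh t.
apply: (@eq_integrable _ _ _ mu _ mI (EFin \o (fun u => h (Num.max 0 u)))).
  move=> u; rewrite inE/= in_itv/= => /andP[su _].
  by rewrite max_r// (le_trans s0).
apply: measurable_bounded_integrable => //.
- by apply: compact_finite_measure; exact: segment_compact.
- exact: measurable_funTS.
exists K; split; first exact: num_real.
move=> x Kx u; rewrite /= in_itv/= => /andP[su ut].
have u0 : 0 <= u := le_trans s0 su.
by rewrite max_r// (le_trans (hK u _) (ltW Kx))// u0.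
Qed.

Lemma lbm_integral_split h s t : lbm h -> 0 <= s -> s <= t ->
  \int[mu]_(u in `[0, t]) h u - \int[mu]_(u in `[0, s]) h u =
  \int[mu]_(u in `[s, t]) h u.
Proof.
move=> lh s0 st; have t0 := le_trans s0 st.
rewrite Rintegral_itvB; last 3 first.
- exact: lbm_integrable.
- by rewrite bnd_simp.
- by rewrite bnd_simp.
rewrite Rintegral_itv_obnd_cbnd//.
apply: integrableS (lbm_integrable t lh s0).
- exact: measurable_itv.
- exact: measurable_itv.
- exact: subset_itv_oc_cc.
Qed.

Lemma segment_integral_cst s t (c : R) : s <= t ->
  \int[mu]_(u in `[s, t]) c = c * (t - s).
Proof.
move=> st; have mI : measurable (`[s, t]%classic : set (measurableTypeR R)).
  exact: measurable_itv.
rewrite (Rintegral_cst _ mI).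
have -> : fine (mu (`[s, t]%classic : set (measurableTypeR R))) = t - s => //.
rewrite (lebesgue_measure_itv `[s, t]) /= lte_fin.
by case: ltgtP st => // [->]; rewrite ?subrr.
Qed.

Lemma lbm_integral_le h s t (c : R) : lbm h -> 0 <= s -> s <= t ->
  (forall u, s <= u <= t -> `|h u| <= c) ->
  `|\int[mu]_(u in `[s, t]) h u| <= c * (t - s).
Proof.
move=> lh s0 st hc.
have mI : measurable (`[s, t]%classic : set (measurableTypeR R)) by exact: measurable_itv.
apply: (le_trans (le_normr_Rintegral mI (lbm_integrable t lh s0))).
rewrite -(segment_integral_cst c st).
apply: le_Rintegral => //.
- by apply: integrable_norm; exact: lbm_integrable.
- exact: (lbm_integrable t (lbm_cst c)).
Qed.

Lemma hcont_FTC2 h H t : hcont h -> hcont H ->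
  (forall s, 0 < s -> is_derive s 1 H (h s)) -> 0 <= t ->
  \int[mu]_(s in `[0, t]) h s = H t - H 0.
Proof.
move=> ch cH dH t0.
pose G s := \int[mu]_(u in `[0, s]) (h u).
have cG : hcont G by exact: hcont_primitive.
have dG s : 0 < s -> is_derive s 1 G (h s) by move=> s0; exact: primitive_is_derive.
have G0 : G 0 = 0 by rewrite /G set_itv1 Rintegral_set1.
have dsub (A B : R -> R) : hcont A -> hcont B ->
    (forall s, 0 < s -> is_derive s 1 A (h s)) -> (forall s, 0 < s -> is_derive s 1 B (h s)) ->
    A t - B t <= A 0 - B 0.
  move=> cA cB dA dB.
  apply: (@nonincreasing_of_derive _ (fun s => A s - B s) (cst 0)) => //.
    exact: hcontB.
  by move=> s s0; have := is_deriveB (dA s s0) (dB s s0); rewrite subrr.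
have h1 := dsub G H cG cH dG dH; have h2 := dsub H G cH cG dH dG.
by rewrite -/(G t); apply/eqP; rewrite eq_le; lra.
Qed.

Lemma hcont_FTC2_itv h H s t : hcont h -> hcont H ->
  (forall s, 0 < s -> is_derive s 1 H (h s)) -> 0 <= s -> s <= t ->
  \int[mu]_(u in `[s, t]) h u = H t - H s.
Proof.
move=> ch cH dH s0 st; rewrite -lbm_integral_split//; last exact: hcont_lbm.
rewrite !(hcont_FTC2 ch cH dH)//; last exact: le_trans st.
by ring.
Qed.

End locally_bounded.

Section time_grid.
Context {R : realType}.
Local Notation mu := (@lebesgue_measure R).
Variable del : R.
Hypothesis del0 : 0 < del.
Implicit Types (g h : R -> R) (s t u v : R).
Local Notation pi := (pi_ del).

Lemma pi_le u : pi u <= u.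
Proof. by rewrite /pi_ mulrC -ler_pdivlMr// floor_le. Qed.

Lemma pi_gt u : u - pi u < del.
Proof.
rewrite ltrBlDr /pi_ -[X in X + _]mulr1 -mulrDr mulrC -ltr_pdivrMr// addrC.
by have := floorD1_gt (u / del); rewrite intrD.
Qed.

Lemma pi_ge0 u : 0 <= u -> 0 <= pi u.
Proof.
move=> u0; apply: mulr_ge0; first exact: ltW.
by rewrite ler0z floor_ge_int divr_ge0// ltW.
Qed.

Lemma pi_homo u v : u <= v -> pi u <= pi v.
Proof.
move=> uv; rewrite /pi_ ler_pM2l// ler_int; apply: le_floor.
by rewrite ler_pM2r ?invr_gt0.
Qed.

Lemma pi_block u (m : int) : del * m%:~R <= u < del * (m + 1)%:~R -> pi u = del * m%:~R.
Proof.
move=> /andP[mu_ um]; rewrite /pi_; congr (_ * _%:~R); apply: floor_def.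
by rewrite ler_pdivlMr// ltr_pdivrMr// mulrC mu_ mulrC.
Qed.

Lemma pi_const u v : pi u <= v -> v <= u -> pi v = pi u.
Proof.
move=> uv vu; apply: pi_block; rewrite uv/= (le_lt_trans vu)//.
have := pi_gt u; rewrite ltrBlDr addrC => h; apply: (lt_le_trans h).
by rewrite intrD mulrDr mulr1.
Qed.

Lemma measurable_pi : measurable_fun setT (pi : measurableTypeR R -> measurableTypeR R).
Proof. by apply: nondecreasing_measurable => // u v; exact: pi_homo. Qed.

Lemma lbm_comp_pi h : lbm h -> lbm (fun u => h (pi u)).
Proof.
move=> [mh bh]; split.
  have -> : (fun u : measurableTypeR R => h (pi (Num.max 0 u))) =
      (fun u : measurableTypeR R => h (Num.max 0 u)) \o
        ((pi : measurableTypeR R -> measurableTypeR R) \o (fun u => Num.max 0 u)).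
    by apply/funext => u /=; rewrite [Num.max 0 (pi _)]max_r// pi_ge0// le_max lexx.
  apply: measurableT_comp => //; apply: measurableT_comp; first exact: measurable_pi.
  exact: measurable_maxr.
move=> t; have [K hK] := bh t; exists K => u /andP[u0 ut]; apply: hK.
by rewrite pi_ge0//= (le_trans (pi_le u)).
Qed.

Lemma lbm_pi : lbm pi.
Proof. by have := lbm_comp_pi (hcont_lbm (@hcont_id R)). Qed.

Lemma sawtooth_step_integral g n t : hcont g ->
  del * n%:R <= t <= del * n.+1%:R ->
  \int[mu]_(u in `[0, t]) (g (pi u) * (u - pi u - del / 2)) =
  g (del * n%:R) * ((t - del * n%:R) * (t - del * n.+1%:R) / 2).
Proof.
move=> cg.
have lg : lbm (fun u => g (pi u) * (u - pi u - del / 2)).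
  apply: lbmM; first by apply: lbm_comp_pi; exact: hcont_lbm.
  apply: lbmB; last exact: lbm_cst.
  by apply: lbmB; [exact/hcont_lbm/hcont_id|exact: lbm_pi].
have block m s : del * m%:R <= s <= del * m.+1%:R ->
  \int[mu]_(u in `[del * m%:R, s]) (g (pi u) * (u - pi u - del / 2)) =
  g (del * m%:R) * ((s - del * m%:R) * (s - del * m.+1%:R) / 2).
  move=> /andP[ms sm].
  have m0 : 0 <= del * m%:R by rewrite mulr_ge0// ltW.
  rewrite -Rintegral_itv_bndo_bndc; last first.
    apply: integrableS (lbm_integrable s lg m0); try exact: measurable_itv.
    exact: subset_itv_co_cc.
  rewrite (@eq_Rintegral _ _ _ mu `[del * m%:R, s[%classic
     (fun u => g (del * m%:R) * (u - del * m%:R - del / 2))); last first.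
    move=> u; rewrite inE/= in_itv/= => /andP[mu_ us].
    have -> // : pi u = del * m%:R.
    apply: (@pi_block u m); rewrite mu_/= (lt_le_trans us)//.
    by move: sm; rewrite -addn1 natrD intrD.
  have cl : hcont (fun u => g (del * m%:R) * (u - del * m%:R - del / 2)).
    apply: hcontM; first exact: hcont_cst.
    by apply: hcontB; [apply: hcontB; [exact: hcont_id|exact: hcont_cst]|exact: hcont_cst].
  rewrite Rintegral_itv_bndo_bndc; last first.
    apply: integrableS (hcont_integrable s cl m0); try exact: measurable_itv.
    exact: subset_itv_co_cc.
  pose H u := g (del * m%:R) * ((u - del * m%:R) * (u - del * m.+1%:R) / 2).
  have cH : hcont H.
    apply: hcontM; first exact: hcont_cst.
    apply: hcontM; last exact: hcont_cst.
    by apply: hcontM; apply: hcontB; try exact: hcont_cst; exact: hcont_id.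
  have dH u : 0 < u -> is_derive u 1 H (g (del * m%:R) * (u - del * m%:R - del / 2)).
    move=> u0.
    have d (k : R) : is_derive u 1 (fun v : R => v - k) (1 - 0).
      exact: (is_deriveB (f := id) (g := cst k)).
    have d2 : is_derive u 1 (fun v => (v - del * m%:R) * (v - del * m.+1%:R))
      ((u - del * m%:R) * (1 - 0) + (u - del * m.+1%:R) * (1 - 0)) := is_deriveM (d _) (d _).
    have d3 : is_derive u 1 (fun v => (v - del * m%:R) * (v - del * m.+1%:R) / 2)
      ((u - del * m%:R) * (u - del * m.+1%:R) * 0 + 2^-1 * ((u - del * m%:R) * (1 - 0) + (u - del * m.+1%:R) * (1 - 0))).
      exact: (is_deriveM (g := cst 2^-1) d2).
    apply: is_derive_eq (is_deriveZ (g (del * m%:R)) d3) _.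
    by rewrite /GRing.scale/=; congr (_ * _); rewrite -addn1 natrD; field.
  rewrite (hcont_FTC2_itv cl cH dH)//.
  by rewrite /H subrr mul0r mul0r mulr0 subr0.
elim: n t => [|n IH] t /[dup] tn /andP[nt _].
  by have := block 0%N t tn; rewrite mulr0.
have n0 : 0 <= del * n.+1%:R by rewrite mulr_ge0// ltW.
rewrite -(block n.+1 t tn) -(lbm_integral_split lg n0 nt) (IH (del * n.+1%:R)); last first.
  by rewrite lexx andbT ler_pM2l// ler_nat.
by rewrite subrr mulr0 mul0r mulr0 subr0.
Qed.

Lemma sawtooth_integral_le g (K : R) s t : hcont g ->
  (forall u, 0 <= u -> `|g u| <= K) ->
  (forall u v, 0 <= u -> u <= v -> `|g v - g u| <= K * (v - u)) ->
  0 <= s -> s <= t ->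
  `|\int[mu]_(u in `[s, t]) (g u * (u - pi u - del / 2))| <=
    K * del ^+ 2 * (1 + (t - s)).
Proof.
move=> cg gK gL s0 st.
have t0 := le_trans s0 st; have K0 : 0 <= K := le_trans (normr_ge0 _) (gK 0 (lexx _)).
have lsaw : lbm (fun u => u - pi u - del / 2).
  apply: lbmB; last exact: lbm_cst.
  by apply: lbmB; [exact/hcont_lbm/hcont_id|exact: lbm_pi].
have lg := hcont_lbm cg.
have lgp := lbm_comp_pi lg.
have sawK u : `|u - pi u - del / 2| <= del.
  by have := pi_le u; have := pi_gt u; rewrite ler_norml => h1 h2; apply/andP; split; lra.
pose st_ u := g (pi u) * (u - pi u - del / 2).
have lst : lbm st_ by exact: lbmM.
pose df u := (g u - g (pi u)) * (u - pi u - del / 2).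
have ldf : lbm df by apply: lbmM => //; exact: lbmB.
have prim v : 0 <= v -> `|\int[mu]_(u in `[0, v]) st_ u| <= K * (del ^+ 2 / 2).
  move=> v0; pose m := Num.floor (v / del).
  have m0 : (0 <= m)%R by rewrite floor_ge_int divr_ge0// ltW.
  have [n nE] : exists n : nat, m = n by exists `|m|%N; rewrite gez0_abs.
  have hv : del * n%:R <= v <= del * n.+1%:R.
    have := pi_le v; have := pi_gt v; rewrite /pi_ -/m nE => h1 h2.
    by rewrite h2/= -addn1 natrD mulrDr mulr1 -lerBlDl ltW.
  rewrite /st_ (sawtooth_step_integral cg hv) normrM; apply: ler_pM => //.
    by apply: gK; rewrite mulr_ge0// ltW.
  have /andP[h1 h2] := hv.
  rewrite normrM [`|2^-1|]ger0_norm ?invr_ge0//; apply: ler_wpM2r; first by rewrite invr_ge0.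
  rewrite normrM expr2; move: h1 h2; rewrite -addn1 natrD mulrDr mulr1 => h1 h2.
  by apply: ler_pM => //; rewrite ler_norml; apply/andP; split; lra.
have -> : \int[mu]_(u in `[s, t]) (g u * (u - pi u - del / 2)) =
    \int[mu]_(u in `[s, t]) df u + \int[mu]_(u in `[s, t]) st_ u.
  rewrite -RintegralD//; try exact: lbm_integrable.
  by apply: eq_Rintegral => u _; rewrite /df /st_; ring.
have h1 : `|\int[mu]_(u in `[s, t]) df u| <= K * del ^+ 2 * (t - s).
  apply: lbm_integral_le => // u /andP[su ut].
  have u0 := le_trans s0 su.
  rewrite /df normrM expr2 mulrA; apply: ler_pM => //.
  apply: (le_trans (gL _ _ (pi_ge0 u0) (pi_le u))).
  by apply: ler_wpM2l => //; exact/ltW/pi_gt.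
have h2 : `|\int[mu]_(u in `[s, t]) st_ u| <= K * del ^+ 2.
  rewrite -lbm_integral_split//; apply: (le_trans (ler_normB _ _)).
  apply: (le_trans (lerD (prim t t0) (prim s s0))).
  by rewrite -mulrDr -splitr.
apply: (le_trans (ler_normD _ _)); apply: (le_trans (lerD h1 h2)).
by rewrite [leRHS]mulrDr mulr1 addrC.
Qed.

End time_grid.

Section ito_at_zero.
Context {R : realType} {d : measure_display} {T : measurableType d}.
Variables (P : probability T R) (F : R -> set_system T).

Lemma ito_integral0 (W H I0 : R -> T -> R) : is_filtration F ->
  is_ito_integral P F W H I0 -> {ae P, forall w, I0 0 w = 0}.
Proof.
move=> hF [aI _ [G HG]].
have [_ cv] := HG 0 (lexx 0).
have mI : measurable_fun setT (I0 0) := adapted_measurable hF aI (lexx 0).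
have sp0 n w : sp_integral (G n) W 0 w = 0.
  rewrite /sp_integral big1// => j _.
  by rewrite !min_l ?sp_time_ge0// subrr mulr0.
have small (k : nat) : {ae P, forall w, `|I0 0 w| < k.+1%:R^-1}.
  pose A := [set w | ((k.+1%:R^-1)%:E <= (`|I0 0 w|)%:E)%E].
  have mA : measurable A.
    apply: measurable_ge_level; apply/measurable_EFinP.
    exact: measurableT_comp.
  exists A; split => //; last first.
    by move=> w /=; rewrite /A/= lee_fin => /negP; rewrite -leNgt.
  have k0 : 0 < k.+1%:R^-1 :> R by rewrite invr_gt0.
  have := cv _ k0; have -> : (fun n => P [set w |
      ((k.+1%:R^-1)%:E <= (`|sp_integral (G n) W 0 w - I0 0 w|)%:E)%E]) = fun=> P A.
    by apply/funext => n; congr (P _); apply/funext => w; rewrite /A/= sp0 sub0r normrN.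
  move=> cA; have := @cvg_unique _ (@ereal_hausdorff R) _ _ _ _ cA (cvg_cst _).
  by move=> <-.
have := ae_foralln small.
apply: filterS => w h; apply/eqP; rewrite -normr_le0; apply/ler_addgt0Pr => e e0.
rewrite add0r ltW// (lt_trans (h (Num.truncn e^-1)))//.
by rewrite invf_plt ?posrE// truncnS_gt.
Qed.

End ito_at_zero.

Section increment_families.
Context {R : realType} {I : Type} {d : I -> measure_display}.
Context {T : forall i, measurableType (d i)}.
Variable P : forall i, probability (T i) R.
Local Notation mu := (@lebesgue_measure R).
Implicit Types (Phi X : forall i, R -> T i -> R).

Definition lbm_process Phi : Prop :=
  (forall i, measurable_fun setT
     (fun z : measurableTypeR R * T i => Phi i (Num.max 0 z.1) z.2)) /\
  (forall i w, lbm (fun u => Phi i u w)).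

Lemma regular_lbm X : regular_process X -> lbm_process X.
Proof.
move=> rX; split; first exact: regular_jointly_measurable.
by move=> i w; apply: hcont_lbm; case: rX.
Qed.

Lemma lbm_processD Phi X : lbm_process Phi -> lbm_process X ->
  lbm_process (fun i u w => Phi i u w + X i u w).
Proof.
move=> [m1 l1] [m2 l2]; split=> [i|i w]; [exact: measurable_funD|exact: lbmD].
Qed.

Lemma lbm_processB Phi X : lbm_process Phi -> lbm_process X ->
  lbm_process (fun i u w => Phi i u w - X i u w).
Proof.
move=> [m1 l1] [m2 l2]; split=> [i|i w]; [exact: measurable_funB|exact: lbmB].
Qed.

Lemma lbm_process_measurable Phi i t : lbm_process Phi -> 0 <= t ->
  measurable_fun setT (Phi i t).
Proof.
move=> [mP _] t0.
have -> : Phi i t = (fun z => Phi i (Num.max 0 z.1) z.2) \o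
    (fun w => (t : measurableTypeR R, w)).
  by apply/funext => w /=; rewrite max_r.
apply: measurableT_comp; first exact: mP.
by apply: measurable_fun_pair => //; exact: measurable_id.
Qed.

Lemma regular_comp_pi (del : I -> R) X : (forall i, 0 < del i) -> regular_process X ->
  lbm_process (fun i u w => X i (pi_ (del i) u) w).
Proof.
move=> d0 rX; split=> [i|i w]; last first.
  have lX : lbm (fun u => X i u w) by apply: hcont_lbm; case: rX.
  exact: (lbm_comp_pi (d0 i) lX).
have -> : (fun z : measurableTypeR R * T i => X i (pi_ (del i) (Num.max 0 z.1)) z.2) =
    (fun z => X i (Num.max 0 z.1) z.2) \o
    (fun z : measurableTypeR R * T i => (pi_ (del i) (Num.max 0 z.1) : measurableTypeR R, z.2)).
  by apply/funext => z /=; rewrite [Num.max 0 (pi_ _ _)]max_r// pi_ge0// le_max lexx.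
apply: measurableT_comp; first exact: regular_jointly_measurable.
apply: measurable_fun_pair => //=.
apply: (measurableT_comp (measurable_pi (d0 i))
  (g := fun z : measurableTypeR R * T i => Num.max 0 z.1)).
exact: measurable_maxr.
Qed.

Lemma momO_increment_integral (K : Type) (D : I -> K -> Prop) (s t rho : I -> K -> R)
    (eta : I -> R) Phi :
  (forall i k, D i k -> 0 <= s i k <= t i k) ->
  (forall i k, D i k -> t i k - s i k <= rho i k) ->
  (forall i k, D i k -> 0 < rho i k) -> (forall i, 0 <= eta i) ->
  lbm_process Phi -> momO P (@pos_times R I) (fun i _ => eta i) Phi ->
  momO P D (fun i k => rho i k * eta i)
    (fun i k w => \int[mu]_(u in `[s i k, t i k]) Phi i u w).
Proof.
move=> st tr r0 e0 [mP _] HP.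
have H := @momO_path_integral _ _ _ _ P K D (fun i k => `[s i k, t i k]%classic)
  (fun _ _ _ => 1) rho (fun i _ => eta i)
  (fun i k (z : measurableTypeR R * T i) => Phi i (Num.max 0 z.1) z.2).
have {}H := H (fun i k _ => measurable_itv _) (fun i k _ => measurable_cst _ )
  (fun i k _ u => ler01) r0 (fun i k _ => e0 i).
apply: momO_le (H _ (fun i k _ => mP i) _) _ _.
- move=> i k Dik; have /andP[s0 sk] := st i k Dik.
  rewrite integral_cst ?mul1e; last exact: measurable_itv.
  apply: (@le_trans _ _ (t i k - s i k)%:E); last by rewrite lee_fin tr.
  rewrite le_eqVlt; apply/orP; left; apply/eqP; apply: etrans (lebesgue_measure_itv _) _.
  by rewrite /= lte_fin; case: ltgtP sk => // [->]; rewrite ?subrr.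
- apply: (@momO_reindex _ _ _ _ P _ _ (@pos_times R I) _
    (fun i ku => Num.max 0 ku.2) (fun i _ => eta i) Phi HP).
  by move=> i ku _; rewrite /pos_times le_max lexx.
- move=> i k Dik; have /andP[s0 sk] := st i k Dik.
  under [X in measurable_fun _ X]eq_fun => w.
    rewrite (@eq_Rintegral _ _ _ mu `[s i k, t i k]%classic
      (fun u => 1 * Phi i (Num.max 0 u) w)); last first.
      by move=> u; rewrite inE/= in_itv/= => /andP[u0 _]; rewrite mul1r max_r// (le_trans s0).
    over.
  by apply: (measurable_path_Rintegral (k := fun=> 1)
    (Phi := fun z => Phi i (Num.max 0 z.1) z.2)).
move=> i k w Dik; have /andP[s0 sk] := st i k Dik.
rewrite le_eqVlt; apply/orP; left; apply/eqP; congr `|_|.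
apply: eq_Rintegral => u; rewrite inE/= in_itv/= => /andP[u0 _].
by rewrite mul1r max_r// (le_trans s0).
Qed.

Lemma momO_ito (K : Type) (D : I -> K -> Prop) (s t rho eta : I -> K -> R)
    (F : forall i, R -> set_system (T i)) (W H1 H2 I1 I2 : forall i, R -> T i -> R)
    (K1 K2 a b : I -> R) :
  (forall i, is_filtration (F i)) -> (forall i, is_brownian_motion (P i) (F i) (W i)) ->
  (forall i, adapted (F i) (H1 i)) -> (forall i, continuous_paths (H1 i)) ->
  (forall i u w, `|H1 i u w| <= K1 i) ->
  (forall i, adapted (F i) (H2 i)) -> (forall i, continuous_paths (H2 i)) ->
  (forall i u w, `|H2 i u w| <= K2 i) ->
  (forall i, is_ito_integral (P i) (F i) (W i) (H1 i) (I1 i)) ->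
  (forall i, is_ito_integral (P i) (F i) (W i) (H2 i) (I2 i)) ->
  (forall i k, D i k -> 0 <= s i k <= t i k) ->
  (forall i k, D i k -> t i k - s i k <= rho i k ^+ 2) ->
  (forall i k, D i k -> 0 < rho i k) -> (forall i k, D i k -> 0 < eta i k) ->
  momO P (fun i (ku : K * R) => D i ku.1 /\ s i ku.1 <= ku.2 <= t i ku.1)
    (fun i ku => eta i ku.1)
    (fun i ku w => a i * H1 i ku.2 w + b i * H2 i ku.2 w) ->
  momO P D (fun i k => rho i k * eta i k)
    (fun i k w => a i * (I1 i (t i k) w - I1 i (s i k) w)
                + b i * (I2 i (t i k) w - I2 i (s i k) w)).
Proof.
move=> hF hW aH1 cH1 bH1 aH2 cH2 bH2 I1H I2H st tr r0 e0 [mH HH].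
have mI (J H : forall i, R -> T i -> R) i u :
    is_ito_integral (P i) (F i) (W i) (H i) (J i) -> 0 <= u -> measurable_fun setT (J i u).
  by move=> [aJ _ _] u0; exact: (adapted_measurable (hF i) aJ).
apply: momO_even.
- by move=> i k Dik; rewrite mulr_gt0 ?r0 ?e0.
- move=> i k Dik; have /andP[s0 sk] := st i k Dik; have t0 := le_trans s0 sk.
  by apply: measurable_funD; apply: measurable_funM => //; apply: measurable_funB;
    [exact: (mI I1)|exact: (mI I1)|exact: (mI I2)|exact: (mI I2)].
move=> m m0; have m20 : (0 < m.*2)%N by rewrite double_gt0.
have [C [C0 HC]] := HH _ m20.
exists (`|(ito_cst m : R)| * C); split; first by rewrite mulr_ge0.
move=> i k Dik; have /andP[s0 sk] := st i k Dik.
have ek := ltW (e0 i k Dik).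
have BE : 0 <= C * eta i k ^+ m.*2 by apply: mulr_ge0 => //; exact: exprn_ge0.
have rhs0 : 0 <= `|(ito_cst m : R)| * C * (rho i k * eta i k) ^+ m.*2.
  have re := ltW (mulr_gt0 (r0 i k Dik) (e0 i k Dik)).
  by apply: mulr_ge0; [exact: mulr_ge0|exact: exprn_ge0].
move: sk; rewrite le_eqVlt => /predU1P[st_|sk].
  under eq_integral do rewrite -st_ !subrr !mulr0 addr0 normr0 expr0n double_eq0 eqn0Ngt m0.
  by rewrite integral0 lee_fin.
apply: (le_trans (@ito_increment_moment _ _ _ _ _ _ (hF i) (hW i) _ _ _ _ (K1 i) (K2 i) _ _ _ _
  (C * eta i k ^+ m.*2) _ (aH1 i) (cH1 i) (bH1 i) (aH2 i) (cH2 i) (bH2 i) (I1H i) (I2H i) s0 sk m0 _)).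
  by move=> u su ut; apply: (HC i (k, u)); rewrite su ut.
rewrite lee_fin exprMn; move: (ito_cst m) => q; rewrite -!mulrA.
apply: (@le_trans _ _ (`|q| * ((t i k - s i k) ^+ m * (C * eta i k ^+ m.*2)))).
  apply: ler_wpM2r; last exact: ler_norm.
  by apply: mulr_ge0 => //; rewrite exprn_ge0// subr_ge0 ltW.
apply: ler_wpM2l => //; rewrite mulrCA; apply: ler_wpM2l => //.
apply: ler_wpM2r; first exact: exprn_ge0.
rewrite -mul2n exprM; apply: lerXn_le; [by rewrite subr_ge0 ltW|exact: tr].
Qed.

End increment_families.

Section flow_and_configurations.
Context {R : realType}.
Local Notation mu := (@lebesgue_measure R).
Variables (f kappa sigma x : R -> R).

Definition drift y := f y + kappa y.
Definition drift_slope t := derive1 f (x t) + derive1 kappa (x t).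
Definition delay_slope t := derive1 kappa (x t) * drift (x t).

Record flow_bounds (x0 a K : R) (r : nat) : Prop := FlowBounds {
  fb_a : 0 < a;
  fb_f : continuous f;
  fb_kappa : continuous kappa;
  fb_sigma : continuous sigma;
  fb_dissipative : forall y z, (y - z) * (drift y - drift z) <= - a * (y - z) ^+ 2;
  fb_kappa_le : forall y, `|kappa y| <= K;
  fb_sigma_le : forall y, `|sigma y| <= K;
  fb_kappa_lip : forall y z, `|kappa y - kappa z| <= K * `|y - z|;
  fb_sigma_lip : forall y z, `|sigma y - sigma z| <= K * `|y - z|;
  fb_flow : hcont x;
  fb_flowE : forall t, 0 <= t -> x t = x0 + \int[mu]_(s in `[0, t]) drift (x s);
  fb_f_flow_le : forall t, 0 <= t -> `|f (x t)| <= K;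
  fb_f_growth : forall t y, 0 <= t -> `|f (x t + y) - f (x t)| <= K * (`|y| + `|y| ^+ r.+2);
  fb_drift_taylor : forall t y, 0 <= t ->
    `|drift (x t + y) - drift (x t) - drift_slope t * y| <= K * (`|y| ^+ 2 + `|y| ^+ r.+2);
  fb_slope : hcont drift_slope;
  fb_slope_le : forall t, 0 <= t -> drift_slope t <= - a;
  fb_slope_bound : forall t, 0 <= t -> `|drift_slope t| <= K;
  fb_kappa_taylor : forall t y z, 0 <= t ->
    `|kappa y - kappa z - derive1 kappa (x t) * (y - z)| <=
      K * (`|y - x t| + `|z - x t|) * `|y - z|;
  fb_kappa_slope : forall t, 0 <= t -> `|derive1 kappa (x t)| <= K;
  fb_delay : hcont delay_slope;
  fb_delay_le : forall t, 0 <= t -> `|delay_slope t| <= K;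
  fb_delay_lip : forall s t, 0 <= s -> s <= t ->
    `|delay_slope t - delay_slope s| <= K * (t - s);
  fb_flow_taylor : forall s t, 0 <= s -> s <= t ->
    `|x s - x t + (t - s) * drift (x t)| <= K * (t - s) ^+ 2 }.

Record config (x0 cc Lam : R) := Config {
  cd : measure_display;
  cT : measurableType cd;
  cP : probability cT R;
  cF : R -> set_system cT;
  cW : R -> cT -> R;
  cX : R -> cT -> R;
  cM : R -> cT -> R;
  cZ : R -> cT -> R;
  cN : R -> cT -> R;
  ceps : R;
  cdel : R;
  c_filtration : is_filtration cF;
  c_brownian : is_brownian_motion cP cF cW;
  c_eps_gt0 : 0 < ceps;
  c_eps_le1 : ceps <= 1;
  c_del_gt0 : 0 < cdel;
  c_del_le : cdel <= Lam * ceps;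
  c_X_adapted : adapted cF cX;
  c_X_continuous : continuous_paths cX;
  c_M : is_ito_integral cP cF cW (fun s w => ceps * sigma (cX s w)) cM;
  c_X : {ae cP, forall w, forall t, 0 <= t ->
    cX t w = x0 + \int[mu]_(s in `[0, t]) (f (cX s w) + kappa (cX (pi_ cdel s) w)) + cM t w};
  c_Z_adapted : adapted cF cZ;
  c_Z_continuous : continuous_paths cZ;
  c_N : is_ito_integral cP cF cW (fun s _ => sigma (x s)) cN;
  c_Z : {ae cP, forall w, forall t, 0 <= t ->
    cZ t w = \int[mu]_(s in `[0, t]) (drift_slope s * cZ s w)
      - cc / 2 * \int[mu]_(s in `[0, t]) delay_slope s + cN t w} }.

End flow_and_configurations.

Arguments cF {R f kappa sigma x x0 cc Lam} _ _.
Arguments cW {R f kappa sigma x x0 cc Lam} _ _ _.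
Arguments cX {R f kappa sigma x x0 cc Lam} _ _ _.
Arguments cM {R f kappa sigma x x0 cc Lam} _ _ _.
Arguments cZ {R f kappa sigma x x0 cc Lam} _ _ _.
Arguments cN {R f kappa sigma x x0 cc Lam} _ _ _.

Section deterministic_processes.
Context {R : realType} {I : Type} {d : I -> measure_display}.
Context {T : forall i, measurableType (d i)}.

Lemma lbm_process_det (h : I -> R -> R) : (forall i, lbm (h i)) ->
  lbm_process (fun i t (_ : T i) => h i t).
Proof.
move=> lh; split=> [i|i w]; last exact: lh.
exact: (measurableT_comp (proj1 (lh i)) measurable_fst).
Qed.

End deterministic_processes.

Section bounded_families.
Context {R : realType} {I : Type} {d : I -> measure_display}.
Context {T : forall i, measurableType (d i)}.
Variable P : forall i, probability (T i) R.

Lemma momO_bounded (L : Type) (D : I -> L -> Prop) (eta : I -> L -> R)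
    (V : forall i, L -> T i -> R) (k : R) : 0 <= k ->
  (forall i l, D i l -> 0 <= eta i l) ->
  (forall i l, D i l -> measurable_fun setT (V i l)) ->
  (forall i l w, D i l -> `|V i l w| <= k * eta i l) -> momO P D eta V.
Proof.
move=> k0 e0 mV VK; have H : momO P D eta (fun i l _ => k * eta i l).
  apply: (momO_det (c := k) _ _) => // i l Dil.
  by rewrite ger0_norm// mulr_ge0// e0.
apply: momO_le H mV _ => i l w Dil; apply: le_trans (VK i l w Dil) _.
exact: ler_norm.
Qed.

Lemma momO_le_abs (L : Type) (D : I -> L -> Prop) (eta : I -> L -> R)
    (V B : forall i, L -> T i -> R) : momO P D eta B ->
  (forall i l, D i l -> measurable_fun setT (V i l)) ->
  (forall i l w, D i l -> `|V i l w| <= B i l w) -> momO P D eta V.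
Proof.
move=> HB mV VB; apply: momO_le HB mV _ => i l w Dil.
by apply: le_trans (VB i l w Dil) _; exact: ler_norm.
Qed.

(* [momO] with the rate [eta] is inherited by powers when [eta] is bounded by [1] *)
Lemma momO_powW (L : Type) (D : I -> L -> Prop) (eta : I -> L -> R)
    (V : forall i, L -> T i -> R) n : (0 < n)%N ->
  (forall i l, D i l -> 0 <= eta i l <= 1) -> momO P D eta V ->
  momO P D eta (fun i l w => `|V i l w| ^+ n).
Proof.
case: n => // n _ e1 HV.
apply: (momO_weaken (c := 1) (momO_pow (m := n.+1) _ (momO_abs HV)) _ _) => //.
move=> i l Dil; have /andP[h0 h1] := e1 i l Dil.
by rewrite mul1r exprn_ge0//= exprS; apply: ler_piMr => //; exact: exprn_ile1.
Qed.

End bounded_families.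

Section stages.
Context {R : realType}.
Local Notation mu := (@lebesgue_measure R).
Variables (f kappa sigma x : R -> R) (x0 a K c Lam : R) (r : nat).
Hypothesis fb : flow_bounds f kappa sigma x x0 a K r.
Hypothesis Lam0 : 0 < Lam.
Local Notation I := (config f kappa sigma x x0 c Lam).
Local Notation T := (fun i : I => cT i).
Local Notation P := (fun i : I => cP i).
Local Notation b := (drift f kappa).
Local Notation eps := (fun i : I => ceps i).
Local Notation del := (fun i : I => cdel i).
Implicit Types (i : I).

Let K0 : 0 <= K. Proof. exact: le_trans (normr_ge0 _) (fb_kappa_le fb 0). Qed.

Let a0 : 0 < a := fb_a fb.

Let e0 i : 0 < eps i := c_eps_gt0 i.
Let d0 i : 0 < del i := c_del_gt0 i.

Unset Implicit Arguments.
Let X i t w := cX i t w.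
Let M i t w := cM i t w.
Let Z i t w := cZ i t w.
Let N i t w := cN i t w.
Let Xpi i t w := X i (pi_ (del i) t) w.
Let U i t w := X i t w - x t.
Let gU i t w := b (X i t w) - b (x t).
Let J i t w := kappa (Xpi i t w) - kappa (X i t w).
Set Implicit Arguments.

Let cb : continuous b.
Proof. by move=> y; apply: cvgD; [exact: fb_f fb y|exact: fb_kappa fb y]. Qed.

Let regular_of (V : forall i, R -> T i -> R) : (forall i, adapted (cF i) (V i)) ->
  (forall i, continuous_paths (V i)) -> regular_process V.
Proof.
move=> aV cV; split=> [i w|i t t0]; first exact: cV.
exact: (adapted_measurable (c_filtration i) (aV i)).
Qed.

Let rX : regular_process X.
Proof. by apply: regular_of => i; [exact: c_X_adapted|exact: c_X_continuous]. Qed.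
Let rZ : regular_process Z.
Proof. by apply: regular_of => i; [exact: c_Z_adapted|exact: c_Z_continuous]. Qed.
Let rM : regular_process M.
Proof. by apply: regular_of => i; case: (c_M i). Qed.
Let rN : regular_process N.
Proof. by apply: regular_of => i; case: (c_N i). Qed.

Let rx (h : R -> R) : hcont h -> regular_process (fun i t (_ : T i) => h t).
Proof. by move=> ch; split=> [i w|i t t0]; [exact: ch|exact: measurable_cst]. Qed.

Let cbx : hcont (fun t => b (x t)).
Proof. exact: (hcont_comp cb (fb_flow fb)). Qed.
Let rU : regular_process U.
Proof. by apply: regularB => //; apply: rx; exact: fb_flow fb. Qed.
Let rgU : regular_process gU.
Proof. by apply: regularB; [exact: (regular_comp cb rX)|exact: rx]. Qed.
Let lXpi : lbm_process Xpi.
Proof. exact: (regular_comp_pi d0 rX). Qed.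
Let lkXpi : lbm_process (fun i t w => kappa (Xpi i t w)).
Proof. exact: (regular_comp_pi d0 (regular_comp (fb_kappa fb) rX)). Qed.
Let lJ : lbm_process J.
Proof. by apply: lbm_processB lkXpi _; exact/regular_lbm/regular_comp/rX/(fb_kappa fb). Qed.
Let lfX : lbm_process (fun i t w => f (X i t w) + kappa (Xpi i t w)).
Proof. by apply: lbm_processD lkXpi; exact/regular_lbm/regular_comp/rX/(fb_f fb). Qed.

Lemma X_increment i : {ae P i, forall w, forall s t, 0 <= s -> s <= t ->
  X i t w - X i s w = \int[mu]_(u in `[s, t]) (f (X i u w) + kappa (Xpi i u w))
    + (M i t w - M i s w)}.
Proof.
apply: filterS (c_X i) => w Xw s t s0 st.
have t0 := le_trans s0 st; have [_ l] := lfX.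
rewrite -(lbm_integral_split (l i w) s0 st) /X (Xw _ s0) (Xw _ t0).
rewrite -/(X i) -/(M i) /Xpi /X /M; ring.
Qed.

Lemma x_increment s t : 0 <= s -> s <= t ->
  x t - x s = \int[mu]_(u in `[s, t]) b (x u).
Proof.
move=> s0 st; have t0 := le_trans s0 st.
rewrite -(lbm_integral_split (hcont_lbm cbx) s0 st).
rewrite (fb_flowE fb t0) (fb_flowE fb s0); ring.
Qed.

Lemma U_increment i : {ae P i, forall w, forall s t, 0 <= s -> s <= t ->
  U i t w - U i s w = \int[mu]_(u in `[s, t]) (gU i u w + J i u w)
    + (M i t w - M i s w)}.
Proof.
apply: filterS (X_increment i) => w Xw s t s0 st.
have -> : U i t w - U i s w = X i t w - X i s w - (x t - x s) by rewrite /U; ring.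
rewrite (Xw _ _ s0 st) (x_increment s0 st) addrAC; congr (_ + _).
have [_ l] := lfX.
rewrite -RintegralB//; last 2 first.
- exact: (lbm_integrable _ (l i w)).
- exact: (lbm_integrable _ (hcont_lbm cbx)).
by apply: eq_Rintegral => u _; rewrite /gU /J /b; ring.
Qed.


Let rs : regular_process (fun i s w => sigma (X i s w)).
Proof. exact: (regular_comp (fb_sigma fb) rX). Qed.

Unset Implicit Arguments.
Let noise i s (w : cT i) := eps i * sigma (X i s w).
Set Implicit Arguments.

Let noise_adapted i : adapted (cF i) (noise i).
Proof.
move=> u u0; have sF := filtration_sigma (c_filtration i) u0.
apply: (mwrtM sF (g := fun=> eps i)); first exact: mwrt_cst.
apply: (mwrt_comp (continuous_measurable_fun (fb_sigma fb))).
exact: (c_X_adapted i).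
Qed.

Let noise_continuous i : continuous_paths (noise i).
Proof. by move=> w; apply: hcontM; [exact: hcont_cst|exact: (proj1 rs)]. Qed.

Let noise_le i u w : `|noise i u w| <= eps i * K.
Proof.
rewrite normrM (ger0_norm (ltW (e0 i))); apply: ler_wpM2l; first exact: ltW.
exact: fb_sigma_le fb _.
Qed.

Let noise_measurable i t : 0 <= t -> measurable_fun setT (noise i t).
Proof. by move=> t0; apply: measurable_funM => //; exact: (proj2 rs). Qed.

Lemma M_increment_momO (L : Type) (D : I -> L -> Prop) (s t rho : I -> L -> R) :
  (forall i l, D i l -> 0 <= s i l <= t i l) ->
  (forall i l, D i l -> t i l - s i l <= rho i l ^+ 2) ->
  (forall i l, D i l -> 0 < rho i l) ->
  momO P D (fun i l => rho i l * eps i) (fun i l w => M i (t i l) w - M i (s i l) w).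
Proof.
move=> st tr r0.
have := @momO_ito _ _ _ _ P L D s t rho (fun i _ => eps i) (fun i => cF i)
  (fun i => cW i) noise noise M M (fun i => eps i * K) (fun i => eps i * K) (fun=> 1) (fun=> 0)
  (fun i => c_filtration i) (fun i => c_brownian i) noise_adapted noise_continuous noise_le noise_adapted noise_continuous noise_le
  (fun i => c_M i) (fun i => c_M i) st tr r0 (fun i _ _ => e0 i).
case.
  apply: (@momO_bounded _ _ _ _ P _ _ _ _ K K0).
  - by move=> i l _; exact: ltW.
  - move=> i [l u] /= [/st/andP[s0 _] /andP[su _]].
    have u0 := le_trans s0 su.
    by apply: measurable_funD; apply: measurable_funM => //; exact: noise_measurable.
  by move=> i [l u] w _ /=; rewrite mul1r mul0r addr0 mulrC.
move=> m1 m2; split.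
  by move=> i l /m1; apply: eq_measurable_fun => w _; rewrite mul1r mul0r addr0.
move=> n /m2[C [C0 HC]]; exists C; split => // i l /HC.
by under eq_integral do rewrite mul1r mul0r addr0.
Qed.

Let U0 i : {ae P i, forall w, U i 0 w = 0}.
Proof.
apply: filterS2 (c_X i) (ito_integral0 (c_filtration i) (c_M i)) => w Xw M0.
rewrite /U /X Xw// M0 (fb_flowE fb (lexx 0)) !set_itv1 !Rintegral_set1; ring.
Qed.

Let unit_gap i (st : R * R) : time_pairs i st -> 0 < 1 + (st.2 - st.1).
Proof. by move=> /andP[_ h]; rewrite ltr_wpDr// subr_ge0. Qed.

Let pair_le i (p : R * R) : time_pairs i p -> 0 <= p.1 <= p.2.
Proof. by []. Qed.

Let gap_le i (p : R * R) : time_pairs i p -> p.2 - p.1 <= 1 + (p.2 - p.1).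
Proof. by move=> _; rewrite lerDr. Qed.

Let gap_le_sqr i (p : R * R) : time_pairs i p -> p.2 - p.1 <= (1 + (p.2 - p.1)) ^+ 2.
Proof.
move=> h; apply: (le_trans (gap_le h)); rewrite expr2 ler_peMr//; first exact/ltW/(unit_gap h).
by rewrite lerDl subr_ge0; move: h => /andP[].
Qed.

Lemma residual_increment_momO (V g j m : forall i, R -> T i -> R) (eta : I -> R) :
  (forall i, 0 < eta i) ->
  regular_process V -> regular_process g -> lbm_process j -> regular_process m ->
  (forall i, {ae P i, forall w, forall s t, 0 <= s -> s <= t ->
    V i t w - V i s w = \int[mu]_(u in `[s, t]) (g i u w + j i u w) + (m i t w - m i s w)}) ->
  momO P (@time_pairs R I) (fun i st => (1 + (st.2 - st.1)) * eta i)
    (fun i st w => m i st.2 w - m i st.1 w) ->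
  momO P (@time_pairs R I) (fun i st => (1 + (st.2 - st.1)) * eta i)
    (fun i st w => \int[mu]_(u in `[st.1, st.2]) j i u w) ->
  momO P (@time_pairs R I) (fun i st => eta i * (1 + (st.2 - st.1)))
    (fun i st w => (V i st.2 w - \int[mu]_(u in `[0, st.2]) g i u w)
                 - (V i st.1 w - \int[mu]_(u in `[0, st.1]) g i u w)).
Proof.
move=> eta0 rV rg lj rm VE Hm Hj.
have rQ := regularB rV (regular_integral rg).
have H := momO_weaken (c := 1) (momO_add Hm Hj)
  (eta' := fun i st => eta i * (1 + (st.2 - st.1))) _ _.
apply: momO_ae_le (H _ _) _ _ => //.
- move=> i st /unit_gap st0; have ei := eta0 i.
  by rewrite mul1r mulrC lexx andbT; apply: mulr_ge0; exact: ltW.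
- move=> i st /andP[s0 st']; have t0 := le_trans s0 st'.
  by apply: measurable_funB; exact: (proj2 rQ).
move=> i [s t] /andP[/= s0 st].
apply: filterS (VE i) => w Vw.
rewrite le_eqVlt; apply/orP; left; apply/eqP; congr `|_|.
have lg := hcont_lbm (proj1 rg i w); have ljw := proj2 lj i w.
have := Vw _ _ s0 st; rewrite RintegralD//; last 2 first.
- exact: lbm_integrable.
- exact: lbm_integrable.
rewrite -(lbm_integral_split lg s0 st).
set A := \int[_]_(_ in _) _; set B := \int[_]_(_ in _) _; set C := \int[_]_(_ in _) _.
move=> h; have -> : V i t w - A - (V i s w - B) = V i t w - V i s w - (A - B) by ring.
rewrite h; ring.
Qed.

Lemma U_contraction (eta : I -> R) : (forall i, eps i <= eta i <= 1) ->
  momO P (@pos_times R I) (fun i _ => eta i) J ->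
  momO P (@pos_times R I) (fun i _ => eta i) U.
Proof.
move=> e1 HJ.
have eta0 i : 0 < eta i by have /andP[h _] := e1 i; exact: lt_le_trans h.
have HM := @M_increment_momO (R * R) (@time_pairs R I) (fun i p => p.1) (fun i p => p.2)
  (fun i p => 1 + (p.2 - p.1)) pair_le gap_le_sqr unit_gap.
have HM' := momO_weaken (c := 1) HM (eta' := fun i p => (1 + (p.2 - p.1)) * eta i) _ ler01.
have Hj := momO_increment_integral pair_le gap_le unit_gap (fun i => ltW (eta0 i)) lJ HJ.
have HQ := residual_increment_momO eta0 rU rgU lJ rM U_increment (HM' _) Hj.
pose Q i t w := U i t w - \int[mu]_(s in `[0, t]) gU i s w.
pose Y i t w := ou a (fun t => Q i t w) t.
have rQ : regular_process Q by exact: regularB rU (regular_integral rgU).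
have HY : momO P (@pos_times R I) (fun i _ => eta i) Y.
  apply: (momO_ou a0 eta0 rQ) (HQ _).
    by move=> i; apply: filterS (U0 i) => w Uw; rewrite /Q Uw set_itv1 Rintegral_set1 subr0.
  move=> i p /unit_gap p0; have /andP[h _] := e1 i.
  rewrite mul1r; apply/andP; split; first by apply: mulr_ge0; exact: ltW.
  by apply: ler_wpM2l => //; exact: ltW.
have rY : regular_process Y := regular_ou a rQ.
pose beta i t w := (2 * K + a) * `|Y i t w| + K * `|Y i t w| ^+ r.+2.
have rb : regular_process beta.
  have ck : continuous (fun y : R => (2 * K + a) * `|y| + K * `|y| ^+ r.+2).
    move=> y; apply: cvgD; apply: cvgM; try exact: cvg_cst; first exact: norm_continuous.
    exact: (continuous_comp (@norm_continuous R R y) (@exprn_continuous R r.+2 _)).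
  exact: (regular_comp ck rY).
have Hb : momO P (@pos_times R I) (fun i _ => eta i) beta.
  apply: momO_add; apply: momO_scale; first exact: momO_abs.
  apply: momO_powW HY => // i _ _; have /andP[_ ->] := e1 i.
  by rewrite ltW.
apply: (momO_contraction a0 eta0 rU rgU rb _ _ HY Hb).
  move=> i t w _; rewrite /beta addr_ge0// mulr_ge0 ?exprn_ge0//.
  by rewrite addr_ge0 ?mulr_ge0// ltW.
move=> i t w t0; rewrite -/(Y i t w).
have := fb_dissipative fb (X i t w) (x t + Y i t w).
have -> : X i t w - (x t + Y i t w) = U i t w - Y i t w by rewrite /U; ring.
have h2 := fb_f_growth fb (Y i t w) (ltW t0).
have h3 := fb_kappa_lip fb (x t + Y i t w) (x t).
rewrite [x t + _ - _](_ : _ = Y i t w) in h3; last by ring.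
move=> h1.
set V := U i t w - Y i t w in h1 *; set y := Y i t w in h1 h2 h3 *.
pose e := b (x t + y) - b (x t) + a * y.
have -> : V * (gU i t w + a * y) = V * (b (X i t w) - b (x t + y)) + V * e.
  by rewrite /gU /e; ring.
apply: lerD => //; apply: (le_trans (ler_norm _)); rewrite normrM; apply: ler_wpM2l => //.
have -> : e = (f (x t + y) - f (x t)) + (kappa (x t + y) - kappa (x t)) + a * y.
  by rewrite /e /b; ring.
have h4 : `|a * y| = a * `|y| by rewrite normrM ger0_norm// ltW.
apply: (le_trans (ler_normD _ _)); rewrite h4.
apply: (@le_trans _ _ (K * (`|y| + `|y| ^+ r.+2) + K * `|y| + a * `|y|)); last first.
  by rewrite /beta -/y le_eqVlt; apply/orP; left; apply/eqP; ring.
by rewrite lerD2r; apply: (le_trans (ler_normD _ _)); exact: lerD.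
Qed.

Lemma J_bounded : momO P (@pos_times R I) (fun _ _ => 1) J.
Proof.
apply: (@momO_bounded _ _ _ _ P _ _ _ _ (2 * K)) => //.
- exact: mulr_ge0.
- by move=> i t t0; exact: lbm_process_measurable lJ t0.
move=> i t w _; rewrite mulr1 mulr_natl mulr2n; apply: le_trans (ler_normB _ _) _.
by apply: lerD; exact: fb_kappa_le fb _.
Qed.

Lemma U_bounded : momO P (@pos_times R I) (fun _ _ => 1) U.
Proof. by apply: U_contraction J_bounded => i; rewrite c_eps_le1 lexx. Qed.

Let U_growth (eta : I -> R) : (forall i, 0 <= eta i <= 1) ->
  momO P (@pos_times R I) (fun i _ => eta i) U ->
  momO P (@pos_times R I) (fun i _ => eta i)
    (fun i t w => K * (`|U i t w| + `|U i t w| ^+ r.+2)).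
Proof.
move=> e1 HU; apply: momO_scale; apply: momO_add; first exact: momO_abs.
by apply: momO_powW HU => // i _ _; exact: e1.
Qed.

Let f_U_growth i t w : 0 <= t ->
  `|f (X i t w) - f (x t)| <= K * (`|U i t w| + `|U i t w| ^+ r.+2).
Proof.
move=> t0; have := fb_f_growth fb (U i t w) t0.
by rewrite (_ : x t + U i t w = X i t w)// /U; ring.
Qed.

Let momO_one (k : R) : momO P (@pos_times R I) (fun _ _ => 1) (fun _ _ _ => k).
Proof.
apply: (@momO_bounded _ _ _ _ P _ _ _ _ `|k|) => // i t t0.
by rewrite mulr1.
Qed.

Lemma drift_bounded :
  momO P (@pos_times R I) (fun _ _ => 1) (fun i t w => f (X i t w) + kappa (Xpi i t w)).
Proof.
have H := momO_add (momO_one (K + K)) (U_growth (eta := fun=> 1) _ U_bounded).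
apply: momO_le_abs (H _) _ _; first by move=> _; rewrite ler01 lexx.
  by move=> i t t0; exact: lbm_process_measurable lfX t0.
move=> i t w t0; have h1 := f_U_growth w t0; have h2 := fb_f_flow_le fb t0.
have h3 := fb_kappa_le fb (Xpi i t w).
have -> : f (X i t w) + kappa (Xpi i t w) =
    f (x t) + kappa (Xpi i t w) + (f (X i t w) - f (x t)) by ring.
apply: le_trans (ler_normD _ _) _; apply: lerD => //.
by apply: le_trans (ler_normD _ _) _; exact: lerD.
Qed.

Let pi_pair i t : pos_times i t -> 0 <= pi_ (del i) t <= t.
Proof. by move=> t0; rewrite (pi_ge0 (d0 i) t0) (pi_le (d0 i)). Qed.
Let pi_gap i t : pos_times i t -> t - pi_ (del i) t <= Lam * eps i.
Proof. by move=> _; apply: le_trans (c_del_le i); exact/ltW/pi_gt. Qed.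
Let Lam_eps (i : I) (t : R) : pos_times i t -> 0 < Lam * eps i.
Proof. by move=> _; exact: mulr_gt0. Qed.
Let eps01 i : 0 <= eps i <= 1.
Proof. by rewrite c_eps_le1 ltW. Qed.

Lemma block_increment_momO :
  momO P (@pos_times R I) (fun i _ => eps i) (fun i t w => X i t w - Xpi i t w).
Proof.
have H1 := momO_increment_integral pi_pair pi_gap Lam_eps (eta := fun=> 1)
  (fun=> ler01) lfX drift_bounded.
have tr i t : pos_times i t -> t - pi_ (del i) t <= (1 + Lam) ^+ 2.
  move=> t0; apply: le_trans (pi_gap t0) _; have /andP[h1 h2] := eps01 i.
  apply: (@le_trans _ _ Lam); first by rewrite ger_pMr.
  have -> : (1 + Lam) ^+ 2 = Lam + (1 + Lam + Lam ^+ 2) by ring.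
  by rewrite lerDl !addr_ge0 ?sqr_ge0// ltW.
have r0 (i : I) (t : R) : pos_times i t -> 0 < 1 + Lam by move=> _; rewrite addr_gt0.
have H2 := M_increment_momO pi_pair tr r0.
have H1' := momO_weaken (c := Lam) H1 (eta' := fun i _ => eps i) _ (ltW Lam0).
have H2' := momO_weaken (c := 1 + Lam) H2 (eta' := fun i _ => eps i) _ _.
apply: momO_ae_le (momO_add (H1' _) (H2' _ _)) _ _.
- by move=> i t t0; rewrite mulr1 lexx andbT; exact/ltW/(Lam_eps t0).
- by move=> i t t0; rewrite lexx andbT; apply: mulr_ge0; [exact/ltW/(r0 i t)|exact/ltW].
- by rewrite addr_ge0// ltW.
- move=> i t t0; apply: measurable_funB; first exact: (proj2 rX).
  exact: lbm_process_measurable lXpi t0.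
move=> i t t0; apply: filterS (X_increment i) => w Xw.
by have /andP[p0 pt] := pi_pair t0; rewrite Xw.
Qed.

Lemma J_momO : momO P (@pos_times R I) (fun i _ => eps i) J.
Proof.
apply: momO_le_abs (momO_scale K (momO_abs block_increment_momO)) _ _.
  by move=> i t t0; exact: lbm_process_measurable lJ t0.
by move=> i t w _; rewrite [`|X i t w - _|]distrC; exact: fb_kappa_lip fb _ _.
Qed.

Lemma U_momO : momO P (@pos_times R I) (fun i _ => eps i) U.
Proof. by apply: U_contraction J_momO => i; rewrite lexx c_eps_le1. Qed.

Lemma gU_momO : momO P (@pos_times R I) (fun i _ => eps i) gU.
Proof.
have H := momO_add (U_growth eps01 U_momO) (momO_scale K (momO_abs U_momO)).
apply: momO_le_abs H _ _; first by move=> i t t0; exact: (proj2 rgU).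
move=> i t w t0; have h1 := f_U_growth w t0.
have h2 := fb_kappa_lip fb (X i t w) (x t).
have -> : gU i t w = (f (X i t w) - f (x t)) + (kappa (X i t w) - kappa (x t)).
  by rewrite /gU /b; ring.
by apply: le_trans (ler_normD _ _) _; exact: lerD.
Qed.

Let sqrt_eps i : eps i <= Num.sqrt (eps i).
Proof.
have /andP[h0 h1] := eps01 i.
rewrite -[leLHS](sqr_sqrtr h0) expr2 ler_piMr ?sqrtr_ge0//.
by rewrite -[leRHS](@sqrtr1 R) ler_sqrt.
Qed.

Let rate i := eps i * Num.sqrt (eps i).
Let rate_gt0 i : 0 < rate i. Proof. by rewrite mulr_gt0// sqrtr_gt0. Qed.

Let eps2_rate i : eps i * eps i <= rate i.
Proof. by rewrite ler_pM2l. Qed.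

Lemma block_U_increment_momO :
  momO P (@pos_times R I) (fun i _ => rate i) (fun i t w => U i t w - U i (pi_ (del i) t) w).
Proof.
have H1 := momO_increment_integral pi_pair pi_gap Lam_eps (fun i => ltW (e0 i))
  (lbm_processD (regular_lbm rgU) lJ) (momO_add gU_momO J_momO).
have tr i t : pos_times i t -> t - pi_ (del i) t <= Num.sqrt (Lam * eps i) ^+ 2.
  by move=> t0; rewrite sqr_sqrtr ?pi_gap//; exact/ltW/(Lam_eps t0).
have r0 (i : I) (t : R) : pos_times i t -> 0 < Num.sqrt (Lam * eps i).
  by move=> t0; rewrite sqrtr_gt0 (Lam_eps t0).
have H2 := M_increment_momO pi_pair tr r0.
have H1' := momO_weaken (c := Lam) H1 (eta' := fun i _ => rate i) _ (ltW Lam0).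
have H2' := momO_weaken (c := Num.sqrt Lam) H2 (eta' := fun i _ => rate i) _ (sqrtr_ge0 _).
apply: momO_ae_le (momO_add (H1' _) (H2' _)) _ _.
- move=> i t t0; rewrite -mulrA ler_pM2l// eps2_rate andbT.
  by apply: mulr_ge0; [exact: ltW|apply: mulr_ge0; exact: ltW].
- move=> i t t0; rewrite sqrtrM ?(ltW Lam0)// -mulrA [X in _ <= _ * X <= _]mulrC lexx andbT.
  by apply: mulr_ge0; [exact: sqrtr_ge0|exact/ltW/rate_gt0].
- move=> i t t0; have /andP[p0 _] := pi_pair t0.
  by apply: measurable_funB; exact: (proj2 rU).
move=> i t t0; apply: filterS (U_increment i) => w Uw.
by have /andP[p0 pt] := pi_pair t0; rewrite Uw.
Qed.

Let eps_power_rate n i : eps i ^+ n.+2 <= rate i.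
Proof.
have /andP[h0 h1] := eps01 i.
rewrite !exprS mulrA; apply: le_trans (eps2_rate i).
by apply: ler_piMr; [exact: mulr_ge0|exact: exprn_ile1].
Qed.

Unset Implicit Arguments.
Let psi i t (w : cT i) := J i t w + delay_slope f kappa x t * (t - pi_ (del i) t).
Set Implicit Arguments.

Let ldelay : lbm (delay_slope f kappa x).
Proof. exact/hcont_lbm/(fb_delay fb). Qed.

Let lgap i : lbm (fun t => t - pi_ (del i) t).
Proof. by apply: lbmB; [exact/hcont_lbm/hcont_id|exact: (lbm_pi (d0 i))]. Qed.

Let lpsi : lbm_process psi.
Proof.
apply: lbm_processD lJ _.
exact: (@lbm_process_det _ _ _ T (fun i t => delay_slope f kappa x t * (t - pi_ (del i) t))
  (fun i => lbmM ldelay (lgap i))).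
Qed.

Lemma psi_le i t w : 0 <= t ->
  `|psi i t w| <= K * ((`|U i t w| + `|U i t w| + `|X i t w - Xpi i t w|)
                      * `|X i t w - Xpi i t w|)
    + K * (`|U i t w - U i (pi_ (del i) t) w| + K * (Lam * eps i) ^+ 2).
Proof.
move=> t0; have /andP[p0 pt] := pi_pair t0 : 0 <= pi_ (del i) t <= t.
set p := pi_ (del i) t in p0 pt *.
set D := X i t w - Xpi i t w.
have h1 := fb_kappa_taylor fb (Xpi i t w) (X i t w) t0.
have h2 := fb_flow_taylor fb p0 pt.
have h3 := fb_kappa_slope fb t0.
have -> : psi i t w = (J i t w - derive1 kappa (x t) * (Xpi i t w - X i t w))
    + derive1 kappa (x t) * ((U i p w - U i t w) + (x p - x t + (t - p) * b (x t))).
  by rewrite /psi /delay_slope /U /Xpi -/p; ring.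
apply: le_trans (ler_normD _ _) _; apply: lerD.
  apply: le_trans h1 _; rewrite -mulrA; apply: ler_wpM2l => //.
  rewrite [`|Xpi i t w - X i t w|]distrC -/D; apply: ler_wpM2r => //.
  rewrite -/(U i t w) addrAC; apply: lerD => //.
  have -> : Xpi i t w - x t = U i t w - D by rewrite /D /U; ring.
  exact: ler_normB.
rewrite normrM; apply: ler_pM => //; apply: le_trans (ler_normD _ _) _.
rewrite distrC lerD2l; apply: le_trans h2 _; apply: ler_wpM2l => //.
by apply: lerXn_le; [rewrite subr_ge0|exact: pi_gap].
Qed.

Lemma psi_momO : momO P (@pos_times R I) (fun i _ => rate i) psi.
Proof.
have HD := momO_abs block_increment_momO; have HU := momO_abs U_momO.
have eP (i : I) (t : R) : pos_times i t -> 0 < eps i by [].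
have H1 := momO_mul (momO_add (momO_add HU HU) HD) HD eP eP.
have H1' : momO P (@pos_times R I) (fun i _ => rate i) _ := momO_weaken (c := 1) H1 _ ler01.
have H2 : momO P (@pos_times R I) (fun i _ => rate i) (fun i _ _ => K * (Lam * eps i) ^+ 2).
  apply: (momO_det (c := K * Lam ^+ 2) _ _).
    by apply: mulr_ge0 => //; exact: sqr_ge0.
  move=> i t _; rewrite ger0_norm; last by apply: mulr_ge0 => //; exact: sqr_ge0.
  rewrite exprMn mulrA; apply: ler_wpM2l; first by apply: mulr_ge0 => //; exact: sqr_ge0.
  by rewrite expr2.
have H3 := momO_add (momO_scale K (H1' _))
  (momO_scale K (momO_add (momO_abs block_U_increment_momO) H2)).
apply: momO_le_abs (H3 _) _ _.
- move=> i t _; rewrite mul1r eps2_rate andbT; apply: mulr_ge0; exact: ltW.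
- by move=> i t t0; exact: lbm_process_measurable lpsi t0.
by move=> i t w t0; exact: psi_le.
Qed.

Let eta i := rate i + `|del i - eps i * c|.
Let eta_gt0 i : 0 < eta i. Proof. by rewrite ltr_wpDr. Qed.
Let rate_eta i : rate i <= eta i. Proof. by rewrite lerDl. Qed.

Unset Implicit Arguments.
Let Rm i t w := U i t w - eps i * Z i t w.
Let gR i t w := gU i t w - eps i * (drift_slope f kappa x t * Z i t w).
Let jR i t (w : cT i) := J i t w + eps i * c / 2 * delay_slope f kappa x t.
Let mR i t w := M i t w - eps i * N i t w.

Set Implicit Arguments.

Let rcst (h : I -> R) : regular_process (fun i t (_ : T i) => h i).
Proof. by split=> [i w|i t t0]; [exact: hcont_cst|exact: measurable_cst]. Qed.

Let rRm : regular_process Rm.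
Proof. by apply: regularB => //; exact: (regularM (rcst _) rZ). Qed.
Let rgR : regular_process gR.
Proof.
apply: regularB => //; apply: (regularM (rcst _)).
exact: (regularM (rx (fb_slope fb)) rZ).
Qed.
Let rmR : regular_process mR.
Proof. by apply: regularB => //; exact: (regularM (rcst _) rN). Qed.
Let ljR : lbm_process jR.
Proof.
apply: lbm_processD lJ _; apply: regular_lbm.
exact: (regularM (rcst _) (rx (fb_delay fb))).
Qed.

Lemma Z_increment i : {ae P i, forall w, forall s t, 0 <= s -> s <= t ->
  Z i t w - Z i s w = \int[mu]_(u in `[s, t]) (drift_slope f kappa x u * Z i u w)
    - c / 2 * \int[mu]_(u in `[s, t]) delay_slope f kappa x u + (N i t w - N i s w)}.
Proof.
apply: filterS (c_Z i) => w Zw s t s0 st; have t0 := le_trans s0 st.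
have lAZ : lbm (fun u => drift_slope f kappa x u * Z i u w).
  by apply: hcont_lbm; apply: hcontM; [exact: fb_slope fb|exact: (proj1 rZ)].
rewrite -(lbm_integral_split lAZ s0 st) -(lbm_integral_split ldelay s0 st).
by rewrite /Z (Zw _ t0) (Zw _ s0) -/(N i t w) -/(N i s w); ring.
Qed.

Lemma R_increment i : {ae P i, forall w, forall s t, 0 <= s -> s <= t ->
  Rm i t w - Rm i s w = \int[mu]_(u in `[s, t]) (gR i u w + jR i u w) + (mR i t w - mR i s w)}.
Proof.
apply: filterS2 (U_increment i) (Z_increment i) => w Uw Zw s t s0 st.
have -> : Rm i t w - Rm i s w = U i t w - U i s w - eps i * (Z i t w - Z i s w).
  by rewrite /Rm; ring.
rewrite (Uw _ _ s0 st) (Zw _ _ s0 st) /mR.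
have lAZ : lbm (fun u => drift_slope f kappa x u * Z i u w).
  by apply: hcont_lbm; apply: hcontM; [exact: fb_slope fb|exact: (proj1 rZ)].
have lk (k : R) := lbm_cst k.
have -> : \int[mu]_(u in `[s, t]) (gR i u w + jR i u w) =
    \int[mu]_(u in `[s, t]) (gU i u w + J i u w) -
    \int[mu]_(u in `[s, t]) (eps i * (drift_slope f kappa x u * Z i u w)) +
    \int[mu]_(u in `[s, t]) (eps i * c / 2 * delay_slope f kappa x u).
  have lUJ : lbm (fun u => gU i u w + J i u w).
    by apply: lbmD; [exact/hcont_lbm/(proj1 rgU)|exact: (proj2 lJ)].
  have l1 := lbmM (lk (eps i)) lAZ.
  have l2 := lbmM (lk (eps i * c / 2)) ldelay.
  rewrite -RintegralB//; try exact: lbm_integrable.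
  rewrite -RintegralD//; try (apply: lbm_integrable => //; exact: lbmB).
  by apply: eq_Rintegral => u _; rewrite /gR /jR; ring.
by rewrite !RintegralZl//; try exact: lbm_integrable; ring.
Qed.

Let R0 i : {ae P i, forall w, Rm i 0 w = 0}.
Proof.
apply: filterS3 (U0 i) (c_Z i) (ito_integral0 (c_filtration i) (c_N i)) => w Uw Zw N0.
rewrite /Rm Uw /Z (Zw _ (lexx 0)) N0 !set_itv1 !Rintegral_set1; ring.
Qed.

Lemma mR_increment_momO :
  momO P (@time_pairs R I) (fun i st => (1 + (st.2 - st.1)) * eta i)
    (fun i st w => mR i st.2 w - mR i st.1 w).
Proof.
pose H2 i (s : R) (w : cT i) := sigma (x s).
have aH2 i : adapted (cF i) (H2 i).
  by move=> u u0; have sF := filtration_sigma (c_filtration i) u0; exact: mwrt_cst.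
have cH2 i : continuous_paths (H2 i).
  by move=> w; exact: (hcont_comp (fb_sigma fb) (fb_flow fb)).
have bH2 i u w : `|H2 i u w| <= K by exact: fb_sigma_le fb _.
have HU : momO P (fun i (ku : (R * R) * R) => time_pairs i ku.1 /\ ku.1.1 <= ku.2 <= ku.1.2)
    (fun i _ => eta i) (fun i ku w => K * (eps i * U i ku.2 w)).
  have tU (i : I) (ku : (R * R) * R) : time_pairs i ku.1 /\ ku.1.1 <= ku.2 <= ku.1.2 ->
      pos_times i ku.2.
    by move=> [/andP[s0 _] /andP[su _]]; exact: le_trans su.
  have h1 := momO_reindex U_momO tU.
  have h2 : momO P (fun i (ku : (R * R) * R) => time_pairs i ku.1 /\ ku.1.1 <= ku.2 <= ku.1.2)
    (fun i _ => eps i) (fun i _ _ => eps i).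
    apply: (momO_det (c := 1) _ _) => [|i ku _]; first exact: ler01.
    by rewrite mul1r ger0_norm// ltW.
  have h3 := momO_mul h2 h1 (fun i _ _ => e0 i) (fun i _ _ => e0 i).
  apply: momO_scale; apply: (momO_weaken (c := 1) h3 _ ler01) => i ku _.
  rewrite mul1r (le_trans (eps2_rate i))// andbT.
  by apply: mulr_ge0; exact: ltW.
have := @momO_ito _ _ _ _ P (R * R) (@time_pairs R I) (fun i p => p.1) (fun i p => p.2)
  (fun i p => 1 + (p.2 - p.1)) (fun i _ => eta i) (fun i => cF i)
  (fun i => cW i) noise H2 M N (fun i => eps i * K) (fun=> K) (fun=> 1) (fun i => - eps i)
  (fun i => c_filtration i) (fun i => c_brownian i) noise_adapted noise_continuous noise_le
  aH2 cH2 bH2 (fun i => c_M i) (fun i => c_N i) pair_le gap_le_sqr unit_gap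
  (fun i _ _ => eta_gt0 i).
move=> /(_ _) Hito; apply: momO_le (Hito _) _ _.
- apply: momO_le HU _ _.
    move=> i [[s t] u] [/andP[/= s0 _] /andP[su _]]; have u0 := le_trans s0 su.
    by apply: measurable_funD; apply: measurable_funM;
      try exact: measurable_cst; exact: noise_measurable.
  move=> i [[s t] u] w _ /=.
  rewrite (_ : 1 * _ + _ = eps i * (sigma (X i u w) - sigma (x u))); last first.
    by rewrite /noise /H2; ring.
  rewrite !normrM mulrCA (ger0_norm K0); apply: ler_wpM2l => //.
  exact: fb_sigma_lip fb _ _.
- move=> i [s t] /andP[/= s0 st]; have t0 := le_trans s0 st.
  by apply: measurable_funB; exact: (proj2 rmR).
move=> i [s t] w _ /=; rewrite le_eqVlt; apply/orP; left; apply/eqP; congr `|_|.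
by rewrite /mR; ring.
Qed.

Lemma jR_integral_momO :
  momO P (@time_pairs R I) (fun i st => (1 + (st.2 - st.1)) * eta i)
    (fun i st w => \int[mu]_(u in `[st.1, st.2]) jR i u w).
Proof.
pose saw i u := u - pi_ (del i) u - del i / 2.
pose h i (st : R * R) :=
  (- \int[mu]_(u in `[st.1, st.2]) (delay_slope f kappa x u * saw i u))
  - (del i - eps i * c) / 2 * \int[mu]_(u in `[st.1, st.2]) delay_slope f kappa x u.
have H1 := momO_increment_integral pair_le gap_le unit_gap (fun i => ltW (rate_gt0 i))
  lpsi psi_momO.
have H1' := momO_weaken (c := 1) H1 (eta' := fun i p => (1 + (p.2 - p.1)) * eta i) _ ler01.
have Hh : momO P (@time_pairs R I) (fun i p => (1 + (p.2 - p.1)) * eta i) (fun i p _ => h i p).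
  have KL0 : 0 <= K * Lam ^+ 2 by apply: mulr_ge0 => //; exact: sqr_ge0.
  apply: (momO_det (c := K * Lam ^+ 2 + K) _ _); first exact: addr_ge0.
  move=> i [s t] hp; have g0 := unit_gap hp; move: hp => /andP[/= s0 st].
  have h1 := sawtooth_integral_le (d0 i) (fb_delay fb) (fb_delay_le fb) (fb_delay_lip fb) s0 st.
  have h2 : `|\int[mu]_(u in `[s, t]) delay_slope f kappa x u| <= K * (t - s).
    apply: lbm_integral_le => // u /andP[su _].
    by apply: fb_delay_le fb _ _; exact: le_trans su.
  rewrite /h/=; apply: (le_trans (ler_normB _ _)); rewrite normrN [leRHS]mulrDl; apply: lerD.
    apply: (le_trans h1); rewrite -!mulrA; apply: ler_wpM2l => //.
    rewrite [leRHS](_ : _ = Lam ^+ 2 * eta i * (1 + (t - s))); last by ring.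
    rewrite mulrA -expr2; apply: ler_wpM2r; first exact: ltW.
    apply: le_trans (lerXn_le 2 (ltW (d0 i)) (c_del_le i)) _.
    rewrite exprMn; apply: ler_wpM2l; first exact: sqr_ge0.
    by apply: le_trans (rate_eta i); exact: eps_power_rate 0%N i.
  rewrite normrM [leRHS](_ : _ = eta i * (K * (1 + (t - s)))); last by rewrite /=; ring.
  apply: ler_pM => //; last first.
    by apply: le_trans h2 _; apply: ler_wpM2l => //; rewrite lerDr.
  rewrite normrM [`|2^-1|]ger0_norm ?invr_ge0//.
  apply: (@le_trans _ _ `|del i - eps i * c|); last by rewrite lerDr; exact/ltW/rate_gt0.
  by rewrite ler_piMr// invf_le1// ler1n.
have E i p (w : cT i) : time_pairs i p ->
    \int[mu]_(u in `[p.1, p.2]) jR i u w = \int[mu]_(u in `[p.1, p.2]) psi i u w + h i p.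
  case: p => s t /andP[/= s0 st].
  have lsaw : lbm (saw i) by apply: lbmB (lgap i) (lbm_cst _).
  have l1 := lbmM ldelay lsaw.
  have l3 := proj2 lpsi i w.
  rewrite /h/= -RintegralZl//; last exact: lbm_integrable.
  have l2 := lbmM (lbm_cst ((del i - eps i * c) / 2)) ldelay.
  rewrite -opprD -RintegralD//; try exact: lbm_integrable.
  rewrite -RintegralB//; try exact: lbm_integrable; last exact/lbm_integrable/s0/lbmD.
  by apply: eq_Rintegral => u _; rewrite /jR /psi /saw; ring.
have H2 := momO_add (H1' _) Hh.
have {}H2 := H2 _.
apply: momO_le (H2 _) _ _.
- move=> i p /unit_gap g0; rewrite mul1r; apply/andP; split.
    by apply: mulr_ge0; exact: ltW.
  by apply: ler_wpM2l => //; exact: ltW.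
- move=> i p hp; under eq_fun do rewrite (E i p _ hp).
  by apply: measurable_funD => //; exact: (proj1 H1).
by move=> i p w hp; rewrite E.
Qed.

Lemma R_momO : momO P (@pos_times R I) (fun i _ => eta i) Rm.
Proof.
have HQ := residual_increment_momO eta_gt0 rRm rgR ljR rmR R_increment
  mR_increment_momO jR_integral_momO.
pose Q i t w := Rm i t w - \int[mu]_(s in `[0, t]) gR i s w.
pose Y i t w := ou a (fun t => Q i t w) t.
have rQ : regular_process Q by exact: regularB rRm (regular_integral rgR).
have HY : momO P (@pos_times R I) (fun i _ => eta i) Y.
  apply: (momO_ou a0 eta_gt0 rQ) HQ => i.
  by apply: filterS (R0 i) => w Rw; rewrite /Q Rw set_itv1 Rintegral_set1 subr0.
have rY : regular_process Y := regular_ou a rQ.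
have cn : continuous (fun y : R => `|y|) := @norm_continuous R R.
have cX n : continuous (fun y : R => `|y| ^+ n).
  by move=> y; exact: (continuous_comp (cn y) (@exprn_continuous R n _)).
pose beta i t w := K * (`|U i t w| ^+ 2 + `|U i t w| ^+ r.+2) + (K + a) * `|Y i t w|.
have rb : regular_process beta.
  apply: regularD; apply: (regularM (rcst _)); last exact: (regular_comp cn rY).
  by apply: regularD; exact: (regular_comp (cX _) rU).
have HU n : momO P (@pos_times R I) (fun i _ => eta i) (fun i t w => `|U i t w| ^+ n.+2).
  have n0 : (0 < n.+2)%N by [].
  apply: (momO_weaken (c := 1) (momO_pow n0 (momO_abs U_momO)) _ ler01) => i t _.
  rewrite mul1r (le_trans (eps_power_rate n i))// andbT.
  by apply: exprn_ge0; exact: ltW.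
have Hb : momO P (@pos_times R I) (fun i _ => eta i) beta.
  apply: momO_add; apply: momO_scale; last exact: momO_abs.
  by apply: momO_add; exact: HU.
have Ka0 : 0 <= K + a by rewrite addr_ge0// ltW.
apply: (momO_contraction a0 eta_gt0 rRm rgR rb _ _ HY Hb).
  by move=> i t w _; rewrite /beta; apply: addr_ge0; apply: mulr_ge0 => //; apply: addr_ge0; exact: exprn_ge0.
move=> i t w t0; rewrite -/(Y i t w) /beta.
have := fb_drift_taylor fb (U i t w) (ltW t0).
rewrite (_ : x t + U i t w = X i t w); last by rewrite /U; ring.
rewrite -/(gU i t w); set A := drift_slope f kappa x t => hT.
have hA : A <= - a by exact: fb_slope_le fb _ (ltW t0).
have hK : `|A| <= K by exact: fb_slope_bound fb _ (ltW t0).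
set V := Rm i t w - Y i t w; set y := Y i t w.
have -> : V * (gR i t w + a * y) =
    A * V ^+ 2 + V * (gU i t w - A * U i t w + (A + a) * y).
  by rewrite /V /gR -/A -/y /Rm; ring.
apply: lerD; first by apply: ler_wpM2r => //; exact: sqr_ge0.
apply: (le_trans (ler_norm _)); rewrite normrM; apply: ler_wpM2l => //.
apply: (le_trans (ler_normD _ _)); apply: lerD => //.
rewrite normrM; apply: ler_wpM2r => //; apply: (le_trans (ler_normD _ _)).
by apply: lerD => //; rewrite ger0_norm// ltW.
Qed.

Theorem linearization_error_momO :
  momO (fun i : config f kappa sigma x x0 c Lam => cP i) (@pos_times R _)
    (fun i _ => ceps i * Num.sqrt (ceps i) + `|cdel i - ceps i * c|)
    (fun i t w => cX i t w - x t - ceps i * cZ i t w).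
Proof. exact: R_momO. Qed.

End stages.

Section second_order_bounds.
Context {R : realType}.
Implicit Types (h : R -> R) (y z p : R).

Lemma derivable_continuous1 h : (forall y, derivable h y 1) -> continuous h.
Proof. by move=> dh y; apply: differentiable_continuous; exact/derivable1_diffP. Qed.

Lemma mvt_between h y z : (forall p, derivable h p 1) ->
  exists2 xi, forall p, `|xi - p| <= Num.max `|y - p| `|z - p| &
    h z - h y = derive1 h xi * (z - y).
Proof.
move=> dh.
have mvt u v : u < v -> exists2 xi, u < xi < v & h v - h u = derive1 h xi * (v - u).
  move=> uv; have d (s : R) : s \in `]u, v[ -> is_derive s 1 h (derive1 h s).
    by move=> _; apply: DeriveDef; [exact: dh|rewrite derive1E].
  have [xi xiuv E] := MVT uv d (continuous_subspaceT (derivable_continuous1 dh)).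
  by exists xi => //; move: xiuv; rewrite in_itv.
have bet u v xi : u < xi < v -> forall p, `|xi - p| <= Num.max `|u - p| `|v - p|.
  move=> /andP[u1 u2] p; rewrite le_max !ler_norml.
  have := ler_norm (v - p); have := ler_norm (- (u - p)); rewrite normrN => h1 h2.
  have [le|gt] := leP p xi.
    by apply/orP; right; apply/andP; split; lra.
  by apply/orP; left; apply/andP; split; lra.
have [yz|zy|->] := ltgtP y z.
- by have [xi hxi E] := mvt _ _ yz; exists xi => //; exact: bet.
- have [xi hxi E] := mvt _ _ zy; exists xi.
    by move=> p; rewrite maxC; exact: bet.
  by rewrite -opprB E; ring.
by exists z => [p|]; rewrite ?subrr ?mulr0// le_max lexx.
Qed.

Lemma sqr_le_lin_pow (y : R) r : 0 <= y -> y ^+ 2 <= y + y ^+ r.+2.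
Proof.
move=> y0; have [y1|y1] := leP y 1.
  apply: (@le_trans _ _ y); last by rewrite lerDl exprn_ge0.
  by rewrite expr2 ler_piMr.
apply: (@le_trans _ _ (y ^+ r.+2)); last by rewrite lerDr.
by apply: ler_weXn2l => //; exact: ltW.
Qed.

Definition local_bounds h (B C : R) (r : nat) : Prop :=
  [/\ forall z, `|z| <= B -> `|h z| <= C,
      forall z, `|z| <= B -> `|derive1 h z| <= C,
      forall y z, `|y| <= B -> `|z| <= B -> `|h y - h z| <= C * `|y - z|,
      forall y z, `|y| <= B -> `|z| <= B ->
        `|derive1 h y - derive1 h z| <= C * `|y - z|
    & forall z y, `|z| <= B ->
        `|h (z + y) - h z - derive1 h z * y| <= C * (`|y| ^+ 2 + `|y| ^+ r.+2)].

Lemma local_boundsW h B C C' r : C <= C' -> local_bounds h B C r -> local_bounds h B C' r.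
Proof.
move=> CC [h1 h2 h3 h4 h5]; split.
- by move=> z zB; apply: le_trans CC; exact: h1.
- by move=> z zB; apply: le_trans CC; exact: h2.
- by move=> y z yB zB; apply: (le_trans (h3 _ _ yB zB)); exact: ler_wpM2r.
- by move=> y z yB zB; apply: (le_trans (h4 _ _ yB zB)); exact: ler_wpM2r.
- by move=> z y zB; apply: (le_trans (h5 _ _ zB)); apply: ler_wpM2r => //.
Qed.

Lemma local_boundsP h (k B : R) r : twice_differentiable h -> 0 <= k -> 0 <= B ->
  (forall y, `|derive1n 2 h y| <= k * (1 + `|y| ^+ r)) ->
  exists2 C, 0 <= C & local_bounds h B C r.
Proof.
move=> dd k0 B0 h2.
have dh y : derivable h y 1 := proj1 (dd y).
have ddh y : derivable (derive1 h) y 1 := proj2 (dd y).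
have maxB (u v : R) : `|u| <= B -> `|v| <= B -> forall xi : R,
    (forall p, `|xi - p| <= Num.max `|u - p| `|v - p|) -> `|xi| <= B.
  move=> uB vB xi /(_ 0); rewrite !subr0 => H; apply: (le_trans H).
  by rewrite ge_max uB.
pose B2 := k * (1 + B ^+ r).
have hB2 z : `|z| <= B -> `|derive1n 2 h z| <= B2.
  move=> zB; apply: (le_trans (h2 z)); apply: ler_wpM2l => //; rewrite lerD2l.
  exact: lerXn_le.
have B20 : 0 <= B2 by apply: mulr_ge0 => //; rewrite addr_ge0// exprn_ge0.
have L1 y z : `|y| <= B -> `|z| <= B ->
    `|derive1 h y - derive1 h z| <= B2 * `|y - z|.
  move=> yB zB; have [xi hxi ->] := mvt_between z y ddh.
  by rewrite normrM; apply: ler_wpM2r => //; apply: hB2; exact: maxB hxi.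
have zero : `|(0 : R)| <= B by rewrite normr0.
have from0 (g : R -> R) (L : R) : 0 <= L ->
    (forall y z, `|y| <= B -> `|z| <= B -> `|g y - g z| <= L * `|y - z|) ->
    forall z, `|z| <= B -> `|g z| <= `|g 0| + L * B.
  move=> L0 gL z zB; rewrite -[g z](subrK (g 0)) addrC; apply: (le_trans (ler_normD _ _)).
  rewrite lerD2l; apply: (le_trans (gL _ _ zB zero)); rewrite subr0.
  exact: ler_wpM2l.
pose B1 := `|derive1 h 0| + B2 * B.
have B10 : 0 <= B1 by rewrite addr_ge0// mulr_ge0.
have hB1 := from0 _ _ B20 L1.
have L0 y z : `|y| <= B -> `|z| <= B -> `|h y - h z| <= B1 * `|y - z|.
  move=> yB zB; have [xi hxi ->] := mvt_between z y dh.
  by rewrite normrM; apply: ler_wpM2r => //; apply: hB1; exact: maxB hxi.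
pose BO := `|h 0| + B1 * B.
have BO0 : 0 <= BO by rewrite addr_ge0// mulr_ge0.
have hBO := from0 _ _ B10 L0.
pose Q := 1 + 2 ^+ r * (B ^+ r + 1).
pose Bt := k * Q.
have Q0 : 0 <= Q.
  by apply: addr_ge0 => //; apply: mulr_ge0; [exact: exprn_ge0|apply: addr_ge0 => //; exact: exprn_ge0].
have Bt0 : 0 <= Bt by exact: mulr_ge0.
have T z y : `|z| <= B ->
    `|h (z + y) - h z - derive1 h z * y| <= Bt * (`|y| ^+ 2 + `|y| ^+ r.+2).
  move=> zB; have [xi hxi ->] := mvt_between z (z + y) dh.
  have [zt hzt E] := mvt_between z xi ddh.
  have xz : `|xi - z| <= `|y|.
    by have := hxi z; rewrite subrr normr0 addrAC subrr add0r max_r.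
  have ztB : `|zt| <= B + `|y|.
    have := hzt 0; rewrite !subr0 => H; apply: (le_trans H); rewrite ge_max.
    apply/andP; split; first by apply: (le_trans zB); rewrite lerDl.
    rewrite -[xi](subrK z) addrC; apply: (le_trans (ler_normD _ _)).
    exact: lerD.
  rewrite addrAC subrr add0r -mulrBl E -mulrA normrM.
  apply: (@le_trans _ _ (k * (1 + `|zt| ^+ r) * (`|y| * `|y|))).
    apply: ler_pM => //; first exact: h2.
    by rewrite normrM; exact: ler_wpM2r.
  rewrite /Bt -!mulrA; apply: ler_wpM2l => //.
  rewrite [leRHS](_ : _ = Q * (1 + `|y| ^+ r) * (`|y| * `|y|)); last first.
    by rewrite !exprS; ring.
  apply: ler_wpM2r; first exact: mulr_ge0.
  have h3 : `|zt| ^+ r <= 2 ^+ r * (B ^+ r + `|y| ^+ r).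
    apply: le_trans (exprD_le2 _ B0 (normr_ge0 y)); exact: lerXn_le.
  have Br : 0 <= B ^+ r by exact: exprn_ge0.
  have yr : 0 <= `|y| ^+ r by exact: exprn_ge0.
  have tr : 0 <= 2 ^+ r :> R by exact: exprn_ge0.
  apply: (@le_trans _ _ (1 + 2 ^+ r * (B ^+ r + `|y| ^+ r))); first by rewrite lerD2l.
  rewrite [leRHS](_ : _ = 1 + 2 ^+ r * (B ^+ r + `|y| ^+ r) +
      (`|y| ^+ r + 2 ^+ r * (1 + B ^+ r * `|y| ^+ r))); last by rewrite /Q; ring.
  by rewrite lerDl addr_ge0// mulr_ge0// addr_ge0// mulr_ge0.
have [C [C0 BOC B1C B2C BtC]] : exists C, [/\ 0 <= C, BO <= C, B1 <= C, B2 <= C & Bt <= C].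
  by exists (BO + B1 + (B2 + Bt)); split; lra.
exists C => //.
split.
- by move=> z zB; apply: le_trans BOC; exact: hBO.
- by move=> z zB; apply: le_trans B1C; exact: hB1.
- by move=> y z yB zB; apply: (le_trans (L0 _ _ yB zB)); exact: ler_wpM2r.
- by move=> y z yB zB; apply: (le_trans (L1 _ _ yB zB)); exact: ler_wpM2r.
- by move=> z y zB; apply: (le_trans (T _ _ zB)); exact: ler_wpM2r.
Qed.

End second_order_bounds.

Section flow_bounds_of_assumptions.
Context {R : realType}.
Local Notation mu := (@lebesgue_measure R).
Variables (f kappa sigma x : R -> R) (x0 : R).
Local Notation b := (drift f kappa).

Lemma lipschitz_continuous (h : R -> R) (L : R) :
  (forall y z, `|h y - h z| <= L * `|y - z|) -> continuous h.
Proof.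
move=> hL y; apply/cvgrPdist_lt => e e0.
have L0 : 0 < `|L| + 1 by rewrite ltr_wpDl.
near=> z.
apply: (le_lt_trans (hL y z)); apply: (@le_lt_trans _ _ ((`|L| + 1) * `|y - z|)).
  by apply: ler_wpM2r => //; apply: le_trans (ler_norm _) _; rewrite lerDl.
rewrite mulrC -ltr_pdivlMr//; near: z.
apply: (@cvgr_dist_lt _ _ _ _ _ id y (@cvg_id _ _)).
by rewrite divr_gt0.
Unshelve. all: by end_near. Qed.

Lemma flow_bounded (a : R) : 0 < a -> continuous b ->
  (forall y z, (y - z) * (b y - b z) <= - a * (y - z) ^+ 2) ->
  ode_solution f kappa x0 x -> exists2 B, 0 <= B & forall t, 0 <= t -> `|x t| <= B.
Proof.
move=> a0 cb diss [x00 cx' dx]; have cx : hcont x := cx'; exists (`|x0| + a^-1 * `|b 0|).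
  by rewrite addr_ge0// mulr_ge0// invr_ge0 ltW.
move=> t t0.
have cbx : hcont (fun s => b (x s)) by exact: hcont_comp cb cx.
have ineq s : 0 < s -> x s * b (x s) <= - a * x s ^+ 2 + `|x s| * `|b 0|.
  move=> _; have := diss (x s) 0; rewrite subr0 => h.
  have -> : x s * b (x s) = x s * (b (x s) - b 0) + x s * b 0 by ring.
  by apply: lerD => //; rewrite -normrM; exact: ler_norm.
have cc : hcont (fun=> `|b 0|) by exact: hcont_cst.
have h := dissipative_comparison a0 cx cc (fun _ _ => normr_ge0 _)
  dx ineq t0.
apply: (le_trans h); rewrite x00 lerD2l.
have cE : hcont (fun s => expR (- (a * (t - s)))).
  apply: (hcont_comp (k := expR)); first exact: continuous_expR.
  apply: hcontN; apply: hcontM; first exact: hcont_cst.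
  by apply: hcontB; [exact: hcont_cst|exact: hcont_id].
rewrite RintegralZr//; last exact: hcont_integrable.
apply: ler_wpM2r => //; rewrite exp_integral//.
by rewrite ger_pMr ?invr_gt0// gerBl expR_ge0.
Qed.

Lemma flow_bounds_exist : assumption_A1 f kappa sigma -> assumption_A2 kappa sigma ->
  ode_solution f kappa x0 x -> assumption_A3 f kappa x ->
  exists a K r, flow_bounds f kappa sigma x x0 a K r.
Proof.
move=> [q [xi0 [m [Lk [Ls [lam [_ [[_ kL sL] [lam0 fdiss lamL]]]]]]]]] [gam hgam] ode
  [df dk _ [k2 hk2] [kf [r hkf]]].
have [x00 cx' dx] := ode; have cx : hcont x := cx'.
have cf : continuous f := derivable_continuous1 (fun y => proj1 (df y)).
have ck : continuous kappa := derivable_continuous1 (fun y => proj1 (dk y)).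
have cdf : continuous (derive1 f) := derivable_continuous1 (fun y => proj2 (df y)).
have cdk : continuous (derive1 kappa) := derivable_continuous1 (fun y => proj2 (dk y)).
have cs : continuous sigma := lipschitz_continuous sL.
have cb : continuous b by move=> y; apply: cvgD; [exact: cf|exact: ck].
pose a := lam / 2; have a0 : 0 < a by rewrite divr_gt0.
have bdiss y z : (y - z) * (b y - b z) <= - a * (y - z) ^+ 2.
  have h1 := fdiss y z; have h2 := kL y z.
  rewrite real_normK ?num_real// in h1.
  have h3 : (y - z) * (kappa y - kappa z) <= a * (y - z) ^+ 2.
    apply: (le_trans (ler_norm _)); rewrite normrM.
    apply: (le_trans (ler_wpM2l (normr_ge0 _) h2)).
    rewrite mulrCA -expr2 real_normK ?num_real//; apply: ler_wpM2r; first exact: sqr_ge0.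
    by rewrite /a; lra.
  rewrite /b (_ : _ * _ = (y - z) * (f y - f z) + (y - z) * (kappa y - kappa z)); last by ring.
  have -> : - a * (y - z) ^+ 2 = - lam * (y - z) ^+ 2 + a * (y - z) ^+ 2.
    by rewrite /a; field.
  exact: lerD.
have [B B0 xB] := flow_bounded a0 cb bdiss ode.
have [Cf Cf0 lf] : exists2 C, 0 <= C & local_bounds f B C r.
  apply: (local_boundsP (k := `|kf|)) => // y; apply: (le_trans (hkf y)).
  by apply: ler_wpM2r; [rewrite addr_ge0// exprn_ge0|exact: ler_norm].
have [Ck Ck0 lk] : exists2 C, 0 <= C & local_bounds kappa B C r.
  apply: (local_boundsP (k := `|k2|)) => // y; apply: (le_trans (hk2 y)).
  by apply: (le_trans (ler_norm _)); apply: ler_peMr => //; rewrite lerDl exprn_ge0.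
pose C := Cf + Ck.
have C0 : 0 <= C by rewrite addr_ge0.
have [f0 f1 fL dfL fT] : local_bounds f B C r.
  by apply: local_boundsW lf; rewrite lerDl.
have [kp0 k1 kpL dkL kT] : local_bounds kappa B C r.
  by apply: local_boundsW lk; rewrite lerDr.
have [K [[KC Kgam KLk KLs Kk2] [KC2 KC3]]] : exists K, [/\ 2 * C <= K, gam <= K, Lk <= K, Ls <= K
    & `|k2| <= K] /\ 4 * C ^+ 2 <= K /\ 8 * C ^+ 3 <= K.
  exists (2 * C + `|gam| + `|Lk| + `|Ls| + `|k2| + 4 * C ^+ 2 + 8 * C ^+ 3).
  have := exprn_ge0 2 C0; have := exprn_ge0 3 C0; have := ler_norm gam; have := ler_norm Lk.
  have := ler_norm Ls; have := normr_ge0 gam; have := normr_ge0 Lk; have := normr_ge0 Ls.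
  have := normr_ge0 k2 => *; do ?split; lra.
exists a, K, r.
have K0 : 0 <= K by apply: le_trans KC; rewrite mulr_ge0.
have CK : C <= K by lra.
have cbx : hcont (fun s => b (x s)) by exact: hcont_comp cb cx.
have flowE t : 0 <= t -> x t = x0 + \int[mu]_(s in `[0, t]) b (x s).
  by move=> t0; rewrite (hcont_FTC2 cbx cx dx t0) x00; ring.
have bB t : 0 <= t -> `|b (x t)| <= 2 * C.
  move=> t0; rewrite mulr_natl mulr2n; apply: le_trans (ler_normD _ _) _.
  by apply: lerD; [exact/f0/xB|exact/kp0/xB].
have xL s t : 0 <= s -> s <= t -> `|x t - x s| <= 2 * C * (t - s).
  move=> s0 st; rewrite -(hcont_FTC2_itv cbx cx dx s0 st).
  apply: lbm_integral_le => //; first exact: hcont_lbm.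
  by move=> u /andP[su _]; apply: bB; exact: le_trans su.
have bL s t : 0 <= s -> 0 <= t -> `|b (x t) - b (x s)| <= 2 * C * `|x t - x s|.
  move=> s0 t0.
  have -> : b (x t) - b (x s) = (f (x t) - f (x s)) + (kappa (x t) - kappa (x s)).
    by rewrite /drift; ring.
  apply: (le_trans (ler_normD _ _)); rewrite mulr_natl mulr2n mulrDl.
  by apply: lerD; [apply: fL|apply: kpL]; exact: xB.
have bT t y : 0 <= t -> `|b (x t + y) - b (x t) - drift_slope f kappa x t * y| <=
    2 * C * (`|y| ^+ 2 + `|y| ^+ r.+2).
  move=> t0; rewrite /drift /drift_slope.
  rewrite (_ : _ - _ = (f (x t + y) - f (x t) - derive1 f (x t) * y) +
    (kappa (x t + y) - kappa (x t) - derive1 kappa (x t) * y)); last by ring.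
  apply: (le_trans (ler_normD _ _)); rewrite mulr_natl mulr2n mulrDl.
  by apply: lerD; [apply: fT|apply: kT]; exact: xB.
have AC t : 0 <= t -> `|drift_slope f kappa x t| <= 2 * C.
  move=> t0; rewrite mulr_natl mulr2n; apply: (le_trans (ler_normD _ _)).
  by apply: lerD; [apply: f1|apply: k1]; exact: xB.
have Aa t : 0 <= t -> drift_slope f kappa x t <= - a.
  move=> t0; apply/ler_addgt0Pr => e e_gt0; set A := drift_slope f kappa x t.
  have D0 : 0 < 4 * C + 1 by lra.
  pose h := Num.min 1 (e / (4 * C + 1)).
  have h0 : 0 < h by rewrite lt_min ltr01 divr_gt0.
  have h1 : h <= 1 by rewrite ge_min lexx.
  have he : (4 * C + 1) * h <= e by rewrite mulrC -ler_pdivlMr// ge_min lexx orbT.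
  have := bdiss (x t + h) (x t); rewrite (_ : x t + h - x t = h); last by ring.
  have := bT t h t0; rewrite (ger0_norm (ltW h0)) -/A ler_norml => /andP[hT _].
  set Bd := b (x t + h) - b (x t) in hT * => hd.
  have hr : C * h ^+ r.+2 <= C * h ^+ 2.
    apply: ler_wpM2l => //; rewrite -addn2 exprD; apply: ler_piMl; first exact: sqr_ge0.
    by apply: exprn_ile1 => //; exact: ltW.
  have hB : h * (A * h - 4 * C * h ^+ 2) <= h * Bd by apply: ler_wpM2l; [exact: ltW|lra].
  have : (A - 4 * C * h + a) * h ^+ 2 <= 0.
    rewrite (_ : _ * _ = h * (A * h - 4 * C * h ^+ 2) + a * h ^+ 2); last by ring.
    lra.
  rewrite pmulr_lle0 ?exprn_gt0// => h5.
  lra.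
have delay_le t : 0 <= t -> `|delay_slope f kappa x t| <= C * (2 * C).
  by move=> t0; rewrite normrM; apply: ler_pM => //; [exact/k1/xB|exact: bB].
split => //.
- by move=> y; apply: le_trans Kgam; apply: le_trans (hgam y); rewrite lerDr.
- by move=> y; apply: le_trans Kgam; apply: le_trans (hgam y); rewrite lerDl.
- by move=> y z; apply: (le_trans (kL y z)); exact: ler_wpM2r.
- by move=> y z; apply: (le_trans (sL y z)); exact: ler_wpM2r.
- by move=> t t0; apply: le_trans CK; exact/f0/xB.
- move=> t y t0; have h1 := fT _ y (xB t t0); have h2 := f1 _ (xB t t0).
  rewrite -[f (x t + y) - f (x t)](subrK (derive1 f (x t) * y)).
  apply: (le_trans (ler_normD _ _)); apply: (le_trans (lerD h1 (lexx _))).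
  have h3 := sqr_le_lin_pow r (normr_ge0 y).
  have h4 : `|derive1 f (x t) * y| <= C * `|y| by rewrite normrM; exact: ler_wpM2r.
  have yr : 0 <= `|y| ^+ r.+2 by exact: exprn_ge0.
  apply: (@le_trans _ _ (C * (`|y| + `|y| ^+ r.+2 + `|y| ^+ r.+2) + C * `|y|)).
    by apply: lerD => //; apply: ler_wpM2l => //; rewrite lerD2r.
  apply: (@le_trans _ _ (2 * C * (`|y| + `|y| ^+ r.+2))); last first.
    by apply: ler_wpM2r => //; exact: addr_ge0.
  by rewrite le_eqVlt; apply/orP; left; apply/eqP; ring.
- by move=> t y t0; apply: (le_trans (bT t y t0)); exact: ler_wpM2r.
- by apply: hcontD; [exact: (hcont_comp cdf cx)|exact: (hcont_comp cdk cx)].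
- by move=> t t0; apply: le_trans KC; exact: AC.
- move=> t y z t0.
  have [xi hxi ->] := mvt_between z y (fun p => proj1 (dk p)).
  have [zt _ E] := mvt_between (x t) xi (fun p => proj2 (dk p)).
  rewrite -mulrBl E !normrM; apply: ler_wpM2r => //; apply: ler_pM => //.
    by apply: le_trans Kk2; apply: le_trans (ler_norm _); exact: hk2.
  apply: (le_trans (hxi (x t))); rewrite ge_max lerDr lerDl.
  by rewrite !normr_ge0.
- by move=> t t0; apply: le_trans CK; exact/k1/xB.
- by apply: hcontM => //; exact: (hcont_comp cdk cx).
- move=> t t0; apply: (le_trans (delay_le t t0)); apply: le_trans KC2.
  by rewrite mulrCA -expr2 ler_wpM2r ?sqr_ge0// ler_nat.
- move=> s t s0 st; have t0 := le_trans s0 st.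
  have hd := dkL _ _ (xB t t0) (xB s s0); have hb := bL s t s0 t0; have hx := xL s t s0 st.
  rewrite /delay_slope (_ : _ - _ = (derive1 kappa (x t) - derive1 kappa (x s)) * b (x t)
    + derive1 kappa (x s) * (b (x t) - b (x s))); last by ring.
  apply: (le_trans (ler_normD _ _)).
  apply: (@le_trans _ _ (C * `|x t - x s| * (2 * C) + C * (2 * C * `|x t - x s|))).
    rewrite !normrM; apply: lerD; apply: ler_pM => //; first exact: bB.
    exact/k1/xB.
  apply: (@le_trans _ _ (4 * C ^+ 2 * (2 * C * (t - s)))); last first.
    rewrite (_ : _ * _ = 8 * C ^+ 3 * (t - s)); last by ring.
    by apply: ler_wpM2r => //; rewrite subr_ge0.
  rewrite [leLHS](_ : _ = 4 * C ^+ 2 * `|x t - x s|); last by ring.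
  by apply: ler_wpM2l => //; apply: mulr_ge0 => //; exact: sqr_ge0.
move=> s t s0 st; have t0 := le_trans s0 st.
have ts0 : 0 <= t - s by rewrite subr_ge0.
have lc : lbm (fun=> b (x t)) by exact: lbm_cst.
have lb := hcont_lbm cbx.
have -> : x s - x t + (t - s) * b (x t) = \int[mu]_(u in `[s, t]) (b (x t) - b (x u)).
  rewrite RintegralB//; try exact: lbm_integrable.
  rewrite (hcont_FTC2_itv cbx cx dx s0 st).
  by rewrite segment_integral_cst//; ring.
apply: (@le_trans _ _ (4 * C ^+ 2 * (t - s) * (t - s))).
  apply: lbm_integral_le => //; first exact: lbmB.
  move=> u /andP[su ut]; have u0 := le_trans s0 su.
  apply: (le_trans (bL u t u0 t0)).
  rewrite (_ : 4 * C ^+ 2 * (t - s) = 2 * C * (2 * C * (t - s))); last by ring.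
  apply: ler_wpM2l; first by rewrite mulr_ge0.
  apply: (le_trans (xL u t u0 ut)); apply: ler_wpM2l; first by rewrite mulr_ge0.
  by rewrite lerD2l lerN2.
by rewrite -mulrA -expr2; apply: ler_wpM2r => //; exact: sqr_ge0.
Qed.

End flow_bounds_of_assumptions.

Lemma rate_expr_le (R : realType) (eps delta c : R) n : 0 < eps ->
  (eps * Num.sqrt eps + `|delta - eps * c|) ^+ n <=
  eps ^+ n * (2 ^+ n * (Num.sqrt (eps ^+ n) + `|delta / eps - c| ^+ n)).
Proof.
move=> e0.
have -> : eps * Num.sqrt eps + `|delta - eps * c| = eps * (Num.sqrt eps + `|delta / eps - c|).
  rewrite mulrDr -[X in _ + X * _](ger0_norm (ltW e0)) -normrM mulrBr; congr (_ + `|_ - _|).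
  by rewrite mulrC divfK// gt_eqF.
rewrite exprMn; apply: ler_wpM2l; first by rewrite exprn_ge0// ltW.
have -> : Num.sqrt (eps ^+ n) = Num.sqrt eps ^+ n.
  elim: n => [|n IH]; first by rewrite !expr0 sqrtr1.
  by rewrite !exprS sqrtrM ?ltW// IH.
by apply: exprD_le2 => //; exact: sqrtr_ge0.
Qed.

Lemma rate_le_bound (R : realType) (eps delta c : R) p : 0 < eps -> 0 < delta ->
  Num.sqrt (eps ^+ p) + `|delta / eps - c| ^+ p <=
  delta ^+ (2 * p) / eps ^+ p + `|delta / eps - c| ^+ p
    + (delta ^+ p / eps ^+ p + 1)
      * Num.sqrt (delta ^+ p + eps ^+ p + delta `^ (p%:R / 2) * eps ^+ p)
    + delta `^ (p%:R / 2) + eps ^+ p.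
Proof.
move=> e0 d0.
have ep : 0 <= eps ^+ p by rewrite exprn_ge0// ltW.
have dp : 0 <= delta ^+ p by rewrite exprn_ge0// ltW.
have d2p : 0 <= delta ^+ (2 * p) / eps ^+ p by rewrite divr_ge0// exprn_ge0// ltW.
have dep : 0 <= delta ^+ p / eps ^+ p by rewrite divr_ge0.
have pw : 0 <= delta `^ (p%:R / 2) by exact: powR_ge0.
set S := Num.sqrt (_ + _).
have hS : Num.sqrt (eps ^+ p) <= S.
  by rewrite ler_wsqrtr// addrAC lerDr addr_ge0// mulr_ge0.
have S0 : 0 <= S by exact: sqrtr_ge0.
have : S <= (delta ^+ p / eps ^+ p + 1) * S by rewrite ler_peMl// lerDr.
lra.
Qed.

Theorem theorem2p6 (R : realType) (f kappa sigma x : R -> R) (x0 c : R)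
    (p : nat)
    (hwp : forall eps delta : R, 0 < eps -> 0 < delta ->
       weak_existence f kappa sigma x0 eps delta /\
       weak_uniqueness f kappa sigma x0 eps delta)
    (hA1 : assumption_A1 f kappa sigma)
    (hA2 : assumption_A2 kappa sigma)
    (hx : ode_solution f kappa x0 x)
    (hA3 : assumption_A3 f kappa x)
    (hc : 0 <= c) (hp : (1 <= p)%N) :
  exists C : R, 0 < C /\
    forall (d : measure_display) (T : measurableType d) (P : probability T R)
      (F : R -> set_system T) (W Z : R -> T -> R) (delta_ : R -> R),
      is_filtration F -> is_brownian_motion P F W ->
      limit_solution f kappa sigma x c P F W Z ->
      (forall eps : R, 0 < eps -> 0 < delta_ eps) ->
      delta_ eps / eps @[eps --> 0^'+] --> c ->
      \forall eps \near 0^'+, forall X : R -> T -> R,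
        let delta := delta_ eps in
        let Zeps := fun t w => eps^-1 * (X t w - x t) in
        sde_solution f kappa sigma x0 eps delta P F W X ->
        (ereal_sup [set 'E_P[(fun w => `|Zeps t w - Z t w| ^+ p)%R]
                     | t in `[0%R, +oo[]
         = ((eps ^+ p)^-1)%:E *
           ereal_sup [set 'E_P[(fun w => `|X t w - x t - eps * Z t w| ^+ p)%R]
                     | t in `[0%R, +oo[])%E /\
        (ereal_sup [set 'E_P[(fun w => `|Zeps t w - Z t w| ^+ p)%R]
                     | t in `[0%R, +oo[]
         <= (C * (delta ^+ (2 * p) / eps ^+ p
                  + `|delta / eps - c| ^+ p
                  + (delta ^+ p / eps ^+ p + 1)
                    * Num.sqrt (delta ^+ p + eps ^+ p
                                + delta `^ (p%:R / 2) * eps ^+ p)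
                  + delta `^ (p%:R / 2) + eps ^+ p))%:E)%E.
Proof.
have [a [K [r fb]]] := flow_bounds_exist hA1 hA2 hx hA3.
have L0 : 0 < c + 1 by rewrite ltr_wpDl.
have [mD HD] := linearization_error_momO c fb L0.
have [C0 [C00 HC]] := HD p hp.
have C2 : 0 <= 2 ^+ p * C0 by rewrite mulr_ge0// exprn_ge0.
exists (2 ^+ p * C0 + 1); split; first by rewrite ltr_wpDl.
move=> d T P F W Z delta_ hF hW [aZ cZ [N [IN ZN]]] del0 dlim.
have e_gt0 : \forall eps \near (0 : R)^'+, 0 < eps by exact: nbhs_right_gt.
have e_le1 : \forall eps \near (0 : R)^'+, eps < 1 by exact: nbhs_right_lt.
have d_le : \forall eps \near (0 : R)^'+, `|c - delta_ eps / eps| < 1.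
  by move/cvgrPdist_lt : dlim; apply.
apply: filterS3 e_gt0 e_le1 d_le => eps e0 e1 de X.
move=> [aX cX [M [IM XM]]].
set delta := delta_ eps in IM XM *.
pose Zeps t w := eps^-1 * (X t w - x t).
have dpos : 0 < delta := del0 _ e0.
have dle : delta <= (c + 1) * eps.
  rewrite -ler_pdivrMr//; move: de; rewrite ltr_norml => /andP[h _]; rewrite -/delta in h *; lra.
pose i : config f kappa sigma x x0 c (c + 1) :=
  Config hF hW e0 (ltW e1) dpos dle aX cX IM XM aZ cZ IN ZN.
pose D t w := X t w - x t - eps * Z t w.
have ep : 0 < eps ^+ p by rewrite exprn_gt0.
have E2 t : 0 <= t -> ('E_P[(fun w => `|D t w| ^+ p)%R] <=
    (C0 * (eps * Num.sqrt eps + `|delta - eps * c|) ^+ p)%:E)%E.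
  by move=> t0; rewrite unlock; exact: (HC i t t0).
have E1 t : 0 <= t -> ('E_P[(fun w => `|Zeps t w - Z t w| ^+ p)%R] =
    ((eps ^+ p)^-1)%:E * 'E_P[(fun w => `|D t w| ^+ p)%R])%E.
  move=> t0; rewrite unlock -ge0_integralZl//.
  - apply: eq_integral => w _; rewrite -EFinM; congr EFin.
    have -> : Zeps t w - Z t w = eps^-1 * D t w.
      by rewrite /Zeps /D; field; rewrite gt_eqF.
    by rewrite normrM exprMn ger0_norm ?exprVn// invr_ge0 ltW.
  - apply/measurable_EFinP; apply: measurable_funX; apply: measurableT_comp => //.
    exact: (mD i t t0).
  by rewrite lee_fin invr_ge0 ltW.
have Eset : [set ('E_P[(fun w => `|Zeps t w - Z t w| ^+ p)%R])%E | t in `[0, +oo[]%classic =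
    [set (((eps ^+ p)^-1)%:E * y)%E | y in
      [set ('E_P[(fun w => `|D t w| ^+ p)%R])%E | t in `[0, +oo[]%classic]%classic.
  rewrite image_comp; apply: eq_imagel => t; rewrite /= in_itv/= andbT => t0.
  exact: E1.
split; first by rewrite Eset ereal_sup_pZl// invr_gt0.
apply: ge_ereal_sup => _ [t /= t0 <-]; move: t0; rewrite in_itv/= andbT => t0.
rewrite E1//; apply: (@le_trans _ _ (((eps ^+ p)^-1)%:E *
    (C0 * (eps * Num.sqrt eps + `|delta - eps * c|) ^+ p)%:E)%E).
  by apply: lee_wpmul2l; [rewrite lee_fin invr_ge0 ltW|exact: E2].
rewrite -EFinM lee_fin.
apply: (@le_trans _ _ ((eps ^+ p)^-1 * (C0 * (eps ^+ p * (2 ^+ p *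
    (Num.sqrt (eps ^+ p) + `|delta / eps - c| ^+ p)))))).
  apply: ler_wpM2l; first by rewrite invr_ge0 ltW.
  by apply: ler_wpM2l => //; exact: rate_expr_le.
rewrite [leLHS](_ : _ = 2 ^+ p * C0 * (Num.sqrt (eps ^+ p) + `|delta / eps - c| ^+ p)); last first.
  by field; rewrite expf_neq0// gt_eqF.
apply: ler_pM => //; last exact: rate_le_bound.
by rewrite lerDl.
Qed.
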